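(* The following statements hold. (1) The following two assertions (A) and (B) are equivalent. (A) For every separable infinite-dimensional Hilbert space $H$ and every sequence $T_1\ge T_2\ge\cdots$ of positive linear contractions on $H$, the sequence $S_n:=T_nT_{n-1}\cdots T_1$ converges in the strong operator topology. (B) For every separable infinite-dimensional Hilbert space $H$ and every sequence $T_1\ge T_2\ge\cdots$ of positive linear contractions on $H$, with $S_n:=T_nT_{n-1}\cdots T_1$, $T:=\lim_{n\to\infty}T_n$ (limit in the strong operator topology) and $P:=1_{\{1\}}(T)$, one has $\lim_{n\to\infty}S_n=P$ $*$-strongly. (2) Let $H$ be a separable infinite-dimensional Hilbert space, let $T_1\ge T_2\ge\cdots$ be a sequence of positive linear contractions on $H$, and let $S_n:=T_nT_{n-1}\cdots T_1$. If one of the following two conditions is satisfied, then the sequence $(S_n)_{n=1}^\infty$ converges in the strong operator topology: (2-i) $1$ is not in the essential spectrum of $T_n$ for some $n\in\mathbb{N}$; (2-ii) $\{T_1,T_2,\dots\}$ generates a finite von Neumann algebra.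
   Context: A positive contraction on $H$ is a bounded self-adjoint operator $T$ with $0\le T\le 1$, i.e. $0\le\langle T\xi,\xi\rangle\le\|\xi\|^2$ for all $\xi\in H$; $T\ge T'$ means that $T-T'$ is positive. A non-increasing sequence of positive operators always converges in the strong operator topology, so $T=\lim_n T_n$ exists. For a Borel set $A\subset\mathbb{R}$, $1_A(T)$ denotes the spectral projection of the self-adjoint operator $T$ corresponding to $A$; thus $1_{\{1\}}(T)$ is the orthogonal projection onto $\ker(T-1)$. Convergence $S_n\to P$ $*$-strongly means $\|S_n\xi-P\xi\|\to0$ and $\|S_n^*\xi-P^*\xi\|\to0$ for every $\xi\in H$. The essential spectrum of a bounded self-adjoint operator is the set of points of its spectrum which are not isolated eigenvalues of finite multiplicity. A von Neumann algebra is finite if each of its isometries is a unitary ($v^*v=1$ implies $vv^*=1$). *)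

(* Defs.v *)
From HB Require Import structures.
From mathcomp Require Import all_boot all_order all_algebra.
From mathcomp Require Import complex.
From mathcomp Require Import all_classical all_reals all_analysis.

Set Implicit Arguments.
Unset Strict Implicit.
Unset Printing Implicit Defensive.

Import Order.TTheory GRing.Theory Num.Theory.
Import numFieldNormedType.Exports.

Local Open Scope classical_set_scope.
Local Open Scope ring_scope.
Local Open Scope complex_scope.

(* Complex Hilbert spaces; inner products are linear on the left and
   conjugate-linear on the right, and norms take values in R[i]. *)
HB.mixin Record CompleteNormedModule_isHilbert (R : realType) H
    of CompleteNormedModule R[i] H := {
  inner : {dot H for (@Num.conj R[i])};
  sqr_norm_inner : forall x : H, `|x| ^+ 2 = inner x x
}.

#[short(type="hilbertType")]
HB.structure Definition Hilbert (R : realType) :=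
  {H of CompleteNormedModule_isHilbert R H & CompleteNormedModule R[i] H}.

Section HilbertSpaces.
Context {R : realType} {H : hilbertType R}.
Implicit Types (T A B : H -> H) (M : set (H -> H)) (V : set H) (x y z : H).

Definition separable_space := exists2 D : set H, countable D & dense D.

Definition finite_dimensional V :=
  exists (n : nat) (b : 'I_n -> H), forall x, V x ->
    exists c : 'I_n -> R[i], x = \sum_(i < n) c i *: b i.

Definition bounded_operator T :=
  linear T /\ exists C : R[i], forall x, `|T x| <= C * `|x|.

(* By the Riesz representation theorem, the set is a singleton when T is a
   bounded operator. *)
Definition adjoint T : H -> H :=
  fun y => xget 0 [set z | forall x, inner (T x) y = inner x z].

Definition self_adjoint T := bounded_operator T /\ adjoint T = T.

Definition positive_operator T :=
  self_adjoint T /\ forall x, 0 <= inner (T x) x.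

Definition operator_le A B := positive_operator (B \- A).

Definition positive_contraction T :=
  positive_operator T /\ forall x, inner (T x) x <= `|x| ^+ 2.

Definition orthogonal_projection T := self_adjoint T /\ T \o T = T.

Definition strong_cvg_to (S : nat -> H -> H) T :=
  forall x, S n x @[n --> \oo] --> T x.

Definition strong_cvg (S : nat -> H -> H) :=
  exists2 T, bounded_operator T & strong_cvg_to S T.

Definition strong_lim (S : nat -> H -> H) : H -> H :=
  fun x => lim (S n x @[n --> \oo]).

Definition star_strong_cvg_to (S : nat -> H -> H) T :=
  strong_cvg_to S T /\ strong_cvg_to (fun n => adjoint (S n)) (adjoint T).

(* Indices start at 0: T n stands for the (n+1)-st operator of the sequence. *)
Fixpoint ordered_product (T : nat -> H -> H) (n : nat) : H -> H :=
  if n is m.+1 then T m.+1 \o ordered_product T m else T 0%N.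

Definition decreasing_contractions (T : nat -> H -> H) :=
  (forall n, positive_contraction (T n)) /\
  (forall n, operator_le (T n.+1) (T n)).

(* E is the spectral measure of the self-adjoint operator T: a projection-valued
   measure on the Borel subsets of R such that T is the integral of t against
   dE(t). Countable additivity and the integral are expressed through the
   scalar measures U |-> <E U x, x>. *)
Definition spectral_measure T (E : set (measurableTypeR R) -> H -> H) :=
  [/\ forall U, measurable U -> orthogonal_projection (E U),
      E setT = idfun,
      forall U W, measurable U -> measurable W -> E (U `&` W) = E U \o E W &
      forall x, exists mu : {finite_measure set (measurableTypeR R) -> \bar R},
        [/\ forall U, measurable U -> inner (E U x) x = (fine (mu U))%:C,
            mu.-integrable setT (fun t : measurableTypeR R => (t : R)%:E) &
            inner (T x) x = (\int[mu]_(t in setT) (t : R))%:C]].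

(* By the spectral theorem, a self-adjoint operator has exactly one spectral
   measure (up to its values on non-Borel sets). *)
Definition spectral_projection T (U : set R) : H -> H :=
  xget (fun _ : set (measurableTypeR R) => (fun x : H => x)) (spectral_measure T) U.

Definition spectrum T : set R[i] :=
  [set l | ~ exists B, [/\ bounded_operator B,
     B \o (fun x => T x - l *: x) = idfun &
     (fun x => T x - l *: x) \o B = idfun]].

Definition eigenspace_of T (l : R[i]) : set H := [set x | T x = l *: x].

Definition eigenvalue_of T (l : R[i]) := exists2 x, eigenspace_of T l x & x != 0.

Definition essential_spectrum T : set R[i] :=
  spectrum T `\` [set l | [/\ isolated (spectrum T : set R[i]^o) l, eigenvalue_of T l &
                              finite_dimensional (eigenspace_of T l)]].

(* Unital *-subalgebra of B(H) closed in the strong operator topology; B(H) is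
   not closed in {ptws H -> H}, hence the boundedness condition. *)
Definition von_neumann_algebra M :=
  [/\ forall T, M T -> bounded_operator T,
      M idfun,
      forall (l : R[i]) A B, M A -> M B -> M (fun x => l *: A x + B x),
      forall A B, M A -> M B -> M (A \o B) &
      forall A, M A -> M (adjoint A)] /\
  (forall T, bounded_operator T ->
     closure (M : set {ptws H -> H}) (T : {ptws H -> H}) -> M T).

Definition finite_von_neumann_algebra M :=
  von_neumann_algebra M /\
  forall v, M v -> adjoint v \o v = idfun -> v \o adjoint v = idfun.

Definition generated_von_neumann_algebra (S : set (H -> H)) : set (H -> H) :=
  smallest von_neumann_algebra S.

End HilbertSpaces.

Arguments separable_space {R} H.

(* Main.v *)
(* Let T be the limit of T_1 >= T_2 >= ... and P the projection onto ker(T - 1).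
   Since |T_1 ... T_n x| <= |T_(n-k) ... T_n x| and the right-hand side tends to
   |T^(k+1) x| as n grows, which is small for large k when x is orthogonal to
   ker(T - 1), S_n^* -> P strongly; hence S_n -> P weakly, and P is the only
   possible strong limit of S_n. That P = 1_{1}(T) requires the spectral
   theorem: the projections cutting T at each level l form an increasing right
   continuous family, whose Lebesgue-Stieltjes measures yield the spectral measure.

   (2-i) |(1 - T_n) S_m x| -> 0 as m grows. A gap of 1 - T_n above 0 makes the
   part of S_m x orthogonal to ker(1 - T_n) small, and on this finite dimensional
   kernel weak convergence is strong.

   (2-ii) S'_n = S_n - P satisfies S'_n^* -> 0, and S'_n^* S'_n decreases to some
   A. If A <> 0, then, after passing to a fast subsequence and multiplying on the
   right by a suitable D, one gets W_j with almost orthogonal consecutive ranges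
   and W_j^* W_j almost equal to K = D A D <> 0. Cayley transforms of the rotations
   taking the range of W_j to that of W_(j+1) are unitaries of the algebra tending
   to 1 summably on a dense set. The infinite product of their inverses is an
   isometry, hence a unitary by finiteness, although it should move W_j (f y) to
   infinity, a contradiction. *)

Require Import Defs.
From HB Require Import structures.
From mathcomp Require Import all_boot all_order all_algebra.
From mathcomp Require Import complex.
From mathcomp Require Import all_classical all_reals all_analysis.
From mathcomp Require Import measurable_realfun.
From mathcomp Require Import ring lra.

Set Implicit Arguments.
Unset Strict Implicit.
Unset Printing Implicit Defensive.

Import Order.TTheory GRing.Theory Num.Theory.
Import numFieldNormedType.Exports.

Local Open Scope classical_set_scope.
Local Open Scope ring_scope.
Local Open Scope complex_scope.

(** * The real inner product and bounded operators *)

(** Only [S_n^*] is under control at first, and its strong convergence says nothing about [S_n],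
    because taking adjoints is not strongly continuous. Finiteness repairs this for one sequence of
    unitaries: a strong limit [v] of unitaries [V_n] is an isometry, and once [v] is onto, [V_n^*]
    converges strongly to [v^*]. The vectors [V_n^* W_J (f y)] then converge in norm, although they
    follow [W_(J+n) (f y)], which is weakly null with norms tending to a positive limit. Strong
    convergence makes errors small at one vector at a time, and such bounds do not pass to adjoints.
    Damping by D turns them into operator norm bounds, which do, and which can be summed.
    Projections, square roots, inverses and D all arise as strong limits of sequences of polynomials
    in operators already available. This replaces functional calculus, keeps each of them inside the
    given algebra, and serves the spectral theorem as well as (2-ii). *)

Section RealInnerProduct.
Context {R : realType} {H : hilbertType R}.
Implicit Types (x y z : H) (a b : R).

(* The Hilbert space is used mostly through its underlying real inner product
   and real-valued norm, so that estimates take place in R rather than R[i]. *)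
Definition ip x y : R := complex.Re (inner x y).
Definition nrm x : R := complex.Re `|x|.

Lemma nrmE x : `|x| = (nrm x)%:C.
Proof.
have := normr_ge0 x; rewrite /nrm; case: `|x| => a b; rewrite lecE /=.
by case/andP => /eqP -> _.
Qed.

Lemma nrm_ge0 x : 0 <= nrm x.
Proof. by rewrite -ler0c -nrmE normr_ge0. Qed.

Lemma nrm0_eq0 x : nrm x = 0 -> x = 0.
Proof. by move=> x0; apply/normr0_eq0; rewrite nrmE x0. Qed.

Lemma nrm0 : nrm 0 = 0.
Proof. by apply: complexI; rewrite -nrmE normr0. Qed.

Lemma nrm_gt0 x : x != 0 -> 0 < nrm x.
Proof.
move=> x0; rewrite lt_def nrm_ge0 andbT; apply: contra x0 => /eqP.
by move=> /nrm0_eq0 ->.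
Qed.

Lemma nrmD x y : nrm (x + y) <= nrm x + nrm y.
Proof. by rewrite -lecR rmorphD /= -!nrmE ler_normD. Qed.

Lemma nrmN x : nrm (- x) = nrm x.
Proof. by rewrite /nrm normrN. Qed.

Lemma nrmBC x y : nrm (x - y) = nrm (y - x).
Proof. by rewrite -nrmN opprB. Qed.

Lemma nrmB x y : nrm (x - y) <= nrm x + nrm y.
Proof. by rewrite -(nrmN y) nrmD. Qed.

Lemma nrm_tri z x y : nrm (x - y) <= nrm (x - z) + nrm (z - y).
Proof. by rewrite -{1}(subrK z x) -addrA nrmD. Qed.

Lemma innerC x y : inner x y = (inner y x)^*.
Proof. by rewrite {1}hermC expr0 mul1r. Qed.

Lemma ipC x y : ip x y = ip y x.
Proof. by rewrite /ip innerC; case: (inner y x). Qed.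

Lemma ReD (u v : R[i]) : complex.Re (u + v) = complex.Re u + complex.Re v.
Proof. by case: u; case: v. Qed.

Lemma ReN (u : R[i]) : complex.Re (- u) = - complex.Re u.
Proof. by case: u. Qed.

Lemma ipDl x y z : ip (x + y) z = ip x z + ip y z.
Proof. by rewrite /ip linearDl ReD. Qed.

Lemma ipNl x z : ip (- x) z = - ip x z.
Proof. by rewrite /ip linearNl ReN. Qed.

Lemma ipBl x y z : ip (x - y) z = ip x z - ip y z.
Proof. by rewrite ipDl ipNl. Qed.

Lemma ipZl a x z : ip (a%:C *: x) z = a * ip x z.
Proof.
rewrite /ip linearZl_LR /=; case: (inner x z) => u v /=.
by rewrite mul0r subr0.
Qed.

Lemma ip0l x : ip 0 x = 0.
Proof. by rewrite /ip linear0l. Qed.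

Lemma ipDr x y z : ip z (x + y) = ip z x + ip z y.
Proof. by rewrite !(ipC z) ipDl. Qed.

Lemma ipNr x z : ip z (- x) = - ip z x.
Proof. by rewrite !(ipC z) ipNl. Qed.

Lemma ipBr x y z : ip z (x - y) = ip z x - ip z y.
Proof. by rewrite ipDr ipNr. Qed.

Lemma ipZr a x z : ip z (a%:C *: x) = a * ip z x.
Proof. by rewrite !(ipC z) ipZl. Qed.

Lemma ip0r x : ip x 0 = 0.
Proof. by rewrite ipC ip0l. Qed.

Definition ipE := (ipDl, ipDr, ipNl, ipNr, ipZl, ipZr, ip0l, ip0r).

Lemma ipxx x : ip x x = nrm x ^+ 2.
Proof.
by apply: complexI; rewrite rmorphXn /= -nrmE sqr_norm_inner /ip RRe_real //
  ger0_real // dnorm_ge0.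
Qed.

(** By conjugate-linearity on the right, [inner x ('i *: y)] is [-i] times [inner x y]; hence [ip]
    alone determines [inner]. *)
Lemma inner_ip x y : inner x y = ip x y +i* ip x ('i *: y).
Proof.
rewrite /ip linearZr_LR /=; case: (inner x y) => u v /=.
by rewrite /Num.conj /=; congr (_ +i* _); rewrite !mul0r sub0r mulN1r opprK.
Qed.

Lemma ip_ii x y : ip ('i *: x) ('i *: y) = ip x y.
Proof.
rewrite /ip linearZl_LR linearZr_LR /=; case: (inner x y) => u v /=.
by ring.
Qed.

Lemma ip_inj x y : (forall z, ip x z = ip y z) -> x = y.
Proof.
move=> h; apply/eqP; rewrite -subr_eq0; apply/eqP/nrm0_eq0/eqP.
by rewrite -sqrf_eq0 -ipxx ipBl h subrr.
Qed.

Lemma nrmZ a x : nrm (a%:C *: x) = `|a| * nrm x.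
Proof.
apply: complexI; rewrite -nrmE normrZ nrmE rmorphM /= normc_def /=.
by rewrite expr0n addr0 sqrtr_sqr.
Qed.

Lemma quad_disc a b (c : R) :
  0 <= c -> (forall t, 0 <= a + 2 * t * b + t ^+ 2 * c) -> b ^+ 2 <= a * c.
Proof.
move=> c0 h; have [c00|cn0] := eqVneq c 0.
  have [->|b0] := eqVneq b 0; first by rewrite c00; lra.
  (* For [c = 0] the expression is affine in t; at this t it would equal -1. *)
  have := h (- (a + 1) / (2 * b)); rewrite c00 mulr0 addr0.
  by rewrite (_ : 2 * _ * b = - (a + 1)); [lra|field].
have cp : 0 < c by rewrite lt_def cn0.
have := h (- b / c); rewrite -(pmulr_lge0 _ cp).
rewrite (_ : (a + _ + _) * c = a * c - b ^+ 2); last by field.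
by rewrite subr_ge0.
Qed.

Lemma ip_sqr x y : ip x y ^+ 2 <= nrm x ^+ 2 * nrm y ^+ 2.
Proof.
apply: quad_disc => [|t]; first exact: sqr_ge0.
have := sqr_ge0 (nrm (x + t%:C *: y)); rewrite -!ipxx !ipE (ipC y x); lra.
Qed.

Lemma ip_le x y : `|ip x y| <= nrm x * nrm y.
Proof.
rewrite -(@ler_pXn2r _ 2) ?nnegrE ?mulr_ge0 ?nrm_ge0 //.
by rewrite exprMn real_normK ?num_real // ip_sqr.
Qed.

Lemma nrm_le x y : nrm x ^+ 2 <= nrm y ^+ 2 -> nrm x <= nrm y.
Proof. by rewrite ler_pXn2r ?nnegrE ?nrm_ge0. Qed.

Lemma nrm_le_sqr x a : 0 <= a -> nrm x ^+ 2 <= a ^+ 2 -> nrm x <= a.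
Proof. by move=> a0; rewrite ler_pXn2r ?nnegrE ?nrm_ge0. Qed.

Lemma cvg_nrmP (u : nat -> H) (l : H) :
  u @ \oo --> l <-> (fun n => nrm (u n - l)) @ \oo --> (0 : R).
Proof.
split=> [/cvgrPdist_lt h|/cvgrPdist_lt h].
- apply/cvgrPdist_lt => e e0; have /h : 0 < e%:C by rewrite ltcR.
  apply: filterS => n; rewrite nrmE ltcR sub0r normrN ger0_norm ?nrm_ge0 //.
  by rewrite nrmBC.
- apply/cvgrPdist_lt => -[e e']; rewrite ltcE /= => /andP[/eqP -> /h].
  apply: filterS => n; rewrite nrmE ltcR sub0r normrN ger0_norm ?nrm_ge0 //.
  by rewrite nrmBC.
Qed.

Lemma cvg_eventually (a : nat -> R) (l : R) :
  a @ \oo --> l <->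
  forall e : R, 0 < e -> exists n0, forall n, (n0 <= n)%N -> `|a n - l| < e.
Proof.
split=> [/cvgrPdist_lt h e /h[n0 _ hn]|h].
  by exists n0 => n n0n; rewrite distrC; exact: hn.
apply/cvgrPdist_lt => e /h[n0 hn]; exists n0 => // n /= n0n.
by rewrite distrC; exact: hn.
Qed.

Lemma cvg_vec (u : nat -> H) (l : H) : u @ \oo --> l <->
  forall e : R, 0 < e -> exists n0, forall n, (n0 <= n)%N -> nrm (u n - l) < e.
Proof.
rewrite cvg_nrmP cvg_eventually; split=> h e /h[n0 hn]; exists n0 => n /hn;
  by rewrite subr0 ger0_norm ?nrm_ge0.
Qed.

Lemma cauchy_vec (u : nat -> H) :
  (forall e : R, 0 < e -> exists n0, forall m n, (n0 <= m)%N -> (m <= n)%N ->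
     nrm (u n - u m) < e) ->
  exists l : H, u @ \oo --> l.
Proof.
move=> h; suff: cvg (u @ \oo) by move=> ?; exists (lim (u @ \oo)).
apply: cauchy_cvg; apply/cauchyP => -[e e'].
rewrite ltcE /= => /andP[/eqP -> /h[n0 hn]].
exists (u n0); exists n0 => // n /= n0n; rewrite -ball_normE /= nrmE ltcR.
by rewrite nrmBC; exact: hn.
Qed.

Lemma cvg_ip (u v : nat -> H) (l m : H) : u @ \oo --> l -> v @ \oo --> m ->
  (fun n => ip (u n) (v n)) @ \oo --> ip l m.
Proof.
move=> /cvg_nrmP ul /cvg_nrmP vm.
have -> : (fun n => ip (u n) (v n)) = (fun n => ip l m + (ip (u n - l) m +
    (ip l (v n - m) + ip (u n - l) (v n - m)))).
  by apply/funext => n; rewrite !ipE; ring.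
rewrite -[X in _ --> X]addr0; apply: cvgD; first exact: cvg_cst.
suff sq (a b : nat -> H) (p q : H) :
    (fun n => nrm (a n) * nrm (b n)) @ \oo --> (0 : R) ->
    (fun n => ip (a n) (b n)) @ \oo --> (0 : R).
  rewrite -[X in _ --> X](addr0 (0 : R)); apply: cvgD.
    apply: sq => //; rewrite -(mul0r (nrm m)).
    by apply: cvgM => //; exact: cvg_cst.
  rewrite -[X in _ --> X](addr0 (0 : R)); apply: cvgD.
    apply: sq => //; rewrite -(mulr0 (nrm l)).
    by apply: cvgM => //; exact: cvg_cst.
  by apply: sq => //; rewrite -(mulr0 (0 : R)); exact: cvgM.
move=> h; apply/norm_cvg0P; apply: (squeeze_cvgr _ (@cvg_cst _ _ _ _ _) h).
by near=> n; rewrite normr_ge0 ip_le.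
Unshelve. all: by end_near. Qed.

Lemma cvg_nrm (u : nat -> H) (l : H) : u @ \oo --> l ->
  (fun n => nrm (u n)) @ \oo --> nrm l.
Proof.
move=> /cvg_vec ul; apply/cvg_eventually => e /ul[n0 hn]; exists n0 => n /hn.
apply: le_lt_trans; have := nrm_tri (u n) l 0; have := nrm_tri l (u n) 0.
by rewrite !subr0 (nrmBC l) ler_norml => h1 h2; apply/andP; split; lra.
Qed.

Lemma cvg_nrm_le (u : nat -> H) (l : H) a : u @ \oo --> l ->
  (exists n0, forall n, (n0 <= n)%N -> nrm (u n) <= a) -> nrm l <= a.
Proof.
move=> /cvg_nrm ul [n0 hn]; apply: (@cvgr_to_le _ _ _ _ _ _ _ ul).
by exists n0.
Qed.

Lemma cvg_vec_unique (u : nat -> H) (l m : H) :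
  u @ \oo --> l -> u @ \oo --> m -> l = m.
Proof. by move=> ul um; exact: (cvg_unique _ ul um). Qed.

End RealInnerProduct.

(** * Riesz representation by minimisation *)

Section Riesz.
Context {R : realType} {H : hilbertType R}.

Lemma cvg_to_ge (a : nat -> R) (l b : R) :
  a @ \oo --> l -> (forall n, b <= a n) -> b <= l.
Proof. by move=> al h; apply: (cvgr_to_ge al); exact: nearW. Qed.

Lemma cvg_to_le (a : nat -> R) (l b : R) :
  a @ \oo --> l -> (forall n, a n <= b) -> l <= b.
Proof. by move=> al h; apply: (cvgr_to_le al); exact: nearW. Qed.

Lemma harmonic_lt (e : R) : 0 < e ->
  exists n0, forall n, (n0 <= n)%N -> n.+1%:R^-1 < e :> R.
Proof.
move=> e0; have /cvg_eventually/(_ e e0)[n0 hn] := @cvg_harmonic R.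
by exists n0 => n /hn; rewrite subr0 ger0_norm ?harmonic_ge0.
Qed.

(** The representing vector minimises [J x = |x|^2 - 2 f x]: minimising sequences are Cauchy, and
    the first variation of J at the limit z in direction h is [2 (ip z h - f h)]. *)
Lemma riesz (f : H -> R) (C : R) :
  (forall x y, f (x + y) = f x + f y) ->
  (forall a x, f (a%:C *: x) = a * f x) ->
  (forall x, `|f x| <= C * nrm x) ->
  exists z, forall x, f x = ip x z.
Proof.
move=> fD fZ fb; pose J x := nrm x ^+ 2 - 2 * f x.
have JD x t h : J (x + t%:C *: h) =
    J x + 2 * t * (ip x h - f h) + t ^+ 2 * nrm h ^+ 2.
  by rewrite /J -!ipxx !ipE (ipC h x) fD fZ; ring.
have Jlb x : - C ^+ 2 <= J x.
  have := fb x; rewrite ler_norml => /andP[_ h]; have := sqr_ge0 (nrm x - C).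
  by rewrite /J; nra.
pose S := [set J x | x in [set: H]].
have S0 : S !=set0 by exists (J 0), 0.
have Slb : has_lbound S by exists (- C ^+ 2) => _ [x _ <-].
pose m := inf S.
have mJ x : m <= J x by apply: ge_inf => //; exists x.
have exS n : exists x, J x < m + n.+1%:R^-1.
  have : 0 < n.+1%:R^-1 :> R by [].
  move=> /(@inf_adherent _ S) /(_ (conj S0 Slb)) [_ [x _ <-] h].
  by exists x.
have [u Ju] := choice exS.
(* Parallelogram law: the left side equals [2 (J x + J y) - 4 J] of the midpoint, and J is at least
   m there. *)
have mid x y : nrm (x - y) ^+ 2 <= 2 * (J x + J y) - 4 * m.
  have := mJ (y + 2^-1%:C *: (x - y)); rewrite JD /J -!ipxx.
  rewrite -[x - y]/(x + - y) !ipE (_ : f (x - y) = f x - f y); last first.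
    have := fZ (- 1) y; rewrite (_ : (-1)%:C = -1) ?rmorphN1 // scaleN1r.
    by rewrite fD => ->; ring.
  by rewrite (ipC x y); lra.
have [z uz] : exists z : H, u @ \oo --> z.
  apply: cauchy_vec => e e0.
  have [n0 hn] : exists n0, forall n, (n0 <= n)%N -> n.+1%:R^-1 < e ^+ 2 / 4 :> R.
    by apply: harmonic_lt; rewrite divr_gt0 ?exprn_gt0.
  exists n0 => p q n0p pq; rewrite -(@ltr_pXn2r _ 2) ?nnegrE ?nrm_ge0 ?ltW //.
  apply: (le_lt_trans (mid _ _)).
  have := hn _ n0p; have := hn _ (leq_trans n0p pq).
  have := Ju p; have := Ju q.
  by move: (p.+1%:R^-1) (q.+1%:R^-1) => a b; lra.
exists z => h; apply/esym/eqP; rewrite -subr_eq0 ipC -sqrf_eq0 eq_le sqr_ge0 andbT.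
(* With constant term 0, the discriminant bound reads [(ip z h - f h)^2 <= 0]. The constant term is
   the limit of the defects [n.+1%:R^-1] of [u n]. *)
rewrite -(mul0r (nrm h ^+ 2)); apply: quad_disc => [|t]; first exact: sqr_ge0.
have lim : (fun n => n.+1%:R^-1 + 2 * t * (ip (u n) h - f h) + t ^+ 2 * nrm h ^+ 2)
    @ \oo --> 0 + 2 * t * (ip z h - f h) + t ^+ 2 * nrm h ^+ 2.
  apply: cvgD; last exact: cvg_cst.
  apply: cvgD; first exact: cvg_harmonic.
  apply: cvgMr; apply: cvgB; last exact: cvg_cst.
  by apply: cvg_ip => //; exact: cvg_cst.
apply: (cvg_to_ge lim) => n; have := mJ (u n + t%:C *: h); rewrite JD.
by have := Ju n; move: (n.+1%:R^-1) => a; lra.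
Qed.

End Riesz.

(** * The ring of bounded operators with adjoints *)

Section Operators.
Context {R : realType} {H : hilbertType R}.

(** The adjoint is carried as data so that the rules for [star] hold by computation; it is
    determined by [opf], see [op_ext]. The relation is stated for [ip] only, and complex linearity
    recovers it for [inner], see [adjointE]. *)
Record op := Op {
  opf :> H -> H;
  opadj : H -> H;
  op_linear : linear opf;
  op_adjP : forall x y, ip (opf x) y = ip x (opadj y);
  op_bounded : exists C : R, forall x, nrm (opf x) <= C * nrm x }.

Implicit Types (A B : op) (x y z : H) (a : R).

Lemma opZc A (c : R[i]) x : A (c *: x) = c *: A x.
Proof.
have A0 : A 0 = 0.
  have := op_linear A 1 0 0; rewrite !scale1r addr0 => /eqP.
  by rewrite -subr_eq0 opprD addNKr oppr_eq0 => /eqP.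
by have := op_linear A c x 0; rewrite !addr0 A0 addr0.
Qed.

Lemma opD A x y : A (x + y) = A x + A y.
Proof. by have := op_linear A 1 x y; rewrite !scale1r. Qed.

Lemma opN A x : A (- x) = - A x.
Proof. by rewrite -scaleN1r opZc scaleN1r. Qed.

Lemma opB A x y : A (x - y) = A x - A y.
Proof. by rewrite opD opN. Qed.

Lemma op0 A : A 0 = 0.
Proof. by rewrite -[in LHS](scale0r (0 : H)) opZc scale0r. Qed.

Lemma op_ext A B : (forall x, A x = B x) -> A = B.
Proof.
case: A B => f f' fl fa fb [g g' gl ga gb] /= fg.
have {}fg : f = g by apply/funext.
rewrite -fg in gl ga gb *; have f'g' : f' = g'.
  by apply/funext => y; apply: ip_inj => z; rewrite !(ipC _ z) -fa ga.
by rewrite -f'g' in ga *; congr Op; exact: Prop_irrelevance.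
Qed.

Lemma opbd A : exists2 C : R, 0 < C & forall x, nrm (A x) <= C * nrm x.
Proof.
have [C hC] := op_bounded A; exists (`|C| + 1); first by rewrite ltr_wpDl.
move=> x; apply: (le_trans (hC x)); rewrite ler_wpM2r ?nrm_ge0 //.
by have := ler_norm C; lra.
Qed.

Lemma op_of (f g : H -> H) :
  (forall x y, f (x + y) = f x + f y) ->
  (forall (c : R[i]) x, f (c *: x) = c *: f x) ->
  (forall x y, ip (f x) y = ip x (g y)) ->
  (exists C : R, forall x, nrm (f x) <= C * nrm x) -> { A : op | forall x, A x = f x }.
Proof.
move=> fD fZ fg fb; have fl : linear f by move=> c x y; rewrite fD fZ.
by exists (Op fl fg fb).
Qed.

Lemma opadj_bounded A : exists C : R, forall y, nrm (opadj A y) <= C * nrm y.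
Proof.
have [C C0 hC] := opbd A; exists C => y.
have := hC (opadj A y); have := ip_le (A (opadj A y)) y.
rewrite op_adjP ipxx ger0_norm ?sqr_ge0 // => h1 h2.
have [->|yn0] := eqVneq (nrm (opadj A y)) 0; first by rewrite mulr_ge0 ?nrm_ge0 ?ltW.
have yp : 0 < nrm (opadj A y) by rewrite lt_def yn0 nrm_ge0.
rewrite -(ler_pM2l yp) -expr2; apply: (le_trans h1).
by rewrite mulrCA mulrA ler_wpM2r ?nrm_ge0.
Qed.

Lemma opadj_linear A : linear (opadj A).
Proof.
move=> c x y; apply: ip_inj => z; rewrite !(ipC _ z) -op_adjP !ipDr -op_adjP.
congr (_ + _); case: c => p q.
have E (u : H) : (p +i* q) *: u = p%:C *: u + q%:C *: ('i *: u).
  rewrite scalerA -scalerDl; congr (_ *: _).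
  by apply/eqP; rewrite eq_complex /= !(mulr0, mulr1, mul0r, add0r, subr0, addr0) !eqxx.
rewrite !E !ipE -op_adjP; congr (_ + q * _).
(* Multiplying both arguments by ['i] moves the factor ['i] to the argument of [A], where linearity
   applies. *)
rewrite -ip_ii -[RHS]ip_ii !scalerA -expr2 sqr_i !scaleN1r !ipNr.
by rewrite -opZc op_adjP.
Qed.

(** The value of the adjoint at y is the Riesz vector of the real functional [x |-> ip (f x) y]. *)
Lemma op_of_bounded (f : H -> H) : bounded_operator f -> exists A : op, A = f :> (H -> H).
Proof.
case=> fl [c hc].
have fD x y : f (x + y) = f x + f y by have := fl 1 x y; rewrite !scale1r.
have f0 : f 0 = 0.
  by have := fD 0 0; rewrite addr0 => /eqP; rewrite -subr_eq0 opprD addNKr oppr_eq0 => /eqP.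
have fZ (d : R[i]) x : f (d *: x) = d *: f x by have := fl d x 0; rewrite !addr0 f0 addr0.
have fb x : nrm (f x) <= complex.Re c * nrm x.
  have := hc x; rewrite !nrmE lecE => /andP[_] /=.
  by case: (c) => p q /=; rewrite mulr0 subr0.
have ex y : exists z, forall x, ip (f x) y = ip x z.
  apply: (@riesz _ _ _ (complex.Re c * nrm y)) => [x1 x2|a x|x].
  - by rewrite fD ipDl.
  - by rewrite fZ ipZl.
  - by rewrite (le_trans (ip_le _ _))// mulrAC ler_wpM2r ?nrm_ge0 // fb.
have [g fg] := choice ex; have [A hA] := op_of fD fZ (fun x y => fg y x) (ex_intro _ _ fb).
by exists A; apply/funext.
Qed.

Lemma bounded_op A : bounded_operator A.
Proof.
split; first exact: op_linear.
have [C _ hC] := opbd A; exists C%:C => x; rewrite !nrmE -rmorphM lecR; exact: hC.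
Qed.

Definition star A : op :=
  Op (@opadj_linear A) (fun x y => etrans (etrans (ipC _ _) (esym (op_adjP A y x))) (ipC _ _))
     (opadj_bounded A).

Lemma starP A x y : ip (A x) y = ip x (star A y).
Proof. exact: op_adjP. Qed.

Lemma starP2 A x y : ip (star A x) y = ip x (A y).
Proof. by rewrite ipC -starP ipC. Qed.

Lemma starK A : star (star A) = A.
Proof. by apply: op_ext. Qed.

Lemma op_ext_ip A B : (forall x y, ip (A x) y = ip (B x) y) -> A = B.
Proof. by move=> h; apply: op_ext => x; apply: ip_inj => y. Qed.

Lemma adjointE A : adjoint A = star A :> (H -> H).
Proof.
apply/funext => y; rewrite /adjoint; case: xgetP => [z _ /= hz|h].
  by apply: ip_inj => x; rewrite !(ipC _ x) -op_adjP /ip hz.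
by case: (h (star A y)) => x; rewrite !inner_ip -(opZc (star A)) !starP.
Qed.

Fact op_zero_adj x y : ip ((fun=> 0) x : H) y = ip x ((fun=> 0) y).
Proof. by rewrite !ipE. Qed.
Fact op_zero_linear : linear ((fun=> 0) : H -> H).
Proof. by move=> c x y; rewrite scaler0 addr0. Qed.
Fact op_zero_bounded : exists C : R, forall x, nrm ((fun=> 0 : H) x) <= C * nrm x.
Proof. by exists 0 => x; rewrite nrm0 mul0r. Qed.
Definition op_zero := Op op_zero_linear op_zero_adj op_zero_bounded.

Fact op_one_linear : linear (@idfun H). Proof. by []. Qed.
Fact op_one_bounded : exists C : R, forall x : H, nrm (idfun x) <= C * nrm x.
Proof. by exists 1 => x; rewrite mul1r. Qed.
Definition op_one := Op op_one_linear (fun x y => erefl (ip x y)) op_one_bounded.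

Fact op_add_linear A B : linear (fun x => A x + B x).
Proof. by move=> c x y; rewrite !opD !opZc scalerDr addrACA. Qed.
Fact op_add_adj A B x y : ip (A x + B x) y = ip x (star A y + star B y).
Proof. by rewrite ipDl ipDr !starP. Qed.
Fact op_add_bounded A B : exists C : R, forall x, nrm (A x + B x) <= C * nrm x.
Proof.
have [C _ hC] := opbd A; have [D _ hD] := opbd B; exists (C + D) => x.
by rewrite (le_trans (nrmD _ _))// mulrDl lerD.
Qed.
Definition op_add A B := Op (@op_add_linear A B) (op_add_adj A B) (op_add_bounded A B).

Fact op_scale_linear a A : linear (fun x => a%:C *: A x).
Proof. by move=> c x y; rewrite !opD !opZc scalerDr !scalerA (mulrC c). Qed.
Fact op_scale_adj a A x y : ip (a%:C *: A x) y = ip x (a%:C *: star A y).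
Proof. by rewrite !ipE starP. Qed.
Fact op_scale_bounded a A : exists C : R, forall x, nrm (a%:C *: A x) <= C * nrm x.
Proof.
by have [C _ hC] := opbd A; exists (`|a| * C) => x; rewrite nrmZ -mulrA ler_wpM2l.
Qed.
Definition op_scale a A :=
  Op (@op_scale_linear a A) (op_scale_adj a A) (op_scale_bounded a A).

Fact op_mul_linear A B : linear (fun x => A (B x)).
Proof. by move=> c x y; rewrite !opD !opZc. Qed.
Fact op_mul_adj A B x y : ip (A (B x)) y = ip x (star B (star A y)).
Proof. by rewrite !starP. Qed.
Fact op_mul_bounded A B : exists C : R, forall x, nrm (A (B x)) <= C * nrm x.
Proof.
have [C C0 hC] := opbd A; have [D _ hD] := opbd B; exists (C * D) => x.
by rewrite (le_trans (hC _))// -mulrA ler_wpM2l // ltW.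
Qed.
Definition op_mul A B := Op (@op_mul_linear A B) (op_mul_adj A B) (op_mul_bounded A B).

HB.instance Definition _ := gen_eqMixin op.
HB.instance Definition _ := gen_choiceMixin op.

Fact op_addA : associative op_add.
Proof. by move=> A B D; apply: op_ext => x /=; rewrite addrA. Qed.
Fact op_addC : commutative op_add.
Proof. by move=> A B; apply: op_ext => x /=; rewrite addrC. Qed.
Fact op_add0 : left_id op_zero op_add.
Proof. by move=> A; apply: op_ext => x /=; rewrite add0r. Qed.
Fact op_addN : left_inverse op_zero (op_scale (-1)) op_add.
Proof.
by move=> A; apply: op_ext => x /=; rewrite rmorphN1 scaleN1r addNr.
Qed.
HB.instance Definition _ := GRing.isZmodule.Build op op_addA op_addC op_add0 op_addN.

Fact op_mulA : associative op_mul. Proof. by move=> A B D; exact: op_ext. Qed.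
Fact op_mul1 : left_id op_one op_mul. Proof. by move=> A; exact: op_ext. Qed.
Fact op_mulr1 : right_id op_one op_mul. Proof. by move=> A; exact: op_ext. Qed.
Fact op_mulDl : left_distributive op_mul +%R.
Proof. by move=> A B D; exact: op_ext. Qed.
Fact op_mulDr : right_distributive op_mul +%R.
Proof. by move=> A B D; apply: op_ext => x /=; rewrite opD. Qed.
HB.instance Definition _ := GRing.Zmodule_isPzRing.Build op
  op_mulA op_mul1 op_mulr1 op_mulDl op_mulDr.

Fact op_scaleA a b A : op_scale a (op_scale b A) = op_scale (a * b) A.
Proof. by apply: op_ext => x /=; rewrite scalerA rmorphM. Qed.
Fact op_scale1 : left_id 1 op_scale.
Proof. by move=> A; apply: op_ext => x /=; rewrite scale1r. Qed.
Fact op_scaleDr : right_distributive op_scale +%R.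
Proof. by move=> a A B; apply: op_ext => x /=; rewrite scalerDr. Qed.
Fact op_scaleDl A : {morph op_scale^~ A : a b / a + b}.
Proof. by move=> a b; apply: op_ext => x /=; rewrite rmorphD scalerDl. Qed.
HB.instance Definition _ := GRing.Zmodule_isLmodule.Build R op
  op_scaleA op_scale1 op_scaleDr op_scaleDl.

Lemma addE A B x : (A + B) x = A x + B x. Proof. by []. Qed.
Lemma oppE A x : (- A) x = - A x.
Proof. by rewrite /= rmorphN1 scaleN1r. Qed.
Lemma subE A B x : (A - B) x = A x - B x. Proof. by rewrite addE oppE. Qed.
Lemma zeroE x : (0 : op) x = 0. Proof. by []. Qed.
Lemma oneE x : (1 : op) x = x. Proof. by []. Qed.
Lemma mulE A B x : (A * B) x = A (B x). Proof. by []. Qed.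
Lemma scaleE a A x : (a *: A) x = a%:C *: A x. Proof. by []. Qed.
Lemma exprSE A n x : (A ^+ n.+1) x = A ((A ^+ n) x). Proof. by rewrite exprS. Qed.

Definition opE := (addE, subE, oppE, zeroE, oneE, mulE, scaleE).
Definition oplE := (opD, opB, opN, op0, opZc).

Lemma scalerAlo a A B : a *: (A * B) = (a *: A) * B.
Proof. exact: op_ext. Qed.
Lemma scalerAro a A B : a *: (A * B) = A * (a *: B).
Proof. by apply: op_ext => x; rewrite !opE oplE. Qed.

Lemma starD A B : star (A + B) = star A + star B.
Proof. exact: op_ext. Qed.
Lemma starZ a A : star (a *: A) = a *: star A.
Proof. exact: op_ext. Qed.
Lemma starN A : star (- A) = - star A.
Proof. exact: op_ext. Qed.
Lemma starB A B : star (A - B) = star A - star B.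
Proof. by rewrite starD starN. Qed.
Lemma starM A B : star (A * B) = star B * star A.
Proof. exact: op_ext. Qed.
Lemma star1 : star 1 = 1.
Proof. exact: op_ext. Qed.
Lemma star0 : star 0 = 0.
Proof. exact: op_ext. Qed.
Lemma starX A n : star (A ^+ n) = star A ^+ n.
Proof. by elim: n => [|n IHn]; rewrite ?expr0 ?star1 // exprS starM IHn -exprSr. Qed.

Lemma op_cvg A (u : nat -> H) (l : H) : u @ \oo --> l -> (fun n => A (u n)) @ \oo --> A l.
Proof.
have [C C0 hC] := opbd A; move=> /cvg_vec ul; apply/cvg_vec => e e0.
have /ul[n0 hn] : 0 < e / C by rewrite divr_gt0.
exists n0 => n /hn; rewrite -opB ltr_pdivlMr // => h.
by rewrite (le_lt_trans (hC _))// mulrC.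
Qed.

End Operators.
Arguments op {R} H.

(** * Positive operators and strong convergence *)

Section PositiveOperators.
Context {R : realType} {H : hilbertType R}.
Implicit Types (A B T : op H) (F G : nat -> op H) (x y z : H) (a b : R).

Definition sa A := star A = A.

Definition psd A := sa A /\ forall x, 0 <= ip (A x) x.

Definition pcontr A := psd A /\ forall x, ip (A x) x <= nrm x ^+ 2.

Definition scvg (F : nat -> op H) A := forall x, (fun n => F n x) @ \oo --> A x.

Lemma saP A x y : sa A -> ip (A x) y = ip x (A y).
Proof. by move=> sA; rewrite starP sA. Qed.

Lemma saD A B : sa A -> sa B -> sa (A + B).
Proof. by rewrite /sa starD => -> ->. Qed.

Lemma saB A B : sa A -> sa B -> sa (A - B).
Proof. by rewrite /sa starB => -> ->. Qed.

Lemma saZ a A : sa A -> sa (a *: A).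
Proof. by rewrite /sa starZ => ->. Qed.

Lemma sa1 : sa 1. Proof. exact: star1. Qed.

Lemma sa0 : sa 0. Proof. exact: star0. Qed.

Lemma saX A n : sa A -> sa (A ^+ n).
Proof. by rewrite /sa starX => ->. Qed.

Lemma sa_conj A B : sa A -> sa (star B * A * B).
Proof. by move=> sA; rewrite /sa !starM starK sA mulrA. Qed.

Lemma psdD A B : psd A -> psd B -> psd (A + B).
Proof.
move=> [sA pA] [sB pB]; split=> [|x]; first exact: saD.
by rewrite opE ipDl addr_ge0.
Qed.

Lemma psdZ a A : 0 <= a -> psd A -> psd (a *: A).
Proof.
move=> a0 [sA pA]; split=> [|x]; first exact: saZ.
by rewrite opE ipZl mulr_ge0.
Qed.

Lemma psd0 : psd 0.
Proof. by split=> [|x]; [exact: sa0|rewrite opE ip0l]. Qed.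

Lemma psd1 : psd 1.
Proof. by split=> [|x]; [exact: sa1|rewrite opE ipxx sqr_ge0]. Qed.

Lemma psd_conj A B : psd A -> psd (star B * A * B).
Proof.
by move=> [sA pA]; split=> [|x]; [exact: sa_conj|rewrite !opE starP2 pA].
Qed.

Lemma psd_sqr B : psd (star B * B).
Proof. by have := psd_conj B psd1; rewrite mulr1. Qed.

Lemma ip_sqr_nrm A x : sa A -> ip (A (A x)) x = nrm (A x) ^+ 2.
Proof. by move=> sA; rewrite (saP _ _ sA) ipxx. Qed.

Lemma form_cs A x y : psd A -> ip (A x) y ^+ 2 <= ip (A x) x * ip (A y) y.
Proof.
move=> [sA pA]; apply: quad_disc => // t.
have := pA (x + t%:C *: y); rewrite !oplE !ipE (saP y x sA) (ipC y); lra.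
Qed.

(** Cauchy-Schwarz for the form of [A] between [x] and [A x]: [|A x|^4 <= <A x, x> <A (A x), A x> <=
    <A x, x> b |A x|^2]; then divide. *)
Lemma psd_nrm A b x : psd A -> (forall x, ip (A x) x <= b * nrm x ^+ 2) ->
  nrm (A x) ^+ 2 <= b * ip (A x) x.
Proof.
move=> pA Ab; have := form_cs x (A x) pA; rewrite ipxx.
(* The sign of b is free here; a negative b forces the form at [x] to be 0. *)
have [->|n0] := eqVneq (nrm (A x)) 0.
  move=> _; have [b0|b0] := leP 0 b; first by rewrite expr0n mulr_ge0 //; case: pA.
  have := Ab x; have [_ /(_ x) h] := pA; rewrite expr0n /= => h2.
  suff -> : ip (A x) x = 0 by rewrite mulr0.
  by apply/eqP; rewrite eq_le h andbT (le_trans h2) // nmulr_rle0 // sqr_ge0.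
move=> h; have np : 0 < nrm (A x) ^+ 2 by rewrite exprn_gt0 // lt_def n0 nrm_ge0.
rewrite -(ler_pM2r np) -expr2 (le_trans h)// mulrAC mulrC.
by rewrite ler_wpM2r //; case: pA.
Qed.

Lemma psd_eq0 A x : psd A -> ip (A x) x = 0 -> A x = 0.
Proof.
move=> pA h; apply: nrm0_eq0; have := form_cs x (A x) pA.
rewrite h mul0r ipxx => h2; apply/eqP.
by rewrite -sqrf_eq0 -sqrf_eq0 eq_le h2 sqr_ge0.
Qed.

Lemma pcontr_nrm2 A x : pcontr A -> nrm (A x) ^+ 2 <= ip (A x) x.
Proof.
case=> pA Ab; have := @psd_nrm A 1 x pA; rewrite mul1r; apply.
by move=> y; rewrite mul1r.
Qed.

Lemma pcontr_nrm A x : pcontr A -> nrm (A x) <= nrm x.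
Proof.
by move=> pA; apply/nrm_le/(le_trans (pcontr_nrm2 x pA)); case: pA.
Qed.

Lemma pcontr1B A : pcontr A -> pcontr (1 - A).
Proof.
move=> [[sA pA] Ab]; split; last by move=> x; rewrite !opE ipBl ipxx gerBl.
split=> [|x]; first exact: (saB sa1).
by rewrite !opE ipBl ipxx subr_ge0.
Qed.

Lemma pcontr0 : pcontr 0.
Proof. by split=> [|x]; [exact: psd0|rewrite opE ip0l sqr_ge0]. Qed.

Lemma scvg_cst A : scvg (fun=> A) A.
Proof. by move=> x; exact: cvg_cst. Qed.

Lemma scvgD F A G B : scvg F A -> scvg G B -> scvg (fun n => F n + G n) (A + B).
Proof. by move=> hA hB x; exact: (cvgD (hA x) (hB x)). Qed.

Lemma scvgZ a F A : scvg F A -> scvg (fun n => a *: F n) (a *: A).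
Proof. by move=> hA x; exact: (@cvgZ _ _ _ _ _ (fun=> _) _ _ _ (cvg_cst _) (hA x)). Qed.

Lemma scvgN F A : scvg F A -> scvg (fun n => - F n) (- A).
Proof.
move=> hA x; rewrite oppE; apply: cvg_trans (cvgN (hA x)); apply: near_eq_cvg.
by apply: nearW => n; rewrite oppE.
Qed.

Lemma scvgB F A G B : scvg F A -> scvg G B -> scvg (fun n => F n - G n) (A - B).
Proof. by move=> hA hB; apply: scvgD => //; exact: scvgN. Qed.

Lemma scvgMl A G B : scvg G B -> scvg (fun n => A * G n) (A * B).
Proof. by move=> hB x; exact/op_cvg/hB. Qed.

Lemma scvgMr B F A : scvg F A -> scvg (fun n => F n * B) (A * B).
Proof. by move=> hA x; exact: (hA (B x)). Qed.

Lemma scvg_app (C : R) F A (u : nat -> H) (l : H) :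
  (forall n x, nrm (F n x) <= C * nrm x) -> scvg F A -> u @ \oo --> l ->
  (fun n => F n (u n)) @ \oo --> A l.
Proof.
move=> Cb hA /cvg_nrmP ul.
have -> : (fun n => F n (u n)) = (fun n => F n l + F n (u n - l)).
  by apply/funext => n; rewrite -opD addrC subrK.
rewrite -[X in _ --> X]addr0; apply: cvgD; first exact: hA.
apply/cvg_nrmP/(@squeeze_cvgr _ _ _ _ (cst 0) (fun n => C * nrm (u n - l))).
- by apply: nearW => n; rewrite subr0 nrm_ge0 Cb.
- exact: cvg_cst.
- by rewrite -(mulr0 C); apply: cvgMr.
Qed.

Lemma scvgM (C : R) F A G B : (forall n x, nrm (F n x) <= C * nrm x) ->
  scvg F A -> scvg G B -> scvg (fun n => F n * G n) (A * B).
Proof. by move=> Cb hA hB x; exact: (scvg_app Cb hA (hB x)). Qed.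

Lemma scvg_unique F A B : scvg F A -> scvg F B -> A = B.
Proof. by move=> hA hB; apply: op_ext => x; exact: cvg_vec_unique (hA x) (hB x). Qed.

Lemma scvgS F A : scvg F A -> scvg (fun n => F n.+1) A.
Proof. by move=> hA x; rewrite (@cvg_shiftS _ (fun n => F n x)); exact: hA. Qed.

Lemma scvg_lim F (C : R) :
  (forall n x, nrm (F n x) <= C * nrm x) ->
  (forall x, exists l : H, (fun n => F n x) @ \oo --> l) -> exists A, scvg F A.
Proof.
move=> Cb /choice[f fl].
have fD x y : f (x + y) = f x + f y.
  apply: (cvg_vec_unique (fl _)); under eq_fun do rewrite opD.
  exact: (cvgD (fl x) (fl y)).
have fZ (c : R[i]) x : f (c *: x) = c *: f x.
  apply: (cvg_vec_unique (fl _)); under eq_fun do rewrite opZc.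
  exact: (@cvgZ _ _ _ _ _ (fun=> _) _ _ _ (cvg_cst _) (fl x)).
have fb x : nrm (f x) <= C * nrm x by apply: (cvg_nrm_le (fl x)); exists 0%N.
have [|A AE] := @op_of_bounded _ _ f.
  split; first by move=> c x y; rewrite fD fZ.
  by exists C%:C => x; rewrite !nrmE -rmorphM lecR.
by exists A => x; rewrite AE.
Qed.

Lemma scvg_star F A x y : scvg F A ->
  (fun n => ip (star (F n) x) y) @ \oo --> ip (star A x) y.
Proof.
move=> hA; under eq_fun do rewrite starP2.
by rewrite starP2; apply: cvg_ip; [exact: cvg_cst|exact: hA].
Qed.

Lemma scvg_form F A x : scvg F A -> (fun n => ip (F n x) x) @ \oo --> ip (A x) x.
Proof. by move=> hA; apply: cvg_ip; [exact: hA|exact: cvg_cst]. Qed.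

Lemma scvg_sa F A : (forall n, sa (F n)) -> scvg F A -> sa A.
Proof.
move=> sA hA; apply: op_ext_ip => x y.
have h := @scvg_star _ _ x y hA; apply: (cvg_unique _ h) => //.
rewrite (_ : (fun n => _) = (fun n => ip (F n x) y)); last first.
  by apply/funext => n; rewrite sA.
by apply: cvg_ip; [exact: hA|exact: cvg_cst].
Qed.

Lemma scvg_psd F A : (forall n, psd (F n)) -> scvg F A -> psd A.
Proof.
move=> pA hA; split; first by apply: (scvg_sa _ hA) => n; case: (pA n).
by move=> x; apply: (cvg_to_ge (scvg_form (x:=x) hA)) => n; case: (pA n).
Qed.

Lemma scvg_pcontr F A : (forall n, pcontr (F n)) -> scvg F A -> pcontr A.
Proof.
move=> pA hA; split; first by apply: (scvg_psd _ hA) => n; case: (pA n).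
by move=> x; apply: (cvg_to_le (scvg_form (x:=x) hA)) => n; case: (pA n).
Qed.

(** Monotone forms converge, and [psd_nrm] applied to [F (n + k) - F n] turns the Cauchy property of
    the forms into that of the vectors [F n x]. *)
Lemma scvg_inc (F : nat -> op H) b : 0 <= b ->
  psd (F 0%N) -> (forall n, psd (F n.+1 - F n)) ->
  (forall n x, ip (F n x) x <= b * nrm x ^+ 2) ->
  exists2 A, scvg F A & forall n, psd (A - F n).
Proof.
move=> b0 p0 pS Ab.
have pD n k : psd (F (n + k)%N - F n).
  elim: k => [|k IHk]; first by rewrite addn0 subrr; exact: psd0.
  by rewrite addnS -(subrK (F (n + k)%N) (F _)) -addrA; exact: psdD.
have pA n : psd (F n).
  by have := psdD (pD 0%N n) p0; rewrite add0n subrK.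
have Dn n k x : nrm (F (n + k)%N x - F n x) ^+ 2 <= b * (ip (F (n + k)%N x) x - ip (F n x) x).
  have := @psd_nrm _ b x (pD n k); rewrite !opE ipBl; apply => y.
  rewrite !opE ipBl; apply: le_trans (Ab (n + k)%N y); rewrite gerBl.
  by case: (pA n).
have ex x : exists l : H, (fun n => F n x) @ \oo --> l.
  have [l al] : exists l : R, (fun n => ip (F n x) x) @ \oo --> l.
    exists (sup (range (fun n => ip (F n x) x))); apply: nondecreasing_cvgn.
      apply/nondecreasing_seqP => n; have [_ /(_ x)] := pS n.
      by rewrite !opE ipBl subr_ge0.
    by exists (b * nrm x ^+ 2) => _ [n _ <-].
  apply: cauchy_vec => e e0; have b1 : 0 < b + 1 by lra.
  (* Two forms within d of the limit give [|F n x - F m x|^2 <= 2 b d], which is below [e^2]; the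
     [+ 1] covers [b = 0]. *)
  move/cvg_eventually: al => /(_ (e ^+ 2 / (2 * (b + 1)))) []; first by rewrite divr_gt0 ?exprn_gt0 ?mulr_gt0.
  move=> n0 hn; exists n0 => m n n0m mn.
  rewrite -(@ltr_pXn2r _ 2) ?nnegrE ?nrm_ge0 ?ltW // -(subnKC mn).
  apply: (le_lt_trans (Dn _ _ _)); rewrite subnKC //.
  have := hn _ n0m; have := hn _ (leq_trans n0m mn); rewrite !ltr_norml.
  set d := _ / _; have dE : d * (2 * (b + 1)) = e ^+ 2 by rewrite divfK // mulf_neq0 // gt_eqF.
  have d0 : 0 < d by rewrite divr_gt0 ?exprn_gt0 ?mulr_gt0.
  move=> /andP[? ?] /andP[? ?]; rewrite -dE.
  apply: (@le_lt_trans _ _ (b * (2 * d))); last by nra.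
  by rewrite ler_wpM2l //; lra.
have [|A hA] := @scvg_lim F b _ ex.
  move=> n x; apply: nrm_le_sqr; first by rewrite mulr_ge0 ?nrm_ge0.
  apply: (le_trans (psd_nrm x (pA n) (Ab n))).
  by rewrite exprMn expr2 -mulrA ler_wpM2l.
exists A => // n; have hB : scvg (fun k => F (n + k)%N - F n) (A - F n).
  apply: scvgB; last exact: scvg_cst.
  move=> x; under eq_fun do rewrite addnC.
  by have := hA x; rewrite -(cvg_shiftn n (fun k => F k x)).
by apply: (scvg_psd _ hB) => k; exact: pD.
Qed.

Lemma scvg_dec (F : nat -> op H) :
  (forall n, pcontr (F n)) -> (forall n, psd (F n - F n.+1)) ->
  exists2 A, scvg F A & forall n, psd (F n - A).
Proof.
move=> pA pD.
have [||||B hB pB] := @scvg_inc (fun n => 1 - F n) 1.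
- by [].
- by case: (pcontr1B (pA 0%N)).
- by move=> n; rewrite opprB addrC addrA subrK.
- by move=> n x; rewrite mul1r; case: (pcontr1B (pA n)).
exists (1 - B) => [|n]; last first.
  by have := pB n; rewrite !opprB (addrC _ (B - 1)) addrA addrAC -addrA.
suff -> : F = (fun n => 1 - (1 - F n)) by apply: scvgB => //; exact: scvg_cst.
by apply/funext => n; rewrite opprB addrC subrK.
Qed.

End PositiveOperators.

Ltac opring := apply: op_ext_ip => ? ?; rewrite !(opE, oplE, ipE); ring.

(** * Strongly closed algebras; square roots, spectral cuts, inverses *)

Section Algebras.
Context {R : realType} {H : hilbertType R}.
Implicit Types (A B T F P : op H) (S : set (op H)) (x y z : H) (a b : R).
Implicit Types (G : nat -> op H).

(** Real scalars and sequential limits are all that the constructions below use, so commutants and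
    von Neumann algebras are both instances. *)
Definition strong_algebra S :=
  [/\ S 1, forall A B, S A -> S B -> S (A - B),
      forall A B, S A -> S B -> S (A * B),
      forall a A, S A -> S (a *: A) &
      forall G A, (forall n, S (G n)) -> scvg G A -> S A].

(** Stands in for the functional calculus of [T]: by induction its elements lie in every strong
    algebra containing [T], and commute with whatever commutes with [T]. *)
Inductive strong_gen T : set (op H) :=
| Gen1 : strong_gen T 1
| GenT : strong_gen T T
| GenB A B of strong_gen T A & strong_gen T B : strong_gen T (A - B)
| GenM A B of strong_gen T A & strong_gen T B : strong_gen T (A * B)
| GenZ a A of strong_gen T A : strong_gen T (a *: A)
| GenLim G A of (forall n, strong_gen T (G n)) & scvg G A : strong_gen T A.

Section Closure.
Variable S : set (op H).
Hypothesis hS : strong_algebra S.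

Lemma alg1 : S 1. Proof. by case: hS. Qed.
Lemma algB A B : S A -> S B -> S (A - B). Proof. by case: hS => _ h _ _ _; exact: h. Qed.
Lemma algM A B : S A -> S B -> S (A * B). Proof. by case: hS => _ _ h _ _; exact: h. Qed.
Lemma algZ a A : S A -> S (a *: A). Proof. by case: hS => _ _ _ h _; exact: h. Qed.
Lemma alg_lim G A : (forall n, S (G n)) -> scvg G A -> S A.
Proof. by case: hS => _ _ _ _; exact. Qed.
Lemma alg0 : S 0. Proof. by rewrite -(subrr 1); apply: algB; exact: alg1. Qed.
Lemma algN A : S A -> S (- A). Proof. by rewrite -sub0r; exact/algB/alg0. Qed.
Lemma algD A B : S A -> S B -> S (A + B).
Proof. by move=> sA sB; rewrite -(opprK B); exact/algB/algN. Qed.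
Lemma algX A n : S A -> S (A ^+ n).
Proof. by move=> sA; elim: n => [|n IHn]; [exact: alg1|rewrite exprS; exact: algM]. Qed.
Lemma alg_sum n G : (forall i, S (G i)) -> S (\sum_(i < n) G i).
Proof.
move=> sG; elim: n => [|n IHn]; first by rewrite big_ord0; exact: alg0.
by rewrite big_ord_recr; exact: algD.
Qed.
End Closure.

Lemma strong_gen_algebra T : strong_algebra (strong_gen T).
Proof.
split; [exact: Gen1|exact: GenB|exact: GenM|by move=> a A; exact: GenZ|exact: GenLim].
Qed.

Lemma strong_gen_min S T A : strong_algebra S -> S T -> strong_gen T A -> S A.
Proof.
move=> hS ST; elim=> [|//|C D _ sC _ sD|C D _ sC _ sD|a C _ sC|G C _ sG hG].
- exact: alg1.
- exact: algB.
- exact: algM.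
- exact: algZ.
- exact: (alg_lim hS sG).
Qed.

Lemma commutant_algebra B : strong_algebra [set A | A * B = B * A].
Proof.
split=> /= [|A C hA hC|A C hA hC|a A hA|G A hG hA].
- by rewrite mul1r mulr1.
- by rewrite mulrBl mulrBr hA hC.
- by rewrite -mulrA hC mulrA hA mulrA.
- by rewrite -scalerAlo hA scalerAro.
- apply: (scvg_unique (scvgMr (B:=B) hA)).
  rewrite (_ : (fun n => _) = (fun n => B * G n)); first exact: scvgMl.
  by apply/funext => n; exact: hG.
Qed.

Lemma strong_gen_comm T A B : strong_gen T A -> T * B = B * T -> A * B = B * A.
Proof. by move=> hA hT; exact: (strong_gen_min (commutant_algebra B) hT hA). Qed.

Lemma strong_gen_comm2 T A B : strong_gen T A -> strong_gen T B -> A * B = B * A.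
Proof.
move=> hA hB; apply: (strong_gen_comm hA).
by apply/esym/(strong_gen_comm hB).
Qed.

(** With [k = n./2], the power is [A^k A^k] or [A^k A A^k], a conjugate of 1 or of [A]. *)
Lemma psdX A n : psd A -> psd (A ^+ n).
Proof.
move=> pA; have sA : sa A by case: pA.
rewrite -(odd_double_half n) -addnn; case: (odd n); rewrite ?add0n ?add1n.
  rewrite exprSr exprD -mulrA -exprSr exprS mulrA.
  by have := psd_conj (A ^+ n./2) pA; rewrite (saX n./2 sA).
by rewrite exprD; have := psd_sqr (A ^+ n./2); rewrite (saX n./2 sA).
Qed.

Lemma psd_sub_sqr A : pcontr A -> psd (A - A * A).
Proof.
move=> pA; have sA : sa A by case: pA => -[].
split=> [|x]; first by apply: saB => //; rewrite /sa starM sA.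
by rewrite !opE ipBl (ip_sqr_nrm _ sA) subr_ge0 pcontr_nrm2.
Qed.

(** With [k = n./2], the difference is [A^k (1 - A) A^k] or [A^k (A - A^2) A^k]. *)
Lemma psd_pow_sub A n : pcontr A -> psd (A ^+ n - A ^+ n.+1).
Proof.
move=> pA; have sA : sa A by case: pA => -[].
rewrite -(odd_double_half n) -addnn; case: (odd n); rewrite ?add0n ?add1n.
  have := psd_conj (A ^+ n./2) (psd_sub_sqr pA); rewrite (saX n./2 sA).
  by rewrite mulrBr mulrBl mulrA -exprSr -exprD -exprSr -exprD -!addSn.
have := psd_conj (A ^+ n./2) (proj1 (pcontr1B pA)); rewrite (saX n./2 sA).
by rewrite mulrBr mulrBl mulr1 -exprD -exprSr -exprD -!addSn.
Qed.

Lemma pcontrX A n : pcontr A -> pcontr (A ^+ n).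
Proof.
move=> pA; split; first by apply: psdX; case: pA.
move=> x; elim: n => [|n IHn]; first by rewrite expr0 opE ipxx.
apply: le_trans IHn; have [_ /(_ x)] := psd_pow_sub n pA.
by rewrite !opE ipBl subr_ge0.
Qed.

(** The powers of [T] decrease, and their strong limit is the projection onto ker(T - 1). This is
    how all projections are produced before any spectral theorem is available. *)
Lemma fix_projection T : pcontr T -> exists P,
  [/\ scvg (fun n => T ^+ n) P, strong_gen T P, sa P, P * P = P & T * P = P].
Proof.
move=> pT; have [|P hP _] := @scvg_dec _ _ (fun n => T ^+ n) (fun n => pcontrX n pT).
  by move=> n; exact: psd_pow_sub.
have TP : T * P = P.
  apply: (@scvg_unique _ _ (fun n => T * T ^+ n)); first exact: scvgMl.
  rewrite (_ : (fun n => _) = (fun n => T ^+ n.+1)); first exact: scvgS hP.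
  by apply/funext => n; rewrite exprS.
exists P; split=> //.
- apply: (alg_lim (strong_gen_algebra T)) hP => n.
  exact/(algX (strong_gen_algebra T))/GenT.
- by apply: (scvg_sa _ hP) => n; case: (pcontrX n pT) => -[].
- apply: (@scvg_unique _ _ (fun n => T ^+ n * P)); first exact: scvgMr.
  suff -> : (fun n => T ^+ n * P) = (fun=> P) by exact: scvg_cst.
  by apply/funext; elim=> [|n IHn]; rewrite ?mul1r // exprSr -mulrA TP.
Qed.

Lemma fix_projectionP T P x : scvg (fun n => T ^+ n) P -> T * P = P ->
  P x = x <-> T x = x.
Proof.
move=> hP TP; split=> [<-|Tx]; first by rewrite -mulE TP.
apply: (cvg_vec_unique (hP x)); rewrite (_ : (fun n => _) = (fun=> x)).
  exact: cvg_cst.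
by apply/funext; elim=> [|n IHn] //; rewrite exprSE IHn.
Qed.

(* With A_0 = A and A_{n+1} = A_n - A_n^2 one has A = \sum_n A_n^2 strongly,
   and each A_n^2 B = A_n B A_n is positive. *)
Lemma psd_mul A B : pcontr A -> psd B -> A * B = B * A -> psd (A * B).
Proof.
move=> pA pB AB; pose G n := iter n (fun C => C - C * C) A.
have GE n : G n.+1 = G n - G n * G n by [].
have pG n : pcontr (G n).
  elim: n => [|n IHn] //=; split; first exact: psd_sub_sqr.
  move=> x; rewrite !opE ipBl; have [[sG _] Gb] := IHn.
  by rewrite (ip_sqr_nrm _ sG) (le_trans _ (Gb x))// gerBl sqr_ge0.
have sG n : sa (G n) by case: (pG n) => -[].
have GB n : G n * B = B * G n.
  elim: n => [|n IHn] //=; rewrite mulrBl mulrBr -mulrA IHn mulrA IHn.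
  by rewrite mulrA.
have sA : sa A := sG 0%N.
have sB : sa B by case: pB.
split=> [|x]; first by rewrite /sa starM sA sB.
have [l al] : exists l : R, (fun n => ip (G n x) x) @ \oo --> l.
  exists (inf (range (fun n => ip (G n x) x))); apply: nonincreasing_cvgn.
    apply/nonincreasing_seqP => n.
    by rewrite GE !opE ipBl (ip_sqr_nrm _ (sG n)) gerBl sqr_ge0.
  by exists 0 => _ [n _ <-]; case: (pG n) => -[].
have G0 : (fun n => G n x) @ \oo --> (0 : H).
  apply/cvg_nrmP; under eq_fun do rewrite subr0.
  apply/cvg_eventually => e e0.
  have : (fun n => ip (G n x) x - ip (G n.+1 x) x) @ \oo --> (0 : R).
    rewrite -(subrr l); apply: cvgB => //.
    by rewrite (@cvg_shiftS _ (fun n => ip (G n x) x)).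
  move=> /cvg_eventually /(_ (e ^+ 2)) [|n0 hn]; first by rewrite exprn_gt0.
  exists n0 => n /hn; rewrite GE !opE ipBl (ip_sqr_nrm _ (sG n)) subr0 opprB.
  rewrite addrC subrK ger0_norm ?sqr_ge0 // subr0 ger0_norm ?nrm_ge0 //.
  by rewrite ltr_pXn2r ?nnegrE ?nrm_ge0 ?ltW.
have lim : (fun n => ip (B (G n x)) x) @ \oo --> (0 : R).
  rewrite -(ip0l x) -(op0 B); apply: cvg_ip; last exact: cvg_cst.
  exact: op_cvg.
(* The numbers [ip (B (G n x)) x] tend to 0 and drop by [ip (B (G n x)) (G n x) >= 0] at each step,
   so the initial one is nonnegative. *)
rewrite AB mulE; apply: (cvg_to_le lim); elim=> [|n IHn] //.
apply: le_trans IHn; rewrite GE !opE opB ipBl gerBl.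
by rewrite -(mulE B) -GB mulE (saP _ _ (sG n)); case: pB.
Qed.

Lemma diff_sqr A B : A * B = B * A ->
  (A - B) * (2^-1 *: (A + B)) = 2^-1 *: (A * A - B * B).
Proof. by move=> AB; rewrite -scalerAro mulrBl !mulrDr AB addrKA. Qed.

Lemma sqr_eq_mul0 A B : A * A = B * B -> A * B = B * A -> (A + B) * (A - B) = 0.
Proof. by move=> AA AB; rewrite mulrBr !mulrDl AA AB (addrC (B * B)) subrr. Qed.

(** If [B = 1 - Y], then [B^2 = A] says that Y is a fixed point of [Z |-> (1 - A + Z^2) / 2]. The
    iterates from 0 are increasing positive contractions. *)
Lemma psd_sqrt A : pcontr A -> exists B,
  [/\ pcontr B, B * B = A & strong_gen A B].
Proof.
move=> pA; have hS := strong_gen_algebra A.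
pose Z n := iter n (fun Z => 2^-1 *: (1 - A + Z * Z)) (0 : op H).
have ZS n : Z n.+1 = 2^-1 *: (1 - A + Z n * Z n) by [].
have gZ n : strong_gen A (Z n).
  elim: n => [|n IHn] /=; first exact: alg0.
  apply/(algZ hS)/(algD hS); last exact: (algM hS).
  by apply: (algB hS); [exact: alg1|exact: GenT].
have pZ n : pcontr (Z n).
  elim: n => [|n IHn] /=; first exact: pcontr0.
  have [pC Cb] := pcontr1B pA; have sZ : sa (Z n) by case: IHn => -[].
  split; first by apply/psdZ/psdD; rewrite ?invr_ge0 // -{1}sZ; exact: psd_sqr.
  move=> x; rewrite scaleE addE mulE ipZl ipDl (ip_sqr_nrm _ sZ).
  have := Cb x; have [_ h] := IHn; have := h x; have := pcontr_nrm2 x IHn.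
  by lra.
have dZ n : psd (Z n.+1 - Z n).
  elim: n => [|n IHn].
    rewrite /Z /= subr0 mulr0 addr0; apply: psdZ; first by rewrite invr_ge0.
    by case: (pcontr1B pA).
  (* Each increment is the previous one times a commuting positive operator, so [psd_mul] propagates
     positivity. *)
  rewrite (_ : _ - _ = (Z n.+1 - Z n) * (2^-1 *: (Z n.+1 + Z n))); last first.
    rewrite (ZS n.+1) [X in _ - X]ZS -scalerBr opprD addrACA subrr add0r.
    by rewrite diff_sqr //; exact: strong_gen_comm2 (gZ _) (gZ _).
  have gD : strong_gen A (Z n.+1 - Z n) by exact: (algB hS).
  have gE : strong_gen A (2^-1 *: (Z n.+1 + Z n)) by exact/(algZ hS)/(algD hS).
  apply: psd_mul; last exact: strong_gen_comm2 gD gE.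
  - split=> // x; apply: le_trans (proj2 (pZ n.+1) x).
    by rewrite subE ipBl gerBl; case: (pZ n) => -[].
  - by apply/psdZ/psdD; rewrite ?invr_ge0 //; [case: (pZ n.+1)|case: (pZ n)].
have [||||Y hY _] := @scvg_inc _ _ Z 1 => //.
- exact: psd0.
- by move=> n x; rewrite mul1r; case: (pZ n).
have pY : pcontr Y by exact: scvg_pcontr hY.
have gY : strong_gen A Y by exact: (alg_lim hS) hY.
have EY : Y = 2^-1 *: (1 - A + Y * Y).
  apply: (scvg_unique (scvgS hY)); apply/scvgZ/scvgD; first exact: scvg_cst.
  apply: (@scvgM _ _ 1) => // n x; rewrite mul1r; exact: pcontr_nrm.
exists (1 - Y); split; first exact: pcontr1B.
  have -> : A = 1 - 2 *: Y + Y * Y.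
    have -> : 2 *: Y = 1 - A + Y * Y by rewrite {1}EY scalerA divff // scale1r.
    by rewrite !opprD opprK !addrA subrr add0r subrK.
  by opring.
by apply: (algB hS) => //; exact: alg1.
Qed.

(** With [B = T - l] and [s = |B|] the root of [B^2], the operator [G = (s + B) / 2] is the positive
    part of B. F is the projection onto its kernel, obtained as the fixed projection of
    [1 - G^2]. *)
Lemma spectral_cut T (l : R) : pcontr T -> 0 <= l <= 1 -> exists F,
  [/\ sa F, F * F = F, strong_gen T F,
      forall x, F x = x -> ip (T x) x <= l * nrm x ^+ 2 &
      forall x, F x = 0 -> x != 0 -> l * nrm x ^+ 2 < ip (T x) x].
Proof.
move=> pT /andP[l0 l1]; have hS := strong_gen_algebra T.
have sT : sa T by case: pT => -[].
pose B := T - l *: (1 : op H).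
have sB : sa B by exact/saB/saZ/sa1.
have gB : strong_gen T B by apply: (algB hS); [exact: GenT|apply: (algZ hS); exact: alg1].
have Bnrm x : nrm (B x) ^+ 2 <= nrm x ^+ 2.
  rewrite -ipxx !opE !ipE ipxx (ipC x) ipxx.
  have := pcontr_nrm2 x pT; have [[_ /(_ x)]] := pT; have := sqr_ge0 (nrm x).
  move=> h1 h2 /(_ x) h3 h4.
  have := mulr_ge0 (_ : 0 <= nrm x ^+ 2 - ip (T x) x) (_ : 0 <= 1 - l ^+ 2).
  have := mulr_ge0 h2 (_ : 0 <= 2 * l - l ^+ 2).
  rewrite !subr_ge0 exprn_ile1 // => /(_ _) h5 /(_ h3 isT) h6.
  have /h5 : l ^+ 2 <= 2 * l by nra.
  by nra.
have pB2 : pcontr (B * B).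
  split=> [|x]; last by rewrite mulE (ip_sqr_nrm _ sB).
  by rewrite -{1}sB; exact: psd_sqr.
have [s [ps ss gs1]] := psd_sqrt pB2.
have gs : strong_gen T s by apply: (strong_gen_min hS _ gs1); exact: (algM hS).
have sB_comm : s * B = B * s by exact: strong_gen_comm2 gs gB.
have s_sa : sa s by case: ps => -[].
pose G := 2^-1 *: (s + B).
have sG : sa G by exact/saZ/saD.
have gG : strong_gen T G by exact/(algZ hS)/(algD hS).
have pG2 : pcontr (G * G).
  split; first by rewrite -{1}sG; exact: psd_sqr.
  move=> x; rewrite mulE (ip_sqr_nrm _ sG) scaleE addE nrmZ ger0_norm ?invr_ge0 //.
  rewrite ler_pXn2r ?nnegrE ?mulr_ge0 ?nrm_ge0 ?invr_ge0 //.
  have := nrmD (s x) (B x); have := pcontr_nrm x ps; have := nrm_le (Bnrm x).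
  by lra.
have [F [hF gF1 sF FF EF]] := fix_projection (pcontr1B pG2).
have gF : strong_gen T F.
  apply: (strong_gen_min hS _ gF1).
  by apply: (algB hS); [exact: alg1|exact: (algM hS)].
have GF : G * F = 0.
  apply: op_ext => x; apply: nrm0_eq0; apply/eqP; rewrite -sqrf_eq0.
  rewrite -(ip_sqr_nrm _ sG) -mulE; have : (G * G) (F x) = 0.
    have /(congr1 (fun X : op H => X x)) := EF; rewrite !opE => /eqP.
    by rewrite -subr_eq0 addrAC subrr sub0r oppr_eq0 => /eqP.
  by move=> ->; rewrite ip0l.
have Gx0 x : G x = 0 -> F x = x.
  by move=> Gx; apply/(fix_projectionP x hF EF); rewrite subE oneE mulE Gx op0 subr0.
have Gs : G * (s - B) = 0.
  by rewrite -scalerAlo sqr_eq_mul0 ?scaler0.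
(* Since [s^2 = B^2], the range of [s - B] lies in ker G. As F commutes with [s - B], it follows
   that [s x = B x] whenever [F x = 0]. *)
have Fs : F * (s - B) = s - B by apply: op_ext => x; apply: Gx0; rewrite -mulE Gs.
exists F; split=> // x Fx.
- have : (s + B) x = 0.
    apply/eqP; have /(congr1 (fun X : op H => X x)) := GF.
    by rewrite mulE Fx scaleE => /eqP; rewrite scaler_eq0 -(rmorph0 (real_complex R))
      (inj_eq (@complexI R)) invr_eq0 (eqr_nat _ 2 0).
  move=> h; have : ip (B x) x <= 0.
    move/eqP: h; rewrite addE addrC addr_eq0 => /eqP ->.
    by rewrite ipNl oppr_le0; case: ps => -[].
  by rewrite !opE ipBl ipZl ipxx subr_le0.
- move=> x0; have sBx : s x = B x.
    apply/eqP; rewrite -subr_eq0 -subE -Fs.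
    have gsB : strong_gen T (s - B) by exact: (algB hS).
    by rewrite (strong_gen_comm2 gF gsB) mulE Fx op0.
  have : ip (B x) x = ip (T x) x - l * nrm x ^+ 2.
    by rewrite !opE ipBl ipZl ipxx.
  rewrite -sBx => h; rewrite -subr_gt0 -h lt_def (proj2 (proj1 ps)) andbT.
  apply: contra x0 => /eqP /(psd_eq0 (proj1 ps)) sx; apply/eqP.
  by rewrite -(Gx0 x) // scaleE addE -sBx sx addr0 scaler0.
Qed.

(** Neumann series: [C = 1 - T / b] is positive of norm at most [q = 1 - a / b < 1], so the partial
    sums of its powers increase and are bounded by [(1 - q)^-1]. *)
Lemma op_inverse T a b : sa T -> 0 < a -> a <= b ->
  (forall x, a * nrm x ^+ 2 <= ip (T x) x <= b * nrm x ^+ 2) ->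
  exists J, [/\ sa J, strong_gen T J, T * J = 1 & J * T = 1].
Proof.
move=> sT a0 ab Tb; have hS := strong_gen_algebra T.
have b0 : 0 < b by exact: lt_le_trans ab.
pose q := 1 - a / b; have q01 : 0 <= q < 1.
  by rewrite subr_ge0 ler_pdivrMr // mul1r ab gtrBl divr_gt0.
pose C := 1 - b^-1 *: T.
have Cform x : ip (C x) x = nrm x ^+ 2 - b^-1 * ip (T x) x.
  by rewrite !opE ipBl ipxx ipZl.
have pC : psd C.
  split=> [|x]; first exact/saB/saZ/sT/sa1.
  by rewrite Cform subr_ge0 ler_pdivrMl //; case/andP: (Tb x).
have Cq x : ip (C x) x <= q * nrm x ^+ 2.
  rewrite Cform mulrBl mul1r lerD2l lerN2 mulrAC (mulrC _ b^-1) ler_wpM2l ?invr_ge0 ?(ltW b0) //.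
  by case/andP: (Tb x).
have Cnrm x : nrm (C x) <= q * nrm x.
  case/andP: q01 => q0 q1; apply: nrm_le_sqr; first by rewrite mulr_ge0 ?nrm_ge0.
  by rewrite (le_trans (psd_nrm x pC Cq))// exprMn expr2 -mulrA ler_wpM2l.
pose G n := \sum_(i < n) C ^+ i.
have GS n : G n.+1 = G n + C ^+ n by rewrite /G big_ord_recr.
have GS' n : G n.+1 = 1 + C * G n.
  rewrite /G big_ord_recl expr0 mulr_sumr; congr (_ + _).
  by apply: eq_bigr => i _; rewrite exprS.
have sG n : sa (G n).
  elim: n => [|n IHn]; first by rewrite /G big_ord0; exact: sa0.
  by rewrite GS; apply: saD => //; apply: saX; case: pC.
have q1 : 0 < 1 - q by rewrite subr_gt0; case/andP: q01.
have Gnrm n x : nrm (G n x) <= (1 - q)^-1 * nrm x.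
  elim: n => [|n IHn].
    by rewrite /G big_ord0 opE nrm0 mulr_ge0 ?nrm_ge0 ?invr_ge0 ?ltW.
  rewrite GS' addE oneE mulE (le_trans (nrmD _ _)) //.
  have -> : (1 - q)^-1 = 1 + q * (1 - q)^-1 by field; rewrite gt_eqF.
  rewrite mulrDl mul1r lerD2l (le_trans (Cnrm _)) // -mulrA ler_wpM2l //.
  by case/andP: q01.
have [||||J hJ _] := @scvg_inc _ _ G (1 - q)^-1.
- by rewrite invr_ge0 ltW.
- by rewrite /G big_ord0; exact: psd0.
- by move=> n; rewrite GS addrC addKr; exact: psdX.
- move=> n x; rewrite (le_trans (ler_norm _)) // (le_trans (ip_le _ _)) //.
  by rewrite expr2 mulrA ler_wpM2r ?nrm_ge0.
have EJ : J = 1 + C * J.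
  apply: (scvg_unique (scvgS hJ)); rewrite (_ : (fun n => _) = (fun n => 1 + C * G n)).
    by apply: scvgD; [exact: scvg_cst|exact: scvgMl].
  exact/funext.
have gC : strong_gen T C.
  by apply: (algB hS); [exact: alg1|exact/(algZ hS)/GenT].
have gJ : strong_gen T J.
  by apply: (alg_lim hS) hJ => n; apply: (alg_sum hS) => i; exact: (algX hS).
have TJ : b^-1 *: (T * J) = 1.
  apply: (addrI (J - b^-1 *: (T * J))); rewrite subrK addrC.
  by move: EJ; rewrite {1}/C mulrBl mul1r -scalerAlo.
exists (b^-1 *: J); split.
- exact/saZ/(scvg_sa sG hJ).
- exact: (algZ hS).
- by rewrite -scalerAro.
- by rewrite -scalerAlo (strong_gen_comm2 gJ (GenT T)).
Qed.

End Algebras.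

(** * Products of decreasing contractions *)

Section Products.
Context {R : realType} {H : hilbertType R}.
Implicit Types (A B T P : op H) (x y z : H) (G : nat -> op H).

Fixpoint prod_op G n : op H := if n is m.+1 then G m.+1 * prod_op G m else G 0%N.

Definition dec_pcontr G := (forall n, pcontr (G n)) /\ (forall n, psd (G n - G n.+1)).

Lemma dec_pcontr_of (T : nat -> H -> H) : decreasing_contractions T ->
  exists2 G, dec_pcontr G & T = (fun n => G n : H -> H).
Proof.
move=> [pT dT].
have /choice[G TG] n : exists A : op H, T n = A :> (H -> H).
  by have [[[bT _] _] _] := pT n; have [A AT] := op_of_bounded bT; exists A.
have pG n : pcontr (G n).
  have [[[_ sT] pT0] pT1] := pT n; rewrite TG in sT pT0 pT1.
  split; last first.
    by move=> x; have := pT1 x; rewrite nrmE -rmorphXn lecE => /andP[_].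
  split; first by apply: op_ext => x; rewrite -adjointE sT.
  by move=> x; have := pT0 x; rewrite lecE => /andP[_].
exists G; last by apply/funext.
split=> // n; have [[_ _] hT] := dT n; split=> [|x].
  by apply: saB; [case: (pG n) => -[]|case: (pG n.+1) => -[]].
by have := hT x; rewrite !TG lecE subE => /andP[_].
Qed.

Lemma ordered_productE G n : ordered_product (fun n => G n : H -> H) n = prod_op G n.
Proof. by elim: n => [|n IHn] //=; rewrite IHn. Qed.

Lemma dec_pcontr_lim G : dec_pcontr G -> exists2 T, scvg G T &
  pcontr T /\ forall n, psd (G n - T).
Proof.
move=> [pG dG]; have [T hT dT] := scvg_dec pG dG; exists T => //; split=> //.
exact: scvg_pcontr hT.
Qed.

Lemma dec_pcontr_le G m n x : dec_pcontr G -> (m <= n)%N -> ip (G n x) x <= ip (G m x) x.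
Proof.
move=> [_ dG] mn; rewrite -(subnKC mn); elim: (n - m)%N => [|k IHk]; rewrite ?addn0 //.
apply: le_trans IHk; have [_ /(_ x)] := dG (m + k)%N.
by rewrite subE ipBl subr_ge0 addnS.
Qed.

Section Limits.
Variables (G : nat -> op H) (T P : op H).
Hypotheses (hG : dec_pcontr G) (hT : scvg G T) (pT : pcontr T) (GT : forall n, psd (G n - T)).
Hypotheses (hP : scvg (fun n => T ^+ n) P) (sP : sa P) (PP : P * P = P) (TP : T * P = P).

Let S := prod_op G.
Let pG n : pcontr (G n). Proof. by case: hG. Qed.
Let sG n : sa (G n). Proof. by case: (pG n) => -[]. Qed.

(** As [T <= G n <= 1], the form of [1 - G n] at [P x] lies between 0 and that of [1 - T], which is
    0. *)
Lemma mul_fix n : G n * P = P.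
Proof.
apply: op_ext => x; apply/eqP; rewrite eq_sym -subr_eq0; apply/eqP.
have := @psd_eq0 _ _ (1 - G n) (P x) (proj1 (pcontr1B (pG n))).
rewrite subE oneE mulE; apply; apply/eqP; rewrite eq_le; apply/andP; split.
  have [_ /(_ (P x))] := GT n; rewrite subE !ipBl -[T (P x)]mulE TP.
  by rewrite subr_ge0 subr_le0.
by case: (pcontr1B (pG n)) => -[_ /(_ (P x))]; rewrite subE oneE.
Qed.

Lemma fix_mul n : P * G n = P.
Proof. by rewrite -{1}sP -(sG n) -starM mul_fix. Qed.

Lemma prod_mul_fix n : S n * P = P.
Proof. by elim: n => [|n IHn] /=; rewrite ?mul_fix // -mulrA IHn mul_fix. Qed.

Lemma fix_mul_prod n : P * S n = P.
Proof. by elim: n => [|n IHn] /=; rewrite ?fix_mul // mulrA fix_mul IHn. Qed.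

Lemma prod_nrm n x : nrm (S n x) <= nrm x.
Proof.
elim: n => [|n IHn]; first exact: pcontr_nrm (pG 0%N).
by apply: le_trans IHn; exact: pcontr_nrm (pG n.+1).
Qed.

Lemma star_prodS n : star (S n.+1) = star (S n) * G n.+1.
Proof. by rewrite /S /= starM sG. Qed.

Lemma star_prod_nrm n x : nrm (star (S n) x) <= nrm x.
Proof.
elim: n x => [|n IHn] x; first by rewrite [star _]sG pcontr_nrm.
by rewrite star_prodS mulE (le_trans (IHn _)) // pcontr_nrm.
Qed.

(** There are [k + 1] factors, [G n] to [G (n + k)] with increasing indices, as they stand at the
    right end of the adjoint of [S]. *)
Fixpoint tail_prod n k := if k is k'.+1 then G n * tail_prod n.+1 k' else G n.

Lemma star_prod_tail n k : star (S (n + k.+1)%N) = star (S n) * tail_prod n.+1 k.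
Proof.
elim: k n => [|k IHk] n; first by rewrite addn1 star_prodS.
by rewrite addnS -addSn IHk star_prodS mulrA.
Qed.

Lemma tail_prod_cvg k : scvg (fun n => tail_prod n k) (T ^+ k.+1).
Proof.
elim: k => [|k IHk] //; rewrite exprS; apply: (@scvgM _ _ 1).
- by move=> n x; rewrite mul1r; exact: pcontr_nrm.
- exact: hT.
- exact: scvgS IHk.
Qed.

(* T_1 ... T_n x is at most T_{n-k} ... T_n x in norm, which tends to T^{k+1} x. *)
Lemma star_prod_cvg : scvg (fun n => star (S n)) P.
Proof.
move=> x; apply/cvg_vec => e e0; have e2 : 0 < e / 2 by rewrite divr_gt0.
have /cvg_vec/(_ _ e2)[k hk] := scvgS hP (x := x).
have /cvg_vec/(_ _ e2)[n0 hn] := tail_prod_cvg (k := k) (x := x).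
exists (n0 + k.+1)%N => n n0n; rewrite -(subnK (leq_trans (leq_addl _ _) n0n)).
have n1 : (n0 <= n - k.+1)%N by rewrite leq_subRL ?(leq_trans _ n0n) ?leq_addl // addnC.
(* [P] is written as [star (S m) * P], so that the contraction [star (S m)] factors out of the
   difference. *)
rewrite star_prod_tail mulE -[P in X in nrm (_ - X)](_ : star (S (n - k.+1)%N) * P = P); last first.
  by rewrite -{1}sP -starM fix_mul_prod.
rewrite mulE -opB (le_lt_trans (star_prod_nrm _ _)) //.
rewrite (le_lt_trans (nrm_tri ((T ^+ k.+1) x) _ _)) //.
have := hn _ (leqW n1); have := hk _ (leqnn k); lra.
Qed.

Lemma prod_weak_cvg x y : (fun n => ip (S n x) y) @ \oo --> ip (P x) y.
Proof.
rewrite (_ : (fun n => _) = (fun n => ip x (star (S n) y))); last first.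
  by apply/funext => n; rewrite starP.
by rewrite starP sP; apply: cvg_ip; [exact: cvg_cst|exact: star_prod_cvg].
Qed.

Lemma prod_cvg_limit x (l : H) : (fun n => S n x) @ \oo --> l -> l = P x.
Proof.
move=> hl; apply: ip_inj => y.
apply: (cvg_unique _ _ (@prod_weak_cvg x y)) => //.
by apply: cvg_ip => //; exact: cvg_cst.
Qed.

End Limits.

End Products.

(** * Essential spectrum *)

Section EssentialSpectrum.
Context {R : realType} {H : hilbertType R}.
Implicit Types (A B T P : op H) (x y z : H) (G : nat -> op H) (w : nat -> H).

Lemma nonincreasing_cvg0 (a : nat -> R) :
  (forall n, a n.+1 <= a n) -> (forall n, 0 <= a n) ->
  (fun n => a n - a n.+1) @ \oo --> (0 : R).
Proof.
move=> aS a0; have [l al] : exists l : R, a @ \oo --> l.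
  exists (inf (range a)); apply: nonincreasing_cvgn; last by exists 0 => _ [n _ <-].
  exact/nonincreasing_seqP.
by rewrite -(subrr l); apply: cvgB => //; rewrite (@cvg_shiftS _ a).
Qed.

Lemma cvg0_le (a b : nat -> R) (n0 : nat) (C : R) : 0 <= C ->
  (forall n, (n0 <= n)%N -> 0 <= b n <= C * a n) ->
  a @ \oo --> (0 : R) -> b @ \oo --> (0 : R).
Proof.
move=> C0 h ha; apply: (@squeeze_cvgr _ _ _ _ (cst 0) (fun n => C * a n)).
- by exists n0.
- exact: cvg_cst.
- by rewrite -(mulr0 C); exact: cvgMr.
Qed.

Lemma cvg0_sqr (a : nat -> R) : (forall n, 0 <= a n) ->
  (fun n => a n ^+ 2) @ \oo --> (0 : R) -> a @ \oo --> (0 : R).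
Proof.
move=> a0 /cvg_eventually h; apply/cvg_eventually => e e0.
have [|n0 hn] := h (e ^+ 2); first by rewrite exprn_gt0.
exists n0 => n /hn; rewrite !subr0 !ger0_norm ?sqr_ge0 //.
by rewrite ltr_pXn2r ?nnegrE ?(ltW e0).
Qed.

(** For [y = S_m x] and [m >= n0]: [|(1 - G n0) y|^2 <= |y|^2 - <G n0 y, y> <= |y|^2 - <G m.+1 y, y>
    <= |S_m x|^2 - |S_m.+1 x|^2], the decrement of a convergent sequence. *)
Lemma prod_defect G (n0 : nat) x : dec_pcontr G ->
  (fun m => nrm ((1 - G n0) (prod_op G m x))) @ \oo --> (0 : R).
Proof.
move=> hG; have pG n : pcontr (G n) by case: hG.
apply: cvg0_sqr => [n|]; first exact: nrm_ge0.
pose a m := nrm (prod_op G m x) ^+ 2.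
have aS m : a m.+1 <= ip (G m.+1 (prod_op G m x)) (prod_op G m x).
  exact: pcontr_nrm2 (pG m.+1).
apply: (@cvg0_le (fun m => a m - a m.+1) _ n0 1) => // [m n0m|].
  rewrite sqr_ge0 mul1r /= (le_trans (pcontr_nrm2 _ (pcontr1B (pG n0)))) //.
  rewrite subE oneE ipBl ipxx lerD2l lerN2 (le_trans (aS m)) //.
  exact/dec_pcontr_le/leqW.
apply: nonincreasing_cvg0 => [m|m]; last exact: sqr_ge0.
by apply: le_trans (aS m) _; case: (pG m.+1).
Qed.

Lemma resolvent_bound T (l : R) : ~ spectrum T l%:C ->
  exists2 C, 0 < C & forall x, nrm x <= C * nrm (T x - l%:C *: x).
Proof.
move=> /contrapT[B [bB BT _]]; have [B' BE] := op_of_bounded bB.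
have [C C0 hC] := opbd B'; exists C => // x; rewrite (le_trans _ (hC _)) //.
by rewrite BE -[B _]/((B \o (fun x => T x - l%:C *: x)) x) BT.
Qed.

(* The infimum m of the form of A^2 - e A is a spectral value of that operator;
   were m negative, A^2 - e A - m would factor as (A - r1)(A - r2) with roots
   r1, r2 in ]0, e[, so that it would be bounded below. *)
Lemma spectral_gap A (e : R) : psd A -> 0 < e ->
  (forall r, 0 < r < e -> exists2 C, 0 < C & forall x, nrm x <= C * nrm (A x - r%:C *: x)) ->
  forall x, e * ip (A x) x <= nrm (A x) ^+ 2.
Proof.
move=> pA e0 hr x0; have sA : sa A by case: pA.
pose q x := nrm (A x) ^+ 2 - e * ip (A x) x.
have qZ (t : R) x : q (t%:C *: x) = t ^+ 2 * q x.
  by rewrite /q opZc -!ipxx !ipE; ring.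
have qlb x : - (e ^+ 2 / 4) * nrm x ^+ 2 <= q x.
  have := sqr_ge0 (nrm (A x - (e / 2)%:C *: x)); rewrite /q -!ipxx !ipE (ipC x); lra.
rewrite -subr_ge0 -/(q x0) leNgt; apply/negP => q0.
have x0n0 : x0 != 0 by apply: contraTneq q0 => ->; rewrite /q op0 ip0l nrm0 expr0n /= mulr0 subr0 ltxx.
have nx0 := nrm_gt0 x0n0.
pose S := [set q x | x in [set x | nrm x = 1]].
have S0 : S !=set0.
  exists (q ((nrm x0)^-1%:C *: x0)), ((nrm x0)^-1%:C *: x0) => //=.
  by rewrite nrmZ ger0_norm ?invr_ge0 ?nrm_ge0 // mulVf // gt_eqF.
have Slb : has_lbound S.
  by exists (- (e ^+ 2 / 4)) => _ [x nx <-]; have := qlb x; rewrite nx expr1n mulr1.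
pose m := inf S.
have mq x : m * nrm x ^+ 2 <= q x.
  have [->|xn0] := eqVneq x 0; first by rewrite /q op0 ip0l nrm0 !expr0n /= !mulr0 subr0.
  have nx := nrm_gt0 xn0.
  have : m <= q ((nrm x)^-1%:C *: x).
    apply: ge_inf => //; exists ((nrm x)^-1%:C *: x) => //=.
    by rewrite nrmZ ger0_norm ?invr_ge0 ?nrm_ge0 // mulVf // gt_eqF.
  by rewrite qZ exprVn mulrC ler_pdivlMr // exprn_gt0.
have m0 : m < 0.
  have := mq x0; have := exprn_gt0 2 nx0; move: q0; nra.
have mlb : - (e ^+ 2 / 4) <= m.
  apply: lb_le_inf => // _ [x nx <-]; have := qlb x; rewrite nx expr1n mulr1; exact.
(* The roots of [r^2 - e r - m] are [(e - d) / 2] and [(e + d) / 2]; they lie in ]0, e[ because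
   [- e^2 / 4 <= m < 0]. *)
pose d := Num.sqrt (e ^+ 2 + 4 * m).
have dE : d ^+ 2 = e ^+ 2 + 4 * m by rewrite sqr_sqrtr //; lra.
have d0 : 0 <= d by exact: sqrtr_ge0.
have de : d < e by rewrite -(@ltr_pXn2r _ 2) ?nnegrE ?(ltW e0) // dE; lra.
have [|C1 C10 h1] := hr ((e + d) / 2); first by apply/andP; split; lra.
have [|C2 C20 h2] := hr ((e - d) / 2); first by apply/andP; split; lra.
pose C := A * A - e *: A - m *: (1 : op H).
have CE x : C x = A (A x - ((e - d) / 2)%:C *: x) - ((e + d) / 2)%:C *: (A x - ((e - d) / 2)%:C *: x).
  have mE : m = (d ^+ 2 - e ^+ 2) / 4 by rewrite dE; field.
  by apply: ip_inj => z; rewrite /C !(opE, oplE, ipE) mE; field.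
have Cq x : ip (C x) x = q x - m * nrm x ^+ 2.
  by rewrite !opE !ipBl !ipZl ipxx (ip_sqr_nrm _ sA).
have pC : psd C.
  split=> [|x]; last by rewrite Cq subr_ge0.
  by apply/saB/saZ/sa1/saB/saZ/sA; rewrite /sa starM sA.
have [b b0 hb] := opbd C.
have Cb x : ip (C x) x <= b * nrm x ^+ 2.
  rewrite (le_trans (ler_norm _)) // (le_trans (ip_le _ _)) //.
  by rewrite expr2 mulrA ler_wpM2r ?nrm_ge0.
(* The two resolvent bounds give [|x| <= C1 C2 |C x|] and [psd_nrm] gives [|C x|^2 <= b <C x, x>].
   So q is at least [m + g] on unit vectors, against the choice of m. *)
pose g := ((C1 * C2) ^+ 2 * b)^-1.
have g0 : 0 < g by rewrite invr_gt0 mulr_gt0 // exprn_gt0 // mulr_gt0.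
have gC x : g * nrm x ^+ 2 <= q x - m * nrm x ^+ 2.
  rewrite -Cq ler_pdivrMl ?mulr_gt0 ?exprn_gt0 ?mulr_gt0 // -mulrA.
  apply: (@le_trans _ _ ((C1 * C2) ^+ 2 * nrm (C x) ^+ 2)); last first.
    by rewrite ler_wpM2l ?sqr_ge0 // psd_nrm.
  rewrite -exprMn ler_pXn2r ?nnegrE ?mulr_ge0 ?nrm_ge0 ?(ltW C10) ?(ltW C20) //.
  by rewrite (le_trans (h2 x)) // mulrAC (mulrC _ C2) ler_wpM2l ?(ltW C20) // CE h1.
have [_ [x nx <-]] := inf_adherent g0 (conj S0 Slb); rewrite -/m.
by have := gC x; rewrite nx expr1n !mulr1; lra.
Qed.

(** Put [A = 1 - T]. Cauchy-Schwarz for the form of A turns the gap hypothesis into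
    [e |A w|^2 <= <A (A w), A w>], a bound on the range of A. It passes to [z - P z], the limit of
    the vectors [z - T^k z] of that range. *)
Lemma spectral_gap_range T P (e : R) : pcontr T ->
  (forall x, e * ip ((1 - T) x) x <= nrm ((1 - T) x) ^+ 2) -> 0 < e ->
  scvg (fun n => T ^+ n) P ->
  forall z, e * nrm (z - P z) ^+ 2 <= ip ((1 - T) (z - P z)) (z - P z).
Proof.
move=> pT hA e0 hP z; set A := 1 - T in hA *; have pA : psd A by case: (pcontr1B pT).
have hAw (w : H) : e * nrm (A w) ^+ 2 <= ip (A (A w)) (A w).
  have := form_cs (A w) w pA; rewrite (saP _ w (proj1 pA)) ipxx => h.
  have := hA w; have := sqr_ge0 (nrm (A w)).
  have [->|n0] := eqVneq (nrm (A w) ^+ 2) 0; first by rewrite mulr0; case: pA.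
  move=> h2 h3; have np : 0 < nrm (A w) ^+ 2 by rewrite lt_def n0.
  rewrite -(ler_pM2r np) -mulrA -expr2 (le_trans (ler_wpM2l (ltW e0) h)) //.
  by rewrite mulrCA ler_wpM2l //; case: pA.
have hk k : e * nrm (z - (T ^+ k) z) ^+ 2 <= ip (A (z - (T ^+ k) z)) (z - (T ^+ k) z).
  suff [w ->] : exists w : H, z - (T ^+ k) z = A w by exact: hAw.
  elim: k => [|k [w IHw]]; first by exists 0; rewrite oneE subrr op0.
  exists (w + (T ^+ k) z); rewrite opD -IHw /A exprSE subE oneE addrA.
  by rewrite subrK.
have lim : (fun k => z - (T ^+ k) z) @ \oo --> z - P z by apply: cvgB; [exact: cvg_cst|exact: hP].
rewrite -ipxx -subr_ge0; have l1 := cvg_ip lim lim.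
have l2 := cvg_ip (op_cvg (A := A) lim) lim.
have l3 : (fun k => ip (A (z - (T ^+ k) z)) (z - (T ^+ k) z) -
    e * ip (z - (T ^+ k) z) (z - (T ^+ k) z)) @ \oo -->
    ip (A (z - P z)) (z - P z) - e * ip (z - P z) (z - P z).
  by apply: cvgB => //; exact: cvgMr.
by apply: (cvg_to_ge l3) => k; rewrite subr_ge0 ipxx.
Qed.

Definition weakly_null w := forall y, (fun n => ip (w n) y) @ \oo --> (0 : R).

(** Gram-Schmidt, one vector at a time: F receives a rank one correction along [d = b - F b]. Only
    real linearity is kept, and finite rank turns weakly null sequences into norm null ones. *)
Lemma finite_span_projection (s : seq H) : exists F : H -> H,
  [/\ forall x y, F (x + y) = F x + F y, forall (a : R) x, F (a%:C *: x) = a%:C *: F x,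
      {in s, forall b, F b = b} &
      forall w, weakly_null w -> (fun n => F (w n)) @ \oo --> (0 : H)].
Proof.
elim: s => [|b s [F [FD FZ Fs Fw]]].
  exists (fun=> 0); split=> // [x y|a x|w _]; rewrite ?addr0 ?scaler0 //.
  exact: cvg_cst.
pose d := b - F b; have [d0|dn0] := eqVneq d 0.
  exists F; split=> // x; rewrite inE => /orP[/eqP ->|/Fs//].
  by apply/eqP; rewrite eq_sym -subr_eq0; apply/eqP.
pose c x := (nrm d ^+ 2)^-1 * ip (x - F x) d.
have cD x y : c (x + y) = c x + c y by rewrite /c FD !ipE; ring.
have cZ (a : R) x : c (a%:C *: x) = a * c x by rewrite /c FZ !ipE; ring.
exists (fun x => F x + (c x)%:C *: d); split.
- by move=> x y; rewrite FD cD rmorphD scalerDl addrACA.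
- by move=> a x; apply: ip_inj => v; rewrite FZ cZ !ipE; ring.
- move=> x; rewrite inE => /orP[/eqP ->|/Fs Fx]; rewrite /c ?Fx.
    by rewrite -/d ipxx mulVf ?sqrf_eq0 ?gt_eqF ?nrm_gt0 // scale1r addrC subrK.
  by rewrite subrr ip0l mulr0 scale0r addr0.
- move=> w hw; rewrite -(addr0 (0 : H)); apply: cvgD; first exact: Fw.
  apply/cvg_nrmP; under eq_fun do rewrite subr0 nrmZ.
  rewrite -(mul0r (nrm d)); apply: cvgMl; apply/norm_cvg0P.
  rewrite -(mulr0 (nrm d ^+ 2)^-1); apply: cvgMr.
  under eq_fun do rewrite ipBl; rewrite -(subrr 0) -{2}(ip0l d).
  by apply: cvgB; [exact: hw|apply: cvg_ip; [exact: Fw|exact: cvg_cst]].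
Qed.

Lemma weakly_null_finite_dimensional (V : set H) w :
  finite_dimensional V -> (forall n, V (w n)) -> weakly_null w -> w @ \oo --> (0 : H).
Proof.
move=> [n [b hb]] Vw hw.
(* The complex span of the [b i] is the real span of the [b i] and the ['i *: b i]. *)
have [F [FD FZ Fs Fw]] := finite_span_projection
  ([seq b i | i <- enum 'I_n] ++ [seq 'i *: b i | i <- enum 'I_n]).
rewrite (_ : w = (fun m => F (w m))); first exact: Fw.
apply/funext => m; have [c ->] := hb _ (Vw m).
have F0 : F 0 = 0 by rewrite -(scale0r 0) -(rmorph0 (real_complex R)) FZ !scale0r.
rewrite (big_morph F FD F0); apply: eq_bigr => i _; case: (c i) => p q.
have -> : (p +i* q) *: b i = p%:C *: b i + q%:C *: ('i *: b i).
  rewrite scalerA -scalerDl; congr (_ *: _).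
  by apply/eqP; rewrite eq_complex /= !(mulr0, mulr1, mul0r, add0r, subr0, addr0) !eqxx.
by rewrite FD !FZ !Fs // mem_cat; apply/orP; [right|left]; apply/mapP; exists i; rewrite ?mem_enum.
Qed.

Lemma prod_cvg_essential G P (n0 : nat) x : dec_pcontr G ->
  (forall n, G n * P = P) -> (forall y, (fun n => ip (prod_op G n x) y) @ \oo --> ip (P x) y) ->
  ~ essential_spectrum (G n0) 1 -> (fun n => prod_op G n x) @ \oo --> P x.
Proof.
move=> hG GP hw ess; have pG : pcontr (G n0) by case: hG.
pose z m := prod_op G m x - P x; pose A := 1 - G n0.
have zw : weakly_null z.
  move=> y; under eq_fun do rewrite ipBl.
  by rewrite -(subrr (ip (P x) y)); apply: cvgB; [exact: hw|exact: cvg_cst].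
have AP : A (P x) = 0 by rewrite /A subE oneE -mulE GP subrr.
have Az : (fun m => nrm (A (z m))) @ \oo --> (0 : R).
  rewrite (_ : (fun m => _) = (fun m => nrm (A (prod_op G m x)))); first exact: prod_defect.
  by apply/funext => m; rewrite opB AP subr0.
suff z0 : z @ \oo --> (0 : H).
  by apply/cvg_nrmP; move/cvg_nrmP: z0; under eq_fun do rewrite subr0.
have AE y : A y = - (G n0 y - y) by rewrite subE opprB.
have [nsp|[iso _ fin]] : ~ spectrum (G n0) 1%:C \/
    [/\ isolated (spectrum (G n0) : set R[i]^o) 1, eigenvalue_of (G n0) 1 &
        finite_dimensional (eigenspace_of (G n0) 1)].
  have [sp|] := pselect (spectrum (G n0) 1%:C); last by left.
  by right; apply: contrapT => h; apply: ess; split.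
(* Outside the spectrum [1 - G n0] is bounded below, so the vanishing of [A (z m)] already gives
   that of [z m]. *)
- have [C C0 hC] := resolvent_bound nsp.
  apply/cvg_nrmP; under eq_fun do rewrite subr0.
  apply: (@cvg0_le _ _ 0%N C) Az; rewrite ?(ltW C0) // => m _; rewrite nrm_ge0 andTb.
  by rewrite AE nrmN; have := hC (z m); rewrite scale1r.
have [K [hK _ sK KK TK]] := fix_projection pG.
(* e is the radius of a ball around 1 that meets the spectrum only at 1; it becomes the gap of [A]
   above 0. *)
have [e e0 he] : exists2 e : R, 0 < e & forall r, 0 < r < e -> ~ spectrum (G n0) (1 - r)%:C.
  case: iso => _ [V /nbhs_ballP[e /= e0 eV] VS].
  move: e0; rewrite ltcE => /andP[/eqP ei er]; exists (complex.Re e) => // r /andP[r0 re] sp.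
  have : (V `&` spectrum (G n0)) (1 - r)%:C.
    split=> //; apply: eV; rewrite /ball /= rmorphB /= opprB addrCA subrr addr0.
    by rewrite normc_def /= expr0n addr0 sqrtr_sqr gtr0_norm // ltcE /= ei eqxx.
  by rewrite VS => -[] /eqP; rewrite subr_eq addrC -subr_eq subrr eq_sym gt_eqF.
have gap := @spectral_gap A e (proj1 (pcontr1B pG)) e0.
have {}gap y : e * ip (A y) y <= nrm (A y) ^+ 2.
  apply: gap => r hr; have [C C0 hC] := resolvent_bound (he _ hr).
  exists C => // u; rewrite (le_trans (hC u)) //; rewrite -nrmN le_eqVlt.
  apply/orP; left; apply/eqP; congr (_ * nrm _).
  by rewrite AE rmorphB scalerBl scale1r; apply: ip_inj => v; rewrite !ipE; ring.
have gap2 := spectral_gap_range pG gap e0 hK.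
have Kz : (fun m => K (z m)) @ \oo --> (0 : H).
  apply: (weakly_null_finite_dimensional fin) => [m|y].
    by rewrite /eigenspace_of /= scale1r -mulE TK.
  by under eq_fun do rewrite (saP _ _ sK); exact: zw.
have uz : (fun m => z m - K (z m)) @ \oo --> (0 : H).
  apply/cvg_nrmP; under eq_fun do rewrite subr0.
  apply: (@cvg0_le _ _ 0%N e^-1) Az => [|m _]; first by rewrite invr_ge0 ltW.
  rewrite nrm_ge0 andTb mulrC ler_pdivlMr //.
  have := gap2 (z m); have -> : (1 - G n0) (z m - K (z m)) = A (z m).
    by rewrite opB [X in _ - X](_ : _ = 0) ?subr0 // subE oneE -mulE TK subrr.
  set n := nrm _; have [-> _|nn0] := eqVneq n 0; first by rewrite mul0r nrm_ge0.
  have np : 0 < n by rewrite lt_def nn0 nrm_ge0.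
  move=> h; rewrite -(ler_pM2r np) (le_trans _ (le_trans h _)) //; first by rewrite expr2 mulrAC mulrC mulrA.
  by rewrite (le_trans (ler_norm _)) // ip_le.
rewrite (_ : z = (fun m => (z m - K (z m)) + K (z m))); last first.
  by apply/funext => m; rewrite subrK.
by rewrite -(addr0 (0 : H)); exact: cvgD uz Kz.
Qed.

End EssentialSpectrum.

(** * The spectral theorem *)

Section RealMeasures.
Context {R : realType}.
Implicit Types (f : R -> R) (a b c : R).
Local Notation TR := (measurableTypeR R).
Implicit Types (mu : {finite_measure set TR -> \bar R}) (A : set TR).

Lemma stieltjes_finite_measure f c :
  {homo f : x y / x <= y} -> right_continuous f ->
  (forall t, t < 0 -> f t = 0) -> (forall t, 1 <= t -> f t = c) ->
  exists2 mu : {finite_measure set TR -> \bar R}, forall a b, a <= b -> mu `]a, b]%classic = (f b - f a)%:E & mu setT = c%:E.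
Proof.
move=> fnd frc f0 f1.
pose F : cumulative R R := HB.pack f (isCumulative.Build R _ R f fnd frc).
pose m := lebesgue_stieltjes_measure F.
have mE a b : a <= b -> m `]a, b]%classic = (f b - f a)%:E.
  move=> ab; rewrite /m /lebesgue_stieltjes_measure /measure_extension.
  by rewrite measurable_mu_extE /= ?wlength_itv_bnd //; exact: is_ocitv.
have mT : m setT = c%:E.
  (* The total mass is the limit over the intervals []-n, n]], whose masses equal c as soon as n is
     at least 1. *)
  rewrite -(bigcup_itvT false false).
  pose I n : set R := `]- (n%:R), n%:R]%classic.
  have l1 : (m \o I) n @[n --> \oo] --> c%:E.
    apply: cvg_near_cst; exists 1%N => // n /= n1.
    rewrite mE; last by rewrite lerNl (le_trans _ (ler0n _ n)) // oppr_le0.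
    rewrite f1 ?ler1n // f0 ?subr0 // oppr_lt0 ltr0n //.
  have l2 : (m \o I) n @[n --> \oo] --> m (\bigcup_n I n).
    apply: nondecreasing_cvg_mu; rewrite /I //; first exact: bigcup_measurable.
    by move=> *; apply/subsetPset/subset_itv; rewrite leBSide/= ?lerN2 ler_nat.
  exact: (cvg_unique _ l2 l1).
have mTfin : (m setT < +oo)%E by rewrite mT ltry.
(* Restricting to the whole line changes no value; it only equips the measure with its
   finiteness. *)
exists (mfrestr (measurableT : measurable (setT : set TR)) mTfin : {finite_measure set TR -> \bar R}).
  by move=> a b ab; rewrite -(mE _ _ ab) -[in RHS](setIT `]a, b]%classic).
by rewrite -mT -[in RHS](setIT setT).
Qed.

Lemma measurable_fun_coord A :
  measurable_fun A (fun t : TR => (t : R)%:E).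
Proof. by apply/measurable_EFinP; exact: measurable_id. Qed.

Lemma Rintegral_null mu A : measurable A -> mu A = 0%E -> \int[mu]_(t in A) (t : R) = 0.
Proof.
move=> mA A0; rewrite /Rintegral null_set_integral //; exact: measurable_fun_coord.
Qed.

Lemma Rintegral_split mu A : measurable A ->
  mu.-integrable setT (fun t : TR => (t : R)%:E) ->
  \int[mu]_(t in setT) (t : R) = \int[mu]_(t in A) (t : R) + \int[mu]_(t in ~` A) (t : R).
Proof.
move=> mA hi; rewrite -Rintegral_setU ?setUv //; first exact: measurableC.
by rewrite disj_set2E setICr.
Qed.

Lemma Rintegral_support mu A : measurable A -> mu (~` A) = 0%E ->
  mu.-integrable setT (fun t : TR => (t : R)%:E) ->
  \int[mu]_(t in setT) (t : R) = \int[mu]_(t in A) (t : R).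
Proof.
by move=> mA A0 hi; rewrite (Rintegral_split mA hi) (Rintegral_null (measurableC mA) A0) addr0.
Qed.

Lemma Rintegral_bounds mu A a b : measurable A ->
  mu.-integrable A (fun t : TR => (t : R)%:E) -> (forall t, A t -> a <= t <= b) ->
  a * fine (mu A) <= \int[mu]_(t in A) (t : R) <= b * fine (mu A).
Proof.
move=> mA hi h; rewrite -!Rintegral_cst //; apply/andP; split.
- by apply: le_Rintegral => //; [exact: finite_measure_integrable_cst|move=> t /h /andP[]].
- by apply: le_Rintegral => //; [exact: finite_measure_integrable_cst|move=> t /h /andP[]].
Qed.

(** On A the function [t - 1] has constant sign and integral 0, hence vanishes almost everywhere. *)
Lemma mean_one_null mu A : measurable A ->
  mu.-integrable setT (fun t : TR => (t : R)%:E) -> mu (~` A) = 0%E ->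
  \int[mu]_(t in setT) (t : R) = fine (mu setT) ->
  (forall t, A t -> 1 <= t) \/ (forall t, A t -> t <= 1) ->
  mu (~` [set 1]) = 0%E.
Proof.
move=> mA hi A0 hm sgn; have hiA : mu.-integrable A (fun t : TR => (t : R)%:E).
  by apply: integrableS hi.
have mC1 : measurable (~` [set 1] : set TR) by exact: (measurableC (measurable_set1 (1 : R))).
have muA : fine (mu A) = fine (mu setT).
  have mAC := measurableC mA.
  suff -> : mu setT = (mu A + mu (~` A))%E by rewrite A0 adde0.
  by rewrite -(setUv A); apply: measureU => //; exact: setICr.
have h1 : mu.-integrable A (EFin \o cst (1 : R)) by exact: finite_measure_integrable_cst.
have int0 : \int[mu]_(t in A) ((t : R) - 1) = 0.
  by rewrite RintegralB // -(Rintegral_support mA A0 hi) hm Rintegral_cst // mul1r muA subrr.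
have hiB : mu.-integrable A (fun t : TR => ((t : R) - 1)%:E).
  by have := integrableB mA hiA h1; apply: eq_integrable.
have mB : measurable_fun A (fun t : TR => ((t : R) - 1)%:E) by case/integrableP: hiB.
have int1 : \int[mu]_(t in A) `|(t : R) - 1| = 0.
  case: sgn => sgn.
    rewrite -[RHS]int0; apply: eq_Rintegral => t /set_mem /sgn t1.
    by rewrite ger0_norm ?subr_ge0.
  have := @RintegralZl _ _ _ mu A (fun t : TR => (t : R) - 1) (- 1) mA hiB.
  rewrite int0 mulr0 => <-; apply: eq_Rintegral => t /set_mem /sgn t1.
  by rewrite ler0_norm ?subr_le0 // mulN1r.
have int2 : (\int[mu]_(t in A) `|((t : R) - 1)%:E| = 0)%E.
  apply/eqP; rewrite -fine_eq0; first by apply/eqP; exact: int1.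
  exact/integrable_fin_num/integrable_abse.
have /(@ae_eq_integral_abs _ _ _ mu A mA _ mB) [N [mN N0 AN]] := int2.
apply/eqP; rewrite -measure_le0.
apply: (@le_trans _ _ (mu (N `|` ~` A))); last first.
  have := measureU2 mu mN (measurableC mA); rewrite /= N0 A0 adde0; exact.
apply: le_measure; rewrite ?inE //; first exact/measurableU/measurableC.
move=> t t1; have [At|nA] := pselect (A t); last by right.
left; apply: AN => /= /(_ At) /eqP; rewrite eqe subr_eq0 => /eqP; exact: t1.
Qed.

End RealMeasures.

(** * Resolution of the identity of a positive contraction *)

Section SpectralFamily.
Context {R : realType} {H : hilbertType R}.
Implicit Types (A B T P E : op H) (x y z : H) (a b l : R).

Definition projector E := sa E /\ E * E = E.

Lemma proj_form E x : projector E -> ip (E x) x = nrm (E x) ^+ 2.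
Proof. by move=> [sE EE]; rewrite -{1}EE mulE (ip_sqr_nrm _ sE). Qed.

Lemma proj1B E : projector E -> projector (1 - E).
Proof.
move=> [sE EE]; split; first exact/saB/sE/sa1.
by rewrite mulrBr mulrBl mulr1 mul1r mulrBl mul1r EE subrr subr0.
Qed.

Lemma proj_1 : projector 1. Proof. by split; [exact: sa1|rewrite mulr1]. Qed.
Lemma proj_0 : projector 0. Proof. by split; [exact: sa0|rewrite mulr0]. Qed.

Lemma proj_pcontr E : projector E -> pcontr E.
Proof.
move=> pE; have [sE EE] := pE; split; first by split=> // x; rewrite proj_form ?sqr_ge0.
move=> x; rewrite -subr_ge0 -ipxx -{1}[x]oneE -ipBl -subE.
by rewrite proj_form ?sqr_ge0 //; exact: proj1B.
Qed.

Lemma sa_form_inj A B : sa A -> sa B -> (forall x, ip (A x) x = ip (B x) x) -> A = B.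
Proof.
move=> sA sB h; apply/eqP; rewrite -subr_eq0; apply/eqP/op_ext => x.
apply: psd_eq0; last by rewrite subE ipBl h subrr.
by split=> [|y]; [exact: saB|rewrite subE ipBl h subrr].
Qed.

Lemma proj_orth E B : projector E -> projector B ->
  (forall x, ip (E x) x + ip (B x) x <= nrm x ^+ 2) -> E * B = 0.
Proof.
move=> pE pB h; apply: op_ext => x; apply: nrm0_eq0; apply/eqP.
rewrite -sqrf_eq0 eq_le sqr_ge0 andbT mulE -proj_form //.
have := h (B x); rewrite -[B (B x)]mulE (proj2 pB) ipxx; lra.
Qed.

Lemma proj_mulC E B : projector E -> projector B -> E * B = 0 -> B * E = 0.
Proof. by move=> [sE _] [sB _] EB; rewrite -sE -sB -starM EB star0. Qed.

Lemma projD E B : projector E -> projector B -> E * B = 0 -> projector (E + B).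
Proof.
move=> pE pB EB; split; first by apply: saD; [case: pE|case: pB].
by rewrite mulrDl !mulrDr (proj2 pE) (proj2 pB) EB (proj_mulC pE pB EB) addr0 add0r.
Qed.

Lemma proj_sub E B : projector E -> projector B -> E * B = E -> projector (B - E).
Proof.
move=> [sE EE] [sB BB] EB; have BE : B * E = E by move: (congr1 star EB); rewrite starM sE sB.
by split; [exact: saB|rewrite mulrBl !mulrBr BB EB BE EE subrr subr0].
Qed.

Lemma spectral_cut_all T l : pcontr T -> exists E,
  [/\ projector E, strong_gen T E,
      forall x, E x = x -> ip (T x) x <= l * nrm x ^+ 2 &
      forall x, E x = 0 -> x != 0 -> l * nrm x ^+ 2 < ip (T x) x].
Proof.
move=> pT; have hS := strong_gen_algebra T; have [[_ T0] T1] := pT.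
have [l0|l0] := ltP l 0.
  exists 0; split=> [||x|x _ xn0]; first exact: proj_0.
  - exact: alg0.
  - by rewrite opE => <-; rewrite op0 ip0l nrm0 expr0n mulr0.
  - by apply: lt_le_trans (T0 x); rewrite nmulr_rlt0 // exprn_gt0 // nrm_gt0.
have [l1|l1] := leP 1 l.
  exists 1; split=> [||x _|x]; first exact: proj_1.
  - exact: alg1.
  - by rewrite (le_trans (T1 x)) // ler_peMl // sqr_ge0.
  - by rewrite opE => ->; rewrite eqxx.
have [|E [sE EE gE h1 h2]] := @spectral_cut _ _ T l pT; first by rewrite l0 ltW.
by exists E.
Qed.

(** Monotonicity and the end values come from the two form bounds alone: a nonzero y violating them
    would lie in the range of one projection and in the kernel of another, or meet [0 <= T <= 1],
    with incompatible bounds on [<T y, y>]. *)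
Lemma spectral_family T : pcontr T -> exists F : R -> op H,
  [/\ forall l, [/\ projector (F l), F l * T = T * F l,
        forall x, F l x = x -> ip (T x) x <= l * nrm x ^+ 2 &
        forall x, F l x = 0 -> l * nrm x ^+ 2 <= ip (T x) x],
      forall a b, a <= b -> F a * F b = F a,
      forall a, scvg (fun n => F (a + n.+1%:R^-1)) (F a) &
      (forall l, l < 0 -> F l = 0) /\ (forall l, 1 <= l -> F l = 1)].
Proof.
move=> pT; have [F hF] := choice (fun l => @spectral_cut_all T l pT).
have [[_ T0] T1] := pT.
have pF l : projector (F l) by case: (hF l).
have gF l : strong_gen T (F l) by case: (hF l).
have hle l x : F l x = x -> ip (T x) x <= l * nrm x ^+ 2.
  by case: (hF l) => _ _ h _; exact: h.
have hlt l x : F l x = 0 -> x != 0 -> l * nrm x ^+ 2 < ip (T x) x.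
  by case: (hF l) => _ _ _ h; exact: h.
have FM a b : a <= b -> F a * F b = F a.
  move=> ab; apply: op_ext => x; apply/eqP; rewrite -subr_eq0; apply/negPn/negP => yn0.
  set y := _ - _ in yn0; have n0 : 0 < nrm y ^+ 2 by rewrite exprn_gt0 // nrm_gt0.
  have Fay : F a y = y by rewrite opB -!mulE mulrA (proj2 (pF a)).
  have Fby : F b y = 0.
    rewrite opB -!mulE (strong_gen_comm2 (gF a) (gF b)) mulrA (proj2 (pF b)).
    by rewrite subrr.
  have := hle _ _ Fay; have := hlt _ _ Fby yn0; nra.
exists F; split=> // [l|a|].
- split=> // [||x Fx]; [exact: strong_gen_comm2 (gF l) (GenT T)|exact: hle|].
  have [->|xn0] := eqVneq x 0; first by rewrite op0 ip0l nrm0 expr0n mulr0.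
  exact/ltW/hlt.
- pose G n := F (a + n.+1%:R^-1).
  have GG m n : (m <= n)%N -> G n * G m = G n.
    by move=> mn; apply: FM; rewrite lerD2l lef_pV2 ?posrE // ler_nat.
  have [|L hL _] := @scvg_dec _ _ G (fun n => proj_pcontr (pF _)).
    move=> n; apply: (proj1 (proj_pcontr _)).
    by apply: (@proj_sub (G n.+1) (G n) (pF _) (pF _)); exact: GG.
  suff -> : F a = L by [].
  have sL : sa L by apply: (scvg_sa _ hL) => n; case: (pF (a + n.+1%:R^-1)).
  have LG m : L * G m = L.
    apply: (@scvg_unique _ _ (fun n => G (n + m)%N * G m)).
      apply: scvgMr => x; have := hL x; rewrite -(cvg_shiftn m (fun k => G k x)); exact.
    rewrite (_ : (fun n => _) = (fun n => G (n + m)%N)); last first.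
      by apply/funext => n; rewrite GG // leq_addl.
    by move=> x; have := hL x; rewrite -(cvg_shiftn m (fun k => G k x)); exact.
  have FL : F a * L = F a.
    apply: (@scvg_unique _ _ (fun n => F a * G n)); first exact: scvgMl.
    rewrite (_ : (fun n => _) = (fun=> F a)); first exact: scvg_cst.
    by apply/funext => n; apply: FM; rewrite lerDl.
  have LF : L * F a = F a by rewrite -{1}sL -{1}(proj1 (pF a)) -starM FL (proj1 (pF a)).
  apply: op_ext => x; apply/eqP; rewrite eq_sym -subr_eq0; apply/negPn/negP => yn0.
  set y := _ - _ in yn0.
  have LL : L * L = L.
    apply: (@scvg_unique _ _ (fun n => L * G n)); first exact: scvgMl.
    rewrite (_ : (fun n => _) = (fun=> L)); first exact: scvg_cst.
    by apply/funext => n; exact: LG.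
  have Fy : F a y = 0 by rewrite opB -!mulE FL (proj2 (pF a)) subrr.
  have GL m : G m * L = L.
    by have := congr1 star (LG m); rewrite starM sL [star (G m)](proj1 (pF _)).
  have GF m : G m * F a = F a.
    by rewrite -{1}LF mulrA GL.
  have Gy m : G m y = y by rewrite opB -!mulE GL GF.
  (* y is fixed by every [G m], so its form is at most [(a + 1/(n+1)) |y|^2] for all n, while
     [F a y = 0] makes it exceed [a |y|^2]. *)
  have : ip (T y) y <= a * nrm y ^+ 2.
    have lim : (fun n => (a + n.+1%:R^-1) * nrm y ^+ 2) @ \oo --> (a + 0) * nrm y ^+ 2.
      by apply: cvgMl; apply: cvgD; [exact: cvg_cst|exact: cvg_harmonic].
    by rewrite -[a]addr0; apply: (cvg_to_ge lim) => n; exact: hle (Gy n).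
  by rewrite leNgt hlt.
- split=> l hl.
    apply: op_ext => x; apply/eqP/negPn/negP => yn0; set y := F l x in yn0.
    have Fy : F l y = y by rewrite /y -mulE (proj2 (pF l)).
    have := hle _ _ Fy; rewrite leNgt (lt_le_trans _ (T0 y)) //.
    by rewrite nmulr_rlt0 // exprn_gt0 // nrm_gt0.
  apply: op_ext => x; apply/eqP; rewrite eq_sym -subr_eq0; apply/negPn/negP => yn0.
  set y := _ - _ in yn0.
  have Fy : F l y = 0 by rewrite opB oneE -mulE (proj2 (pF l)) subrr.
  have := hlt _ _ Fy yn0; rewrite ltNge (le_trans (T1 y)) //.
  by rewrite ler_peMl // sqr_ge0.
Qed.

End SpectralFamily.

(** * Scalar measures of a resolution of the identity *)

Section SpectralMeasure.
Context {R : realType} {H : hilbertType R}.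
Implicit Types (A B T P E : op H) (x y z : H) (a b l : R).
Local Notation TR := (measurableTypeR R).
Implicit Types (U W : set TR).

Section Family.
Variables (T : op H) (F : R -> op H).
Hypothesis pF : forall l, projector (F l).
Hypothesis FM : forall a b, a <= b -> F a * F b = F a.
Hypothesis FT : forall l, F l * T = T * F l.
Hypothesis Fle : forall l x, F l x = x -> ip (T x) x <= l * nrm x ^+ 2.
Hypothesis Fge : forall l x, F l x = 0 -> l * nrm x ^+ 2 <= ip (T x) x.
Hypothesis Frc : forall a, scvg (fun n => F (a + n.+1%:R^-1)) (F a).
Hypothesis F0 : forall l, l < 0 -> F l = 0.
Hypothesis F1 : forall l, 1 <= l -> F l = 1.

Lemma family_sub a b : a <= b -> projector (F b - F a).
Proof. by move=> ab; apply: proj_sub => //; exact: FM. Qed.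

Lemma family_cumulative x : {homo (fun l => ip (F l x) x) : a b / a <= b} /\
  right_continuous (fun l => ip (F l x) x).
Proof.
have nd : {homo (fun l => ip (F l x) x) : a b / a <= b}.
  move=> a b ab; rewrite -subr_ge0 -ipBl -subE proj_form ?sqr_ge0 //.
  exact: family_sub.
split=> // a; apply/cvgrPdist_lt => e e0.
have /cvg_eventually/(_ e e0)[n hn] := scvg_form (x := x) (@Frc a).
have h := hn n (leqnn n); near=> b.
have ab : a <= b by near: b; exact: nbhs_right_ge.
have bn : b <= a + n.+1%:R^-1 by near: b; apply: nbhs_right_le; rewrite ltrDl.
have := nd _ _ ab; have := nd _ _ bn; move: h; rewrite ltr_norml => /andP[? ?] ? ?.
by rewrite ltr_norml; apply/andP; split; lra.
Unshelve. all: by end_near. Qed.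

Lemma family_measure x : exists2 mu : {finite_measure set TR -> \bar R},
  forall a b, a <= b -> mu `]a, b]%classic = (ip ((F b - F a) x) x)%:E &
  mu setT = (nrm x ^+ 2)%:E.
Proof.
have [nd rc] := family_cumulative x.
have [||mu muE muT] := @stieltjes_finite_measure R _ (nrm x ^+ 2) nd rc.
- by move=> t t0; rewrite F0 // zeroE ip0l.
- by move=> t t1; rewrite F1 // oneE ipxx.
by exists mu => // a b ab; rewrite muE // subE ipBl.
Qed.

Section Integral.
Variables (x : H) (mu : {finite_measure set TR -> \bar R}).
Hypothesis muE : forall a b, a <= b -> mu `]a, b]%classic = (ip ((F b - F a) x) x)%:E.
Hypothesis muT : mu setT = (nrm x ^+ 2)%:E.

Let mi (a b : R) : measurable (`]a, b]%classic : set TR).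
Proof. exact: measurable_itv. Qed.

(** The intervals are open on the left, so a negative left end is taken to include a possible atom
    at 0. *)
Let I1 : set TR := `](-1 : R), 1]%classic.

Lemma family_support : mu (~` I1) = 0%E.
Proof.
have mC := measurableC (mi (-1) 1).
have h : (mu setT = mu I1 + mu (~` I1))%E.
  by rewrite -(setUv I1); apply: measureU => //; [exact: mi|exact: setICr].
have N1 : -1 <= 1 :> R by lra.
move: h; rewrite muT /I1 muE // F1 // F0 ?ltrN10 // subr0 oneE ipxx.
have fin : mu (~` I1) \is a fin_num by exact: fin_num_measure.
by rewrite -(fineK fin) -EFinD => -[h]; congr (_%:E); lra.
Qed.

Lemma coord_integrable_itv a b : mu.-integrable `]a, b]%classic (fun t : TR => (t : R)%:E).
Proof.
apply: (@measurable_bounded_integrable _ _ _ mu (fun t : TR => (t : R))) => //.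
- by have := fin_num_measure mu _ (mi a b); rewrite ge0_fin_numE.
- exists (`|a| + `|b|); split; first by rewrite num_real.
  move=> M hM t /=; rewrite in_itv /= => /andP[at_ tb]; apply: le_trans (ltW hM).
  have := ler_norm b; have := ler_norm (- a); rewrite normrN => h1 h2.
  by rewrite ler_norml; apply/andP; split; have := normr_ge0 a; have := normr_ge0 b; lra.
Qed.

Lemma coord_integrable : mu.-integrable setT (fun t : TR => (t : R)%:E).
Proof.
have mC := measurableC (mi (-1) 1).
rewrite (negligible_integrable mC) //; last exact: family_support.
- by rewrite setTD setCK; exact: coord_integrable_itv.
- exact: measurable_fun_coord.
Qed.

(** Riemann sums by bisection. On one interval, the form and the integral both lie between a and b
    times the mass; halving the interval n times divides the error by [2^n], the masses of the
    halves adding up. *)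
Lemma family_integral_itv n a b : a <= b ->
  `|ip (T ((F b - F a) x)) x - \int[mu]_(t in `]a, b]%classic) (t : R)| <=
  (b - a) / 2 ^+ n * ip ((F b - F a) x) x.
Proof.
elim: n a b => [|n IHn] a b ab.
  have pE := family_sub ab; set E := F b - F a in pE *; pose y := E x.
  have ET : E * T = T * E by rewrite mulrBl mulrBr !FT.
  have TE : ip (T (E x)) x = ip (T y) y.
    by rewrite -{1}(proj2 pE) mulE -mulE -ET mulE (saP _ _ (proj1 pE)).
  have nE : ip (E x) x = nrm y ^+ 2 by rewrite proj_form.
  have h1 : ip (T y) y <= b * nrm y ^+ 2.
    apply: Fle; rewrite /y -mulE mulrBr (proj2 (pF b)).
    have Fab := FM ab; have -> : F b * F a = F a.
      by rewrite -{1}(proj1 (pF b)) -{1}(proj1 (pF a)) -starM Fab (proj1 (pF a)).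
    by [].
  have h2 : a * nrm y ^+ 2 <= ip (T y) y.
    by apply: Fge; rewrite /y -mulE mulrBr (proj2 (pF a)) FM // subrr.
  have [|] := andP (@Rintegral_bounds R mu `]a, b]%classic a b (mi a b) (coord_integrable_itv a b) _).
    by move=> t /=; rewrite in_itv /= => /andP[/ltW -> ->].
  rewrite muE // TE -/E nE expr0 divr1 /= => h3 h4.
  by rewrite ler_norml; apply/andP; split; lra.
pose c := (a + b) / 2.
have ac : a <= c by rewrite /c; lra.
have cb : c <= b by rewrite /c; lra.
have -> : \int[mu]_(t in `]a, b]%classic) (t : R) =
    \int[mu]_(t in `]a, c]%classic) (t : R) + \int[mu]_(t in `]c, b]%classic) (t : R).
  have e : (`]a, b]%classic : set TR) = `]a, c]%classic `|` `]c, b]%classic.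
    apply/seteqP; split=> t /=; rewrite !in_itv /=.
      move=> /andP[at_ tb]; case: (leP t c) => tc; [left|right]; exact/andP.
    by move=> [/andP[h1 h2]|/andP[h1 h2]]; apply/andP; split=> //; lra.
  rewrite e Rintegral_setU //.
  - by rewrite -e; exact: coord_integrable_itv.
  - rewrite disj_set2E; apply/eqP/seteqP; split=> // t /=; rewrite !in_itv /=.
    by move=> [/andP[_ tc] /andP[ct _]]; have := lt_le_trans ct tc; rewrite ltxx.
have E1 : F b - F a = (F c - F a) + (F b - F c) by rewrite [RHS]addrC addrA subrK.
have h1 := IHn _ _ ac; have h2 := IHn _ _ cb.
rewrite E1; move: (F c - F a) (F b - F c) h1 h2 => A B h1 h2.
rewrite addE opD !ipDl opprD addrACA (le_trans (ler_normD _ _)) //.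
apply: (le_trans (lerD h1 h2)).
have -> : c - a = (b - a) / 2 by rewrite /c; field.
have -> : b - c = (b - a) / 2 by rewrite /c; field.
by rewrite -mulrDr exprS invfM mulrA.
Qed.

Lemma family_integral : ip (T x) x = \int[mu]_(t in setT) (t : R).
Proof.
have N1 : -1 <= 1 :> R by lra.
rewrite (Rintegral_support (mi (-1) 1) family_support coord_integrable).
apply/eqP; rewrite -subr_eq0 -normr_eq0 eq_le normr_ge0 andbT.
have lim : (fun n => 2 * nrm x ^+ 2 * 2^-1 ^+ n) @ \oo --> 2 * nrm x ^+ 2 * (0 : R).
  by apply: cvgMr; apply: cvg_expr; rewrite ger0_norm; lra.
rewrite -(mulr0 (2 * nrm x ^+ 2)); apply: (cvg_to_ge lim) => n.
have := family_integral_itv n N1; rewrite F1 // F0 ?ltrN10 // subr0 oneE ipxx.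
by rewrite opprK exprVn mulrAC.
Qed.

End Integral.

End Family.

End SpectralMeasure.

(** * Spectral measures: existence, and value at the point 1 *)

Section SpectralTheorem.
Context {R : realType} {H : hilbertType R}.
Implicit Types (A B T P E : op H) (x y z : H) (a b l : R).
Local Notation TR := (measurableTypeR R).
Implicit Types (U W : set TR) (mu : {finite_measure set TR -> \bar R}).

Lemma measure_compl mu U : measurable U ->
  fine (mu setT) = fine (mu U) + fine (mu (~` U)).
Proof.
move=> mU; have mC := measurableC mU; rewrite -fineD; first last.
- exact: fin_num_measure.
- exact: fin_num_measure.
congr fine; rewrite -(setUv U); apply: measureU => //; exact: setICr.
Qed.

Lemma fine_measure0 mu U : measurable U -> fine (mu U) = 0 -> mu U = 0%E.
Proof.
by move=> mU h; have fin := fin_num_measure mu _ mU; rewrite -(fineK fin) h.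
Qed.

(** Dynkin induction from half-open intervals. Complements use [1 - E]. In a disjoint union the
    projections are mutually orthogonal, because any two of their forms add up to at most [|x|^2];
    the partial sums then increase to a projection. *)
Lemma proj_family_measurable (m : H -> {finite_measure set TR -> \bar R}) :
  (forall x, m x setT = (nrm x ^+ 2)%:E) ->
  (forall a b, a <= b -> exists2 E, projector E & forall x, m x `]a, b]%classic = (ip (E x) x)%:E) ->
  forall U, measurable U -> exists2 E, projector E & forall x, m x U = (ip (E x) x)%:E.
Proof.
move=> mT mI; pose Q U := exists2 E, projector E & forall x, m x U = (ip (E x) x)%:E.
apply: (@dynkin_induction _ TR (@ocitv R) Q).
- by [].
- exact: ocitvI.
- by exists 1; [exact: proj_1|move=> x; rewrite oneE ipxx].
- move=> _ [[a b] _ <-] /=; have [ab|ba] := leP a b; first exact: mI.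
  exists 0; first exact: proj_0.
  by move=> x; rewrite set_itv_ge ?measure0 ?opE ?ip0l // bnd_simp -leNgt ltW.
- move=> U mU [E pE mE]; exists (1 - E); first exact: proj1B.
  move=> x; have fin := fin_num_measure (m x) _ (measurableC mU).
  rewrite -(fineK fin); congr (_%:E).
  have := measure_compl (m x) mU; rewrite mT mE subE oneE ipBl ipxx /=; lra.
- move=> V mV tV /(_ _)/cid2-/all_sig[E /all_and2[pE mE]].
  have orth i j : i != j -> E i * E j = 0.
    move=> ij; apply: proj_orth => // x.
    rewrite -lee_fin EFinD -!mE -mT.
    rewrite (_ : (m x (V i) + m x (V j))%E = m x (V i `|` V j)); last first.
      apply/esym/measureU => //; by move/trivIsetP: tV; exact.
    by apply: le_measure; rewrite ?inE //; exact: measurableU.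
  pose G n := \sum_(i < n) E i.
  have GS n : G n.+1 = G n + E n by rewrite /G big_ord_recr.
  have GE n k : (n <= k)%N -> G n * E k = 0.
    elim: n => [|n IHn] nk; first by rewrite /G big_ord0 mul0r.
    by rewrite GS mulrDl IHn ?(ltnW nk) // orth ?addr0 // ltn_eqF.
  have pG n : projector (G n).
    elim: n => [|n IHn]; first by rewrite /G big_ord0; exact: proj_0.
    by rewrite GS; apply: projD => //; exact: GE.
  have [|||L hL _] := @scvg_inc _ _ G 1 ler01.
  - by rewrite /G big_ord0; exact: psd0.
  - by move=> n; rewrite GS addrC addKr; case: (proj_pcontr (pE n)).
  - by move=> n x; rewrite mul1r; case: (proj_pcontr (pG n)).
  exists L.
    split; first by apply: (scvg_sa _ hL) => n; case: (pG n).
    apply: (scvg_unique _ hL); have := @scvgM _ _ 1 _ _ _ _ _ hL hL.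
    rewrite (_ : (fun n => G n * G n) = G); last by apply/funext => n; case: (pG n).
    by apply=> n x; rewrite mul1r; exact/pcontr_nrm/proj_pcontr.
  have mUV : measurable (\bigcup_n V n) by exact: bigcupT_measurable.
  move=> x; have := @measure_semi_sigma_additive _ _ _ (m x) V mV tV mUV.
  have -> : (fun n => (\sum_(0 <= i < n) m x (V i))%E) = EFin \o (fun n => ip (G n x) x).
    apply/funext => n /=; elim: n => [|n IHn]; first by rewrite big_nil /G big_ord0 opE ip0l.
    by rewrite big_nat_recr //= IHn mE -EFinD -ipDl GS.
  move=> h; apply: (cvg_unique _ h) => //.
  by apply/cvg_EFin; [exact: nearW|exact: scvg_form].
Qed.

Lemma inner_sa A x : sa A -> inner (A x) x = (ip (A x) x)%:C.
Proof.
move=> sA; rewrite inner_ip; congr (_ +i* _).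
have e1 : ip (A x) ('i *: x) = ip ('i *: A x) x by rewrite (saP _ _ sA) opZc ipC.
have e2 : ip ('i *: A x) x = - ip (A x) ('i *: x).
  by rewrite -ip_ii scalerA -expr2 sqr_i scaleN1r ipNl.
by move: e1; rewrite e2; lra.
Qed.

Lemma orthogonal_projection_of E : projector E -> orthogonal_projection E.
Proof.
move=> [sE EE]; split.
  by split; [exact: bounded_op|rewrite adjointE sE].
by rewrite -[in RHS]EE.
Qed.

Lemma proj_of (f : H -> H) : orthogonal_projection f ->
  exists2 E : op H, E = f :> (H -> H) & projector E.
Proof.
move=> [[bf sf] ff]; have [E Ef] := op_of_bounded bf; exists E => //.
rewrite -Ef in sf ff; split; apply: op_ext => x; first by rewrite -adjointE sf.
by rewrite mulE -[in RHS]ff.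
Qed.

Theorem spectral_measure_exists T : pcontr T ->
  exists E : set TR -> H -> H, spectral_measure T E.
Proof.
move=> pT; have [F [hF FM Frc [F0 F1]]] := spectral_family pT.
have pF l : projector (F l) by case: (hF l).
have FT l : F l * T = T * F l by case: (hF l).
have Fle l x : F l x = x -> ip (T x) x <= l * nrm x ^+ 2.
  by case: (hF l) => _ _ h _; exact: h.
have Fge l x : F l x = 0 -> l * nrm x ^+ 2 <= ip (T x) x.
  by case: (hF l) => _ _ _ h; exact: h.
have /(_ _)/cid2-/all_sig[m /all_and2[mI mT]] := @family_measure _ _ F pF FM Frc F0 F1.
have mQ : forall U, measurable U -> exists2 E, projector E & forall x, m x U = (ip (E x) x)%:E.
  apply: (proj_family_measurable mT) => a b ab.
  by exists (F b - F a); [exact: family_sub|move=> x; exact: mI].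
have [E hE] : exists E : set TR -> op H, forall U, measurable U ->
    projector (E U) /\ forall x, m x U = (ip (E U x) x)%:E.
  have /choice[E hE] U : exists E, measurable U -> projector E /\ forall x, m x U = (ip (E x) x)%:E.
    have [mU|nU] := pselect (measurable U); last by exists 0.
    by have [E pE mE] := mQ _ mU; exists E.
  by exists E.
have pE U : measurable U -> projector (E U) by move=> /hE[].
have mE U x : measurable U -> m x U = (ip (E U x) x)%:E by move=> /hE[].
have Eadd U W : measurable U -> measurable W -> U `&` W = set0 ->
    E (U `|` W) = E U + E W /\ E U * E W = 0.
  move=> mU mW UW; have mUW := measurableU _ _ mU mW.
  have e x : ip (E (U `|` W) x) x = ip (E U x) x + ip (E W x) x.
    apply: EFin_inj; rewrite EFinD -!mE //; exact: measureU.
  split.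
    apply: sa_form_inj => [||x]; first by case: (pE _ mUW).
      by apply: saD; [case: (pE _ mU)|case: (pE _ mW)].
    by rewrite e addE ipDl.
  apply: proj_orth => [||x]; [exact: pE|exact: pE|].
  by rewrite -e; case: (proj_pcontr (pE _ mUW)).
exists (fun U => E U : H -> H); split.
- by move=> U mU; exact/orthogonal_projection_of/pE.
- rewrite (_ : E setT = 1) //; apply: sa_form_inj => [||x]; [by case: (pE _ measurableT)|exact: sa1|].
  by apply: EFin_inj; rewrite -mE // mT oneE ipxx.
(* Multiplicativity follows from additivity: the projections of the intersection and of the two
   differences are mutually orthogonal, so only the square of the first survives. *)
- move=> U W mU mW; suff -> : E (U `&` W) = E U * E W by [].
  have mI' := measurableI _ _ mU mW; have mD := measurableD mU mW; have mD' := measurableD mW mU.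
  have [e1 o1] : E U = E (U `&` W) + E (U `\` W) /\ E (U `&` W) * E (U `\` W) = 0.
    have := Eadd _ _ mI' mD; rewrite setUIDK; apply.
    by rewrite setDE setIACA setICr setI0.
  have [e2 o2] : E W = E (U `&` W) + E (W `\` U) /\ E (U `&` W) * E (W `\` U) = 0.
    have := Eadd _ _ mI' mD'; rewrite (_ : U `&` W `|` W `\` U = W); last first.
      by rewrite (setIC U) setUIDK.
    by apply; rewrite setDE (setIC W) setIACA setICr set0I.
  have o3 : E (U `\` W) * E (W `\` U) = 0.
    apply: (proj2 (Eadd _ _ mD mD' _)).
    by rewrite !setDE (setIC W) setIACA setICr set0I.
  have o4 := proj_mulC (pE _ mI') (pE _ mD) o1.
  by rewrite e1 e2 mulrDl !mulrDr o2 o3 o4 (proj2 (pE _ mI')) !addr0.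
- move=> x; exists (m x); split.
  + by move=> U mU; rewrite inner_sa ?mE //; case: (pE _ mU).
  + exact: (coord_integrable F0 F1 (mI x) (mT x)).
  + rewrite inner_sa; last by case: pT => -[].
    by rewrite (family_integral pF FM FT Fle Fge F0 F1 (mI x) (mT x)).
Qed.

(** Valid for an arbitrary spectral measure, since the definition of [spectral_projection] does not
    tell which one is chosen. *)
Lemma spectral_measure_one T P (E : set TR -> H -> H) : pcontr T -> projector P ->
  (forall x, P x = x <-> T x = x) -> spectral_measure T E -> E [set 1] = P.
Proof.
move=> pT pP PT [Eproj ET EI Emu].
have [_ T1] := pT.
have Tfix x : ip (T x) x = nrm x ^+ 2 -> T x = x.
  move=> h; apply/eqP; rewrite eq_sym -subr_eq0; apply/eqP.
  have := @psd_eq0 _ _ (1 - T) x (proj1 (pcontr1B pT)).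
  by rewrite subE oneE; apply; rewrite ipBl h ipxx subrr.
have m1 : measurable ([set 1] : set TR) by exact: (measurable_set1 (1 : R)).
have mU : measurable (`]1, +oo[%classic : set TR) by exact: measurable_itv.
have mD : measurable (`]-oo, 1]%classic : set TR) by exact: measurable_itv.
have cU : ~` (`]1, +oo[%classic : set TR) = `]-oo, 1]%classic by rewrite setCitvr.
have cD : ~` (`]-oo, 1]%classic : set TR) = `]1, +oo[%classic by rewrite setCitvl.
have mass x : exists mu, [/\ forall U, measurable U -> ip (E U x) x = fine (mu U),
    fine (mu setT) = nrm x ^+ 2,
    mu.-integrable setT (fun t : TR => (t : R)%:E) &
    ip (T x) x = \int[mu]_(t in setT) (t : R)].
  have [mu [h1 h2 h3]] := Emu x; exists mu; split=> //.
  - by move=> U mUU; rewrite /ip h1.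
  - by rewrite -ipxx -[x in ip x]/(idfun x) -ET /ip h1.
  - by rewrite /ip h3.
have [Q QE pQ] := proj_of (Eproj _ m1).
have [B BE pB] := proj_of (Eproj _ mU).
have compl0 mu U c : measurable U -> fine (mu setT) = c -> fine (mu U) = c -> mu (~` U) = 0%E.
  move=> mUU h1 h2; apply: fine_measure0; first exact: measurableC.
  by have := measure_compl mu mUU; rewrite h1 h2; lra.
(* For y in the range of [E ]1, +oo[] the mean is at least the mass, and at most the mass as
   [T <= 1]. So the measure of y sits at 1 as well as beyond 1, and is zero. *)
have B0 : B = 0.
  apply: op_ext => x; set y := B x; have By : B y = y by rewrite /y -mulE (proj2 pB).
  have [mu [hm hT hi hTy]] := mass y.
  have hU : fine (mu `]1, +oo[%classic) = nrm y ^+ 2 by rewrite -hm // -BE By ipxx.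
  have null := compl0 _ _ _ mU hT hU.
  have null1 : mu (~` [set 1]) = 0%E.
    apply: (mean_one_null mU hi null); last by left=> t /=; rewrite in_itv /= andbT => /ltW.
    rewrite hT -hTy; apply/eqP; rewrite eq_le T1 /= hTy (Rintegral_support mU null hi) -hU.
    rewrite -[leLHS]mul1r -Rintegral_cst //; apply: le_Rintegral => //.
    + exact: finite_measure_integrable_cst.
    + exact: integrableS hi.
    + by move=> t /=; rewrite in_itv /= andbT => /ltW.
  have null2 : mu [set 1] = 0%E.
    apply/eqP; rewrite -measure_le0 -null; apply: le_measure; rewrite ?inE //.
      exact: measurableC.
    by move=> t ->; rewrite cU /= in_itv /=.
  have := measure_compl mu m1; rewrite hT null1 null2 /= addr0 => /eqP.
  by rewrite sqrf_eq0 => /eqP/nrm0_eq0.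
have QT x : Q x = x -> T x = x.
  move=> Qx; apply: Tfix; have [mu [hm hT hi ->]] := mass x.
  have h1 : fine (mu [set 1]) = nrm x ^+ 2 by rewrite -hm // -QE Qx ipxx.
  rewrite (Rintegral_support m1 (compl0 _ _ _ m1 hT h1) hi) -h1 -[RHS]mul1r.
  apply/eqP; rewrite eq_le andbC; apply: Rintegral_bounds => //.
  - exact: integrableS hi.
  - by move=> t /= ->; rewrite lexx.
(* The measure of x lives on []-oo, 1]] and has mean equal to its mass, hence is concentrated at
   1. *)
have TQ x : T x = x -> Q x = x.
  move=> Tx; have [mu [hm hT hi hTx]] := mass x.
  have null : mu (~` `]-oo, 1]%classic) = 0%E.
    by rewrite cD; apply: fine_measure0 => //; rewrite -hm // -BE B0 zeroE ip0l.
  have null1 : mu (~` [set 1]) = 0%E.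
    apply: (mean_one_null mD hi null); last by right=> t /=; rewrite in_itv.
    by rewrite -hTx Tx ipxx hT.
  apply/eqP; rewrite eq_sym -subr_eq0; apply/eqP.
  have := @psd_eq0 _ _ (1 - Q) x (proj1 (pcontr1B (proj_pcontr pQ))).
  rewrite subE oneE; apply; rewrite ipBl ipxx -hT (measure_compl mu m1) null1 QE hm //=.
  by rewrite addr0 subrr.
rewrite -QE; suff -> : Q = P by [].
have QP : Q * P = P.
  by apply: op_ext => x; apply: TQ; apply/PT; rewrite -mulE (proj2 pP).
have PQ : P * Q = Q.
  by apply: op_ext => x; apply/PT/QT; rewrite -mulE (proj2 pQ).
by rewrite -PQ -{1}(proj1 pP) -(proj1 pQ) -starM QP (proj1 pP).
Qed.

(** Existence of a spectral measure excludes the default value of [xget]. *)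
Lemma spectral_projection_one T P : pcontr T -> projector P ->
  (forall x, P x = x <-> T x = x) -> spectral_projection T [set 1] = P.
Proof.
move=> pT pP PT; rewrite /spectral_projection; case: xgetP => [E _ hE|h].
  exact: (spectral_measure_one pT pP PT hE).
by have [E hE] := spectral_measure_exists pT; case: (h E).
Qed.

End SpectralTheorem.

(** * Finite algebras *)

Section FiniteAlgebra.
Context {R : realType} {H : hilbertType R}.
Implicit Types (A B T P K D S : op H) (x y z : H) (a b l : R) (M : set (op H)).

Lemma nrm_star B (C : R) : 0 <= C -> (forall x, nrm (B x) <= C * nrm x) ->
  forall x, nrm (star B x) <= C * nrm x.
Proof.
move=> C0 hB x; have [->|n0] := eqVneq (nrm (star B x)) 0.
  by rewrite mulr_ge0 ?nrm_ge0.
have np : 0 < nrm (star B x) by rewrite lt_def n0 nrm_ge0.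
rewrite -(ler_pM2r np) -expr2 -ipxx -starP (le_trans (ler_norm _)) //.
by rewrite (le_trans (ip_le _ _)) // mulrAC ler_wpM2r ?nrm_ge0 // mulrC.
Qed.

Lemma inverse_psd T J : sa T -> (forall x, nrm x ^+ 2 <= ip (T x) x) ->
  sa J -> T * J = 1 -> pcontr J.
Proof.
move=> sT hT sJ TJ; have e x : ip (J x) x = ip (T (J x)) (J x).
  by rewrite -[T (J x)]mulE TJ oneE ipC.
have h x : nrm (J x) ^+ 2 <= ip (J x) x by rewrite e.
split; first by split=> // x; rewrite (le_trans _ (h x)) ?sqr_ge0.
move=> x; have := le_trans (ler_norm _) (ip_le (J x) x).
have := h x; have := nrm_ge0 x; have := nrm_ge0 (J x); nra.
Qed.

(** With [p = <x, I x>] and [q = <x, J x>], Cauchy-Schwarz for the form of A gives [q^2 = <A (I x),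
    J x>^2 <= p <A (J x), J x> <= p <B (J x), J x> = p q]. *)
Lemma inverse_antitone A B I J : sa A -> psd (B - A) ->
  (forall x, nrm x ^+ 2 <= ip (A x) x) -> sa I -> sa J -> A * I = 1 -> B * J = 1 ->
  psd (I - J).
Proof.
move=> sA [_ AB] hA sI sJ AI BJ; split=> [|x]; first exact: saB.
have pA : psd A by split=> // y; rewrite (le_trans _ (hA y)) ?sqr_ge0.
have := form_cs (I x) (J x) pA; rewrite -[A (I x)]mulE AI oneE.
have := AB (J x); rewrite subE ipBl -[B (J x)]mulE BJ oneE.
have := hA (I x); rewrite -[A (I x)]mulE AI oneE.
have := hA (J x); have := sqr_ge0 (nrm (J x)); have := sqr_ge0 (nrm (I x)).
rewrite subE ipBl (ipC (J x) x) (ipC (I x) x).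
set p := ip x (I x); set q := ip x (J x); set r := ip (A (J x)) (J x).
move=> hI hJ h1 h2 h3 h4; rewrite subr_ge0.
have [q0|q0] := leP q 0; first by lra.
have p0 : 0 <= p by exact: le_trans h2.
have : q ^+ 2 <= p * q by apply: (le_trans h4); apply: ler_wpM2l => //; lra.
by rewrite expr2 ler_pM2r.
Qed.

Lemma op_sum_app (n : nat) (G : nat -> op H) x :
  (\sum_(i < n) G i) x = \sum_(i < n) G i x.
Proof.
by elim: n => [|n IHn]; rewrite ?big_ord0 // !big_ord_recr /= IHn.
Qed.

Lemma psd_sum (n : nat) (G : nat -> op H) : (forall i, psd (G i)) -> psd (\sum_(i < n) G i).
Proof.
move=> h; elim: n => [|n IHn]; first by rewrite big_ord0; exact: psd0.
by rewrite big_ord_recr; exact: psdD.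
Qed.

(* D = lim_n (1 + \sum_(j < n) t_j a_j)^{-1} *)
Lemma damping M (t : nat -> R) (a : nat -> op H) (xi : H) (e : R) :
  strong_algebra M -> (forall j, M (a j)) -> (forall j, psd (a j)) -> (forall j, 0 <= t j) ->
  (forall n, \sum_(j < n) t j * ip (a j xi) xi <= e * nrm xi ^+ 2) ->
  exists D, [/\ M D, pcontr D, forall j x, t j * ip (a j (D x)) (D x) <= nrm x ^+ 2 &
    nrm (D xi - xi) ^+ 2 <= e * nrm xi ^+ 2].
Proof.
move=> hM Ma pa t0 hxi.
pose B n := \sum_(j < n) t j *: a j; pose L n := 1 + B n.
have pB n : psd (B n) by apply: (@psd_sum n (fun i => t i *: a i)) => i; exact: psdZ.
have BS n : B n.+1 = B n + t n *: a n by rewrite /B big_ord_recr.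
have MB n : M (B n) by apply: (@alg_sum _ _ M hM n (fun i => t i *: a i)) => i; exact: (algZ hM).
have ML n : M (L n) by apply: (algD hM) => //; exact: alg1.
have sL n : sa (L n) by apply: (saD sa1); case: (pB n).
have LE n x : ip (L n x) x = nrm x ^+ 2 + ip (B n x) x by rewrite addE oneE ipDl ipxx.
have L1 n x : nrm x ^+ 2 <= ip (L n x) x by rewrite LE lerDl; case: (pB n).
have /choice[J hJ] n : exists J, [/\ sa J, M J, L n * J = 1 & J * L n = 1].
  have [C C0 hC] := opbd (L n).
  have [||J [sJ gJ LJ JL]] := @op_inverse _ _ (L n) 1 (C + 1) (sL n) ltr01.
  - by rewrite lerDr ltW.
  - move=> x; rewrite mul1r L1 /= (le_trans (ler_norm _)) // (le_trans (ip_le _ _)) //.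
    rewrite expr2 mulrA ler_wpM2r ?nrm_ge0 // (le_trans (hC x)) //.
    by rewrite ler_wpM2r ?nrm_ge0 // lerDl.
  by exists J; split=> //; exact: strong_gen_min gJ.
have sJ n : sa (J n) by case: (hJ n).
have MJ n : M (J n) by case: (hJ n).
have LJ n : L n * J n = 1 by case: (hJ n).
have pJ n : pcontr (J n) by exact: inverse_psd (sL n) (L1 n) (sJ n) (LJ n).
have [|D hD _] := scvg_dec pJ.
  move=> n; apply: (@inverse_antitone (L n) (L n.+1)) => //.
  by rewrite /L BS (_ : _ - _ = t n *: a n); [exact: psdZ|opring].
have pD := scvg_pcontr pJ hD.
have LJx n x : L n (J n x) = x by rewrite -mulE LJ.
exists D; split=> //; first exact: (alg_lim hM MJ hD).
- move=> j x.
  have hDj y : (fun n => J (n + j.+1)%N y) @ \oo --> D y.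
    by rewrite (cvg_shiftn j.+1 (fun k => J k y)); exact: hD.
  have l1 : (fun n => t j * ip (a j (J (n + j.+1)%N x)) (J (n + j.+1)%N x)) @ \oo -->
      t j * ip (a j (D x)) (D x).
    by apply: cvgMr; apply: cvg_ip => //; exact: op_cvg.
  apply: (cvg_to_le l1) => n; set m := (n + j.+1)%N; set y := J m x.
  (* One summand is bounded by the whole, and [<B m y, y> <= <L m y, y> = <J m x, x> <= |x|^2]. *)
  apply: (@le_trans _ _ (ip (B m y) y)).
    have jm : (j < m)%N by rewrite /m addnS ltnS leq_addl.
    rewrite /B (op_sum_app m (fun i => t i *: a i)) (bigD1 (Ordinal jm)) //= ipDl ipZl lerDl.
    have -> : \sum_(i < m | i != Ordinal jm) (t i)%:C *: a i y =
        \sum_(i < m) (if i != Ordinal jm then (t i *: a i) y else 0).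
      by rewrite big_mkcond.
    elim/big_ind: _ => [|u v hu hv|i _]; first by rewrite ip0l.
      by rewrite ipDl addr_ge0.
    by case: ifP => _; rewrite ?ip0l // scaleE ipZl mulr_ge0 //; case: (pa i).
  have [_ hy] := pJ m; apply: le_trans (hy x).
  have -> : ip (J m x) x = ip (L m y) y by rewrite /y LJx ipC.
  by rewrite LE lerDr sqr_ge0.
(* Cauchy-Schwarz for [L n] between [J n xi] and [xi] gives [N <= p (1 + e)]; with [q <= p <= N]
   this yields [q - 2 p + N <= N - p <= e N]. *)
- have hJxi n : nrm (J n xi - xi) ^+ 2 <= e * nrm xi ^+ 2.
    have := form_cs (J n xi) xi (conj (sL n) (fun x => le_trans (sqr_ge0 _) (L1 n x))).
    rewrite LJx ipxx LE.
    have : ip (B n xi) xi <= e * nrm xi ^+ 2.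
      apply: le_trans (hxi n); rewrite /B (op_sum_app n (fun i => t i *: a i)).
      rewrite (big_morph (fun u => ip u xi) (fun u v => ipDl u v xi) (ip0l xi)).
      by rewrite le_eqVlt; apply/orP; left; apply/eqP/eq_bigr => i _; rewrite scaleE ipZl.
    have := pcontr_nrm2 xi (pJ n); have [[_ /(_ xi) + ] /(_ xi)] := pJ n; have := proj2 (pB n) xi.
    rewrite -[in X in _ -> _ -> _ -> _ -> _ -> _ -> X]ipxx ipBl !ipBr !ipxx (ipC xi (J n xi)).
    set p := ip (J n xi) xi; set N := nrm xi ^+ 2; set q := nrm (J n xi) ^+ 2.
    set s := ip (B n xi) xi => s0 p0 pN qp sN h.
    have N0 : 0 <= N by exact: sqr_ge0.
    have [N00|Nn0] := eqVneq N 0.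
      have : p <= 0 by rewrite -N00.
      by rewrite N00 mulr0; lra.
    have Np : 0 < N by rewrite lt_def Nn0.
    have h2 : N * N <= (p * (1 + e)) * N.
      rewrite -expr2 (le_trans h) // -mulrA ler_wpM2l //; lra.
    have h3 : N <= p * (1 + e) by rewrite -(ler_pM2r Np).
    have e0 : 0 <= e by nra.
    have : p * e <= N * e by rewrite ler_wpM2r.
    by lra.
  have lim : (fun n => nrm (J n xi - xi) ^+ 2) @ \oo --> nrm (D xi - xi) ^+ 2.
    under eq_fun do rewrite expr2; rewrite expr2.
    by apply: cvgM; apply: cvg_nrm; apply: cvgB; [exact: hD|exact: cvg_cst|exact: hD|exact: cvg_cst].
  exact: (cvg_to_le lim).
Qed.

(* f inverts K on the range of the spectral projection of K for ]d, 1]. *)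
Lemma generalized_inverse K : pcontr K -> K != 0 -> exists f,
  [/\ strong_gen K f, psd f, f * K * f = f & exists y, 0 < ip (f y) y].
Proof.
move=> pK K0; have hS := strong_gen_algebra K; have [[sK K_ge0] K_le1] := pK.
have [x0 hx0] : exists x, 0 < ip (K x) x.
  apply: contrapT => h; move/eqP: K0; apply; apply: op_ext => x.
  apply: psd_eq0; first by case: pK.
  by apply/eqP; rewrite eq_le K_ge0 andbT leNgt; apply/negP => hx; apply: h; exists x.
have n0 : 0 < nrm x0 ^+ 2 by exact: lt_le_trans (K_le1 x0).
(* Half the Rayleigh quotient of [x0]: this vector exceeds the bound valid on the range of F, so the
   cut [e] is not zero. *)
pose d := ip (K x0) x0 / (2 * nrm x0 ^+ 2).
have dE : d * nrm x0 ^+ 2 = ip (K x0) x0 / 2.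
  rewrite /d; field; rewrite gt_eqF // nrm_gt0 //.
  by apply: contraTneq n0 => ->; rewrite nrm0 expr0n ltxx.
have d0 : 0 < d by rewrite divr_gt0 // mulr_gt0.
have d1 : d <= 1.
  by rewrite -(ler_pM2r n0) dE mul1r; have := K_le1 x0; lra.
have [|F [sF FF gF hF1 hF2]] := @spectral_cut _ _ K d pK; first by rewrite ltW.
pose e := 1 - F; have pF : projector F by [].
have pe : projector e by exact: proj1B.
have ge : strong_gen K e by apply: (algB hS) => //; exact: alg1.
have Fe x : F (e x) = 0 by rewrite -mulE mulrBr mulr1 FF subrr.
have FxE x : nrm x ^+ 2 = nrm (e x) ^+ 2 + nrm (F x) ^+ 2.
  by rewrite -(proj_form x pe) -(proj_form x pF) subE oneE ipBl ipxx subrK.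
(* Adding F makes the part of K above d invertible on all of H; the witness is [e] times the inverse
   of L. *)
pose L := e * K * e + F.
have gL : strong_gen K L by apply: (algD hS) => //; do 2!apply: (algM hS) => //; exact: GenT.
have LE x : ip (L x) x = ip (K (e x)) (e x) + nrm (F x) ^+ 2.
  by rewrite addE ipDl (proj_form x pF) !mulE (saP _ _ (proj1 pe)).
have sL : sa L.
  by apply: saD => //; have := sa_conj e sK; rewrite (proj1 pe).
have hKe x : d * nrm (e x) ^+ 2 <= ip (K (e x)) (e x).
  have [->|en0] := eqVneq (e x) 0; first by rewrite op0 ip0l nrm0 expr0n mulr0.
  exact/ltW/hF2.
have [|J [sJ gJ LJ JL]] := op_inverse sL d0 d1.
  move=> x; rewrite LE FxE mul1r; have := hKe x; have := K_le1 (e x).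
  have := sqr_ge0 (nrm (F x)) => h1 h2 h3; apply/andP; split; last by lra.
  by rewrite mulrDr lerD // ler_piMl.
have {}gJ : strong_gen K J by exact: strong_gen_min gJ.
have eK : e * K = K * e := strong_gen_comm2 ge (GenT K).
have eJ : e * J = J * e := strong_gen_comm2 ge gJ.
have eL : e * L = K * e.
  have eF : e * F = 0 by rewrite mulrBl mul1r FF subrr.
  by rewrite mulrDr !mulrA (proj2 pe) eF addr0 eK -mulrA (proj2 pe).
have fKf : (e * J) * K * (e * J) = e * J.
  by rewrite -(mulrA (e * J)) (mulrA K) -eL -(mulrA e L) LJ mulr1 -mulrA -eJ mulrA (proj2 pe).
have sf : sa (e * J) by rewrite /sa starM sJ (proj1 pe) eJ.
have pf : psd (e * J).
  have := psd_conj (e * J) (proj1 pK); rewrite sf fKf; exact.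
exists (e * J); split=> //; first exact: (algM hS).
apply: contrapT => h; have : e * J = 0.
  apply: op_ext => x; apply: psd_eq0 => //.
  by apply/eqP; rewrite eq_le (proj2 pf) andbT leNgt; apply/negP => hx; apply: h; exists x.
move=> /(congr1 (fun X => X * L)); rewrite -mulrA JL mulr1 mul0r => e0.
have Fx0 : F x0 = x0.
  by apply/eqP; rewrite eq_sym -subr_eq0 -[x0 in x0 - _]oneE -subE -/e e0.
by have := hF1 _ Fx0; rewrite dE; lra.
Qed.

Lemma skew_nrm (c : op H) x : star c = - c -> nrm x <= nrm ((1 - c) x) /\
  nrm ((1 - c) x) ^+ 2 = nrm x ^+ 2 + nrm (c x) ^+ 2.
Proof.
move=> hc; have h0 : ip (c x) x = 0.
  by have := starP c x x; rewrite hc oppE ipNr (ipC x); lra.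
have e : nrm ((1 - c) x) ^+ 2 = nrm x ^+ 2 + nrm (c x) ^+ 2.
  by rewrite -!ipxx subE oneE !ipE (ipC x) h0; lra.
by split=> //; apply: nrm_le; rewrite e lerDl sqr_ge0.
Qed.

(** The unitary is [(1 + c) (1 - c)^-1], written [(1 + c)^2 Q^-1] because [Q = 1 - c^2] is
    self-adjoint with form [|x|^2 + |c x|^2], so that [op_inverse] applies. *)
Lemma cayley M (c : op H) : strong_algebra M -> M c -> star c = - c ->
  exists u, [/\ M u, star u * u = 1, u * star u = 1 & (1 - c) * u = 1 + c].
Proof.
move=> hM Mc hc; pose Q := 1 - c * c.
have QE x : ip (Q x) x = nrm x ^+ 2 + nrm (c x) ^+ 2.
  rewrite subE oneE mulE ipBl ipxx starP hc oppE ipNr ipxx; lra.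
have sQ : sa Q by rewrite /sa starB starM hc mulrNN star1.
have [C C0 hC] := opbd c.
have [||J [sJ gJ QJ JQ]] := @op_inverse _ _ Q 1 (1 + C ^+ 2) sQ ltr01.
- by rewrite lerDl sqr_ge0.
- move=> x; rewrite QE mul1r mulrDl mul1r lerDl sqr_ge0 lerD2l -exprMn /=.
  by rewrite ler_pXn2r ?nnegrE ?mulr_ge0 ?nrm_ge0 // ltW.
have MQ : M Q by apply: (algB hM); [exact: alg1|exact: (algM hM)].
have MJ : M J by exact: strong_gen_min gJ.
have cQ : Q * c = c * Q by rewrite mulrBr mulrBl mulr1 mul1r mulrA.
have cJ : J * c = c * J by exact: strong_gen_comm gJ cQ.
have pmQ : (1 - c) * (1 + c) = Q by opring.
have mpQ : (1 + c) * (1 - c) = Q by opring.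
have Jp : J * (1 + c) = (1 + c) * J by rewrite mulrDr mulrDl mulr1 mul1r cJ.
have Jm : J * (1 - c) = (1 - c) * J by rewrite mulrBr mulrBl mulr1 mul1r cJ.
have Mp : M (1 + c) by apply: (algD hM) => //; exact: alg1.
have su : star ((1 + c) * (1 + c) * J) = J * ((1 - c) * (1 - c)).
  by rewrite !starM sJ starD star1 hc.
have QQ : Q * Q * J * J = 1 by rewrite -(mulrA Q Q) QJ mulr1.
have mm : (1 - c) * (1 - c) * (1 + c) * (1 + c) = Q * Q.
  by rewrite -(mulrA (1 - c)) pmQ -[in LHS]mpQ !mulrA pmQ -mulrA pmQ.
have pp : (1 + c) * (1 + c) * (1 - c) * (1 - c) = Q * Q.
  by rewrite -(mulrA (1 + c)) mpQ -[in LHS]pmQ !mulrA mpQ -mulrA mpQ.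
have Jmm : J * ((1 - c) * (1 - c)) = (1 - c) * (1 - c) * J.
  by rewrite mulrA Jm -!mulrA Jm.
exists ((1 + c) * (1 + c) * J); split.
- by do 2!apply: (algM hM) => //.
- rewrite su Jmm.
  have -> : (1 - c) * (1 - c) * J * ((1 + c) * (1 + c) * J) =
     (1 - c) * (1 - c) * (1 + c) * (1 + c) * J * J.
    by rewrite -!mulrA (mulrA J) Jp -(mulrA _ J) (mulrA J) Jp !mulrA.
  by rewrite mm.
- by rewrite su -mulrA Jmm (mulrA J) Jmm !mulrA pp.
- by rewrite !mulrA pmQ -mulrA -Jp mulrA QJ mul1r.
Qed.

End FiniteAlgebra.

(** * Geometric rates and fast subsequences *)

Section FastSequences.
Context {R : realType} {H : hilbertType R}.
Implicit Types (A B T P K D : op H) (x y z : H) (e C : R) (M : set (op H)).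

Definition quarter (j : nat) : R := 4^-1 ^+ j.

Lemma quarterS j : quarter j.+1 = quarter j / 4.
Proof. by rewrite /quarter exprSr. Qed.

Lemma quarter_gt0 j : 0 < quarter j.
Proof. by rewrite exprn_gt0. Qed.

Lemma quarter_le m n : (m <= n)%N -> quarter n <= quarter m.
Proof.
move=> mn; rewrite -(subnKC mn) /quarter exprD ler_piMr ?exprn_ge0 //.
by rewrite exprn_ile1 //; lra.
Qed.

Lemma quarter_small e : 0 < e -> exists J, forall n, (J <= n)%N -> quarter n < e.
Proof.
have le_h n : quarter n <= n.+1%:R^-1.
  elim: n => [|n IHn]; first by rewrite /quarter expr0 invr1.
  have h1 : (0 : R) < n.+1%:R by rewrite ltr0n.
  have h2 : (0 : R) < n.+2%:R by rewrite ltr0n.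
  rewrite quarterS (le_trans (_ : _ <= n.+1%:R^-1 / 4)) ?ler_wpM2r //.
  rewrite -invfM lef_pV2 ?posrE ?mulr_gt0 // -natrM ler_nat.
  by rewrite mulnC (leq_trans (_ : _ <= 2 * n.+1)%N) ?leq_pmul2r // mul2n -addnn addSn ltnS leq_addl.
by move=> /harmonic_lt[J hJ]; exists J => n /hJ; exact: le_lt_trans.
Qed.

Lemma quarter_cauchy (u : nat -> H) C n0 : 0 <= C ->
  (forall n, (n0 <= n)%N -> nrm (u n.+1 - u n) <= C * quarter n) ->
  exists l : H, u @ \oo --> l.
Proof.
(* Telescoped tail: a step costs [C q] while [quarter] drops by [3 q / 4], so the factor [2 C]
   suffices. *)
move=> C0 hu; have h m k : (n0 <= m)%N ->
    nrm (u (m + k)%N - u m) <= 2 * C * (quarter m - quarter (m + k)).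
  move=> m0; elim: k => [|k IHk]; first by rewrite addn0 !subrr nrm0 mulr0.
  have := nrm_tri (u (m + k)%N) (u (m + k).+1) (u m).
  have := hu (m + k)%N (leq_trans m0 (leq_addr _ _)).
  have := mulr_ge0 C0 (ltW (quarter_gt0 (m + k))).
  by rewrite addnS quarterS; nra.
apply: cauchy_vec => e e0; have C1 : 0 < 2 * C + 1 by lra.
have [J hJ] := quarter_small (divr_gt0 e0 C1); exists (maxn n0 J) => m n.
rewrite geq_max => /andP[m0 mJ] mn; rewrite -(subnKC mn).
apply: le_lt_trans (h _ _ m0) _; have := hJ _ mJ; rewrite ltr_pdivlMr //.
have := quarter_gt0 m; have := quarter_gt0 (m + (n - m)).
set q := quarter _; set p := quarter _; nra.
Qed.

Lemma dense_sequence : separable_space H ->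
  exists d : nat -> H, forall x e, 0 < e -> exists i, nrm (x - d i) < e.
Proof.
move=> [D /countable_injP[f injf] dD].
exists (fun i => xget 0 [set x | D x /\ f x = i]) => x e e0.
have [|y [By Dy]] := dD (ball x e%:C) _ (ball_open x _).
- by exists x; apply: ballxx; rewrite ltcR.
exists (f y); case: xgetP => [z _ [Dz fz]|/(_ y)]; last by case.
have -> : z = y by apply: injf; rewrite ?inE.
by move: By; rewrite -ball_normE /ball_ /= nrmE ltcR.
Qed.

Lemma cvg_on_dense (d : nat -> H) (F : nat -> op H) :
  (forall x e, 0 < e -> exists i, nrm (x - d i) < e) ->
  (forall n x, nrm (F n x) <= nrm x) ->
  (forall i, exists l : H, (fun n => F n (d i)) @ \oo --> l) ->
  exists A, scvg F A.
Proof.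
move=> dd F1 hd; apply: (@scvg_lim _ _ F 1) => [n x|x]; first by rewrite mul1r.
apply: cauchy_vec => e e0; have e3 : 0 < e / 3 by rewrite divr_gt0.
have [i hi] := dd x _ e3; have [l hl] := hd i.
have e6 : 0 < e / 6 by rewrite divr_gt0.
have /cvg_vec/(_ _ e6)[n0 hn] := hl; exists n0 => m n m0 mn.
have := hn _ m0; have := hn _ (leq_trans m0 mn).
have := nrm_tri (F n (d i)) (F n x) (F m x); rewrite -opB.
have := nrm_tri (F m (d i)) (F n (d i)) (F m x); rewrite -(opB (F m)).
have := nrm_tri l (F n (d i)) (F m (d i)); rewrite (nrmBC l).
have := F1 n (x - d i); have := F1 m (d i - x); rewrite (nrmBC (d i)); lra.
Qed.

Lemma eventually_all (Q : nat -> nat -> Prop) :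
  (forall i, exists n0, forall n, (n0 <= n)%N -> Q i n) ->
  forall j, exists n0, forall n, (n0 <= n)%N -> forall i, (i <= j)%N -> Q i n.
Proof.
move=> h; elim=> [|j [n1 h1]].
  by have [n0 hn] := h 0%N; exists n0 => n /hn ? i; rewrite leqn0 => /eqP ->.
have [n2 h2] := h j.+1; exists (maxn n1 n2) => n; rewrite geq_max => /andP[l1 l2] i.
by rewrite leq_eqVlt => /predU1P[->|]; [exact: h2|rewrite ltnS; exact: h1].
Qed.

Lemma fast_subsequence (S : nat -> op H) A (xi : H) (d : nat -> H) (eps : nat -> R) :
  (forall x, (fun n => star (S n) x) @ \oo --> (0 : H)) ->
  scvg (fun n => star (S n) * S n) A -> (forall j, 0 < eps j) ->
  exists N : nat -> nat, [/\ forall j, (j <= N j)%N,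
    forall j, nrm ((star (S (N j)) * S (N j) - A) xi) <= eps j,
    forall j, nrm (star (S (N j.+1)) (S (N j) xi)) <= eps j.+1 &
    forall i j, (i <= j)%N -> nrm (star (S (N j)) (d i)) <= eps j].
Proof.
move=> S0 SA e0.
have S0e j x : exists n0, forall n, (n0 <= n)%N -> nrm (star (S n) x) <= eps j.
  have /cvg_vec/(_ _ (e0 j))[n0 hn] := S0 x.
  by exists n0 => n /hn/ltW; rewrite subr0.
(* A step depends on the past only through the previous index m, so one choice function on pairs
   yields the whole subsequence. *)
have /choice[g hg] (jm : nat * nat) : exists n, [/\ (jm.1 <= n)%N,
    nrm ((star (S n) * S n - A) xi) <= eps jm.1,
    nrm (star (S n) (S jm.2 xi)) <= eps jm.1 &
    forall i, (i <= jm.1)%N -> nrm (star (S n) (d i)) <= eps jm.1].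
  case: jm => j m; rewrite -[(j, m).1]/j -[(j, m).2]/m; have /cvg_vec/(_ _ (e0 j))[n1 h1] := SA xi.
  have [n2 h2] := S0e j (S m xi).
  have [n3 h3] := eventually_all (fun i => S0e j (d i)) j.
  exists (maxn (maxn j n1) (maxn n2 n3)); split.
  - by rewrite -maxnA leq_maxl.
  - by rewrite subE; apply/ltW/h1; rewrite -maxnA maxnCA leq_maxl.
  - by apply: h2; rewrite maxnCA leq_maxl.
  - by apply: h3; rewrite !maxnA leq_maxr.
(* At the start there is no previous index, and 0 takes its place. *)
pose N := fix N j := if j is k.+1 then g (k.+1, N k) else g (0%N, 0%N).
exists N; split=> [[|j]|[|j]|j|i [|j] ij] /=.
- by [].
- by case: (hg (j.+1, N j)).
- by case: (hg (0%N, 0%N)).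
- by case: (hg (j.+1, N j)).
- by case: (hg (j.+1, N j)).
- by case: (hg (0%N, 0%N)) => _ _ _; exact.
- by case: (hg (j.+1, N j)) => _ _ _; exact.
Qed.

End FastSequences.

(** * Almost constant sequences by damping *)

Section FiniteAlgebras.
Context {R : realType} {H : hilbertType R}.
Implicit Types (A B P K D : op H) (x y z : H) (e C : R) (M : set (op H)).

Definition star_closed M := forall A, M A -> M (star A).

(* Up to errors summable in j, star (W j) * W j is K and consecutive W j have
   orthogonal ranges. *)
Definition almost_constant (W : nat -> op H) K (d : nat -> H) C :=
  [/\ forall j x, nrm (star (W j.+1) (W j x)) <= quarter j * nrm x,
      forall j x, nrm ((star (W j) * W j - K) x) <= quarter j * nrm x,
      forall i j, (i <= j)%N -> nrm (star (W j) (d i)) <= C * quarter j,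
      forall x, (fun j => star (W j) x) @ \oo --> (0 : H) &
      forall j x, nrm (W j x) <= nrm x].

Lemma ip_star_mul B x : ip ((star B * B) x) x = nrm (B x) ^+ 2.
Proof. by rewrite mulE starP2 ipxx. Qed.

Lemma quarter_bound_sqr (a b : R) j : 0 <= a -> 0 <= b ->
  16 ^+ j * a ^+ 2 <= b ^+ 2 -> a <= quarter j * b :> R.
Proof.
move=> a0 b0 h; have q0 := quarter_gt0 (R := R) j.
rewrite -(@ler_pXn2r _ 2) ?nnegrE ?mulr_ge0 // ?(ltW q0) // exprMn -exprM.
have -> : 4^-1 ^+ (j * 2) = (16 ^+ j)^-1 :> R.
  by rewrite mulnC exprM exprVn expr2 -natrM exprVn.
by rewrite mulrC ler_pdivlMr ?exprn_gt0 // mulrC.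
Qed.

(* Along the subsequence the operators X_j, Y_j to be made small are at most
   c 8^-j at one vector xi with A xi <> 0; damping with weights 16^j turns this
   into the bound 4^-j for the operators X_j D and Y_j D. *)
Lemma damped_sequence M (S : nat -> op H) A (d : nat -> H) :
  strong_algebra M -> star_closed M -> (forall n, M (S n)) ->
  (forall n x, nrm (S n x) <= nrm x) ->
  (forall x, (fun n => star (S n) x) @ \oo --> (0 : H)) ->
  scvg (fun n => star (S n) * S n) A -> A != 0 ->
  exists W K C, [/\ forall j, M (W j), M K, pcontr K /\ K != 0, 0 <= C &
    almost_constant W K d C].
Proof.
move=> hM sM MS S1 S0 SA A0.
have MA : M A by apply: (alg_lim hM _ SA) => n; apply: (algM hM) => //; exact: sM.
have pA : pcontr A.
  apply: (scvg_pcontr _ SA) => n; split; first exact: psd_sqr.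
  by move=> x; rewrite ip_star_mul ler_sqr ?nnegrE ?nrm_ge0.
have sA : sa A by case: pA => -[].
have [xi Axi] : exists xi, A xi != 0.
  apply: contrapT => h; move/eqP: A0; apply; apply: op_ext => x.
  by apply/eqP; apply: contrapT => hx; apply: h; exists x; apply/negP.
have xi0 : 0 < nrm xi by apply: lt_le_trans (pcontr_nrm xi pA); exact: nrm_gt0.
(* The factor 4 makes [3 c^2 < |A xi|^2], which is what keeps [D A D] from vanishing. *)
pose c := nrm (A xi) / 4; have c0 : 0 < c by rewrite divr_gt0 ?nrm_gt0.
(* [16^j eps_j^2 = c^2 4^-j]: the weights 16^j leave a summable series. *)
pose eps j := c * (8^-1 ^+ j); have eps0 j : 0 < eps j by rewrite mulr_gt0 ?exprn_gt0.
have [N [Nj N1 N2 N3]] := fast_subsequence xi d S0 SA eps0.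
pose X j := star (S (N j)) * S (N j) - A; pose Y j := star (S (N j.+1)) * S (N j).
have sX j : sa (X j) by apply: saB => //; case: (psd_sqr (S (N j))).
have MX j : M (X j) by apply: (algB hM) => //; apply: (algM hM) => //; exact: sM.
have MY j : M (Y j) by apply: (algM hM) => //; exact: sM.
pose a j := star (Y j) * Y j + star (X j) * X j.
have aE j x : ip (a j x) x = nrm (Y j x) ^+ 2 + nrm (X j x) ^+ 2.
  by rewrite addE ipDl !ip_star_mul.
(* X and Y each contribute at most [c^2 4^-j], in all [2 c^2] times [4/3], which is below
   [3 c^2]. *)
pose e := 3 * c ^+ 2 / nrm xi ^+ 2.
have eE : e * nrm xi ^+ 2 = 3 * c ^+ 2 by rewrite /e mulfVK // sqrf_eq0 gt_eqF.
have [| | | |D [MD pD hD Dxi]] := @damping _ _ M (fun j => 16 ^+ j) a xi e hM.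
- by move=> j; apply: (algD hM); apply: (algM hM) => //; exact: sM.
- by move=> j; apply: psdD; exact: psd_sqr.
- by move=> j; rewrite exprn_ge0.
- move=> n; rewrite eE.
  suff : \sum_(j < n) 16 ^+ j * ip (a j xi) xi <= 3 * c ^+ 2 * (1 - quarter n).
    have := quarter_gt0 (R := R) n; have := sqr_ge0 c; nra.
  elim: n => [|n IHn]; first by rewrite big_ord0 /quarter expr0 subrr mulr0.
  rewrite big_ord_recr /= aE quarterS.
  have hY : nrm (Y n xi) <= eps n.
    apply: le_trans (N2 n) _; rewrite /eps ler_wpM2l ?(ltW c0) // exprS ler_piMl ?exprn_ge0 //; lra.
  have hX : nrm (X n xi) <= eps n by exact: N1.
  have q8 : 16 ^+ n * eps n ^+ 2 = c ^+ 2 * quarter n.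
    rewrite /eps /quarter exprMn mulrCA -exprM mulnC exprM -exprMn.
    by rewrite (_ : 16 * 8^-1 ^+ 2 = 4^-1 :> R) //; lra.
  have hY2 : nrm (Y n xi) ^+ 2 <= eps n ^+ 2 by rewrite ler_sqr ?nnegrE ?nrm_ge0 ?(ltW (eps0 n)).
  have hX2 : nrm (X n xi) ^+ 2 <= eps n ^+ 2 by rewrite ler_sqr ?nnegrE ?nrm_ge0 ?(ltW (eps0 n)).
  have : 16 ^+ n * (nrm (Y n xi) ^+ 2 + nrm (X n xi) ^+ 2) <= 16 ^+ n * (2 * eps n ^+ 2).
    by rewrite ler_wpM2l ?exprn_ge0 //; lra.
  have := mulr_ge0 (sqr_ge0 c) (ltW (quarter_gt0 (R := R) n)).
  rewrite mulrCA q8; lra.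
have sD : sa D by case: pD => -[].
have hDa j x : 16 ^+ j * (nrm (Y j (D x)) ^+ 2 + nrm (X j (D x)) ^+ 2) <= nrm x ^+ 2.
  by rewrite -aE; exact: hD.
have hY j x : nrm (Y j (D x)) <= quarter j * nrm x.
  apply: quarter_bound_sqr; rewrite ?nrm_ge0 //; apply: le_trans (hDa j x).
  by rewrite ler_wpM2l ?exprn_ge0 // lerDl sqr_ge0.
have hX j x : nrm (X j (D x)) <= quarter j * nrm x.
  apply: quarter_bound_sqr; rewrite ?nrm_ge0 //; apply: le_trans (hDa j x).
  by rewrite ler_wpM2l ?exprn_ge0 // lerDr sqr_ge0.
have Wstar j : star (S (N j) * D) = D * star (S (N j)) by rewrite starM sD.
exists (fun j => S (N j) * D), (D * A * D), c; split; first by move=> j; exact: (algM hM).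
- by do 2!apply: (algM hM) => //.
- split; last first.
    (* If K were 0, then [A xi = - A (D xi - xi)] would have squared norm at most [3 c^2], whereas
       it is [16 c^2]. *)
    apply/eqP => K0; have : A (D xi) = 0.
      apply: psd_eq0; first by case: pA.
      by rewrite -(saP _ _ sD) -[D (A _)]/((D * A * D) xi) K0 ip0l.
    move=> ADxi; have := pcontr_nrm (D xi - xi) pA.
    rewrite opB ADxi sub0r nrmN => h1; move: Dxi; rewrite eE => h2.
    have : nrm (A xi) ^+ 2 <= 3 * c ^+ 2.
      by apply: le_trans h2; rewrite ler_sqr ?nnegrE ?nrm_ge0.
    have -> : nrm (A xi) = 4 * c by rewrite /c; field.
    by move: c0; set c' := c; clearbody c'; nra.
  have pK := psd_conj D (proj1 pA); rewrite sD in pK; split=> // x.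
  rewrite !mulE (saP _ _ sD) (le_trans (proj2 pA _)) //.
  by rewrite ler_sqr ?nnegrE ?nrm_ge0 // pcontr_nrm.
- exact: ltW.
split=> [j x|j x|i j ij|x|j x].
- by rewrite Wstar mulE (le_trans (pcontr_nrm _ pD)) //; exact: hY.
- rewrite Wstar (_ : _ - _ = D * X j * D); last by rewrite /X mulrBr mulrBl !mulrA.
  by rewrite !mulE (le_trans (pcontr_nrm _ pD)).
- rewrite Wstar mulE (le_trans (pcontr_nrm _ pD)) // (le_trans (N3 _ _ ij)) //.
  rewrite /eps ler_wpM2l ?(ltW c0) // lerXn2r ?nnegrE //; lra.
- apply/cvg_vec => e' e'0; have /cvg_vec/(_ _ e'0)[n0 hn] := S0 x.
  exists n0 => n n0n; rewrite subr0 Wstar (le_lt_trans (pcontr_nrm _ pD)) //.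
  by have := hn _ (leq_trans n0n (Nj n)); rewrite subr0.
- by rewrite mulE (le_trans (S1 _ _)) // pcontr_nrm.
Qed.

End FiniteAlgebras.

(** * Rotations and the contradiction with finiteness *)

Section FiniteVanishing.
Context {R : realType} {H : hilbertType R}.
Implicit Types (A B P K D : op H) (x y z : H) (e C : R) (M : set (op H)).

Definition finite_algebra M := forall v, M v -> star v * v = 1 -> v * star v = 1.

Lemma isometryP B : star B * B = 1 <-> forall x, nrm (B x) = nrm x.
Proof.
split=> [h x|h].
  by apply/eqP; rewrite -(eqrXn2 (n := 2)) ?nrm_ge0 // -ip_star_mul h oneE ipxx.
apply: sa_form_inj; [by case: (psd_sqr B)|exact: sa1|].
by move=> x; rewrite ip_star_mul h oneE ipxx.
Qed.

(** Writing [x = v w], one has [|V_n^* x - w| = |V_n^* (v w - V_n w)| <= |v w - V_n w|]. That every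
    x has this form is what finiteness provides. *)
Lemma scvg_star_unitary (V : nat -> op H) v :
  (forall n, star (V n) * V n = 1) -> scvg V v -> v * star v = 1 ->
  scvg (fun n => star (V n)) (star v).
Proof.
move=> V1 hV v1 x; apply/cvg_vec => e e0; set w := star v x.
have xE : x = v w by rewrite /w -mulE v1.
have /cvg_vec/(_ _ e0)[n0 hn] := hV w; exists n0 => n /hn; apply: le_lt_trans.
have -> : star (V n) x - w = star (V n) (v w - V n w).
  by rewrite opB -[star _ (V n w)]mulE V1 -xE.
have nV y : nrm (V n y) <= 1 * nrm y by rewrite mul1r (iffLR (isometryP _)).
by have := nrm_star ler01 nV (v w - V n w); rewrite mul1r nrmBC (nrmBC (V n w)).
Qed.

Section Rotation.
Variables (M : set (op H)) (W : nat -> op H) (K f : op H) (d : nat -> H) (C F : R).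
Hypotheses (hM : strong_algebra M) (sM : star_closed M) (MW : forall j, M (W j)).
Hypotheses (Mf : M f) (sf : sa f) (fKf : f * K * f = f).
Hypotheses (hW : almost_constant W K d C) (C0 : 0 <= C) (F0 : 0 <= F).
Hypothesis hF : forall x, nrm (f x) <= F * nrm x.

Let W1 j x : nrm (W j x) <= nrm x. Proof. by case: hW. Qed.
Let W1s j x : nrm (star (W j) x) <= nrm x.
Proof.
rewrite -[leRHS]mul1r; apply: nrm_star => // z; rewrite mul1r; exact: W1.
Qed.

(** If [star (W j) * W j] were K for all j and consecutive ranges were orthogonal, then [f K f = f]
    would make this operator c send [W j f] to [W j.+1 f] and [W j.+1 f] to [- W j f]. It is then a
    quarter turn, and where [c^2 = -1] the Cayley transform of c is c itself. *)
Definition rotator j := W j.+1 * f * star (W j) - W j * f * star (W j.+1).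

Lemma rotator_skew j : star (rotator j) = - rotator j.
Proof. by rewrite /rotator starB !starM !starK sf opprB !mulrA. Qed.

Lemma rotator_mem j : M (rotator j).
Proof.
have h i k : M (W i * f * star (W k)) by apply: (algM hM _ (sM (MW k))); exact: (algM hM).
exact: (algB hM).
Qed.

Lemma rotator_nrm j x :
  nrm (rotator j x) <= F * (nrm (star (W j) x) + nrm (star (W j.+1) x)).
Proof.
rewrite subE !mulE (le_trans (nrmB _ _)) // mulrDr lerD //;
by rewrite (le_trans (W1 _ _)).
Qed.

(* The Cayley transform of [rotator j] sends [W j (f y)] near [W j.+1 (f y)]. *)
Lemma rotator_step j y (u : op H) : (1 - rotator j) * u = 1 + rotator j ->
  nrm (u (W j (f y)) - W j.+1 (f y)) <= 4 * F * nrm (f y) * quarter j.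
Proof.
move=> hu; have [W21 WK _ _ _] := hW; set c := rotator j; set w := f y.
(* The adjoint of the bound [W21]; this is where an operator norm bound is indispensable. *)
have W12 x : nrm (star (W j) (W j.+1 x)) <= quarter j * nrm x.
  rewrite -[_ (W j.+1 x)]/((star (W j) * W j.+1) x) -[W j.+1]starK -starM.
  by apply: nrm_star => [|z]; [exact/ltW/quarter_gt0|exact: W21].
have fKw : f (K w) = w by rewrite -!mulE fKf.
apply: le_trans (proj1 (skew_nrm (u (W j w) - W j.+1 w) (rotator_skew j))) _.
rewrite opB -[_ (u _)]mulE hu.
(* In the exact quarter turn this is 0; what remains are four error terms, each at most
   [F |w| quarter j]. *)
have -> : (1 + c) (W j w) - (1 - c) (W j.+1 w) =
   (W j.+1 (f ((star (W j) * W j - K) w)) - W j (f (star (W j.+1) (W j w)))) +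
   (W j.+1 (f (star (W j) (W j.+1 w))) - W j (f ((star (W j.+1) * W j.+1 - K) w))).
  rewrite /c /rotator !opE !oplE fKw.
  by apply: ip_inj => z; rewrite !ipE; ring.
have bd A x a : 0 <= a -> (forall z, nrm (A z) <= nrm z) -> nrm x <= a * nrm w ->
    nrm (A (f x)) <= F * (a * nrm w).
  by move=> a0 hA hx; rewrite (le_trans (hA _)) // (le_trans (hF _)) // ler_wpM2l.
have q0 := ltW (quarter_gt0 (R := R) j).
have b1 := bd (W j.+1) _ _ q0 (W1 _) (WK j w).
have b2 := bd (W j) _ _ q0 (W1 _) (W21 j w).
have b3 := bd (W j.+1) _ _ q0 (W1 _) (W12 w).
have b4 : nrm (W j (f ((star (W j.+1) * W j.+1 - K) w))) <= F * (quarter j * nrm w).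
  apply: bd => //; apply: le_trans (WK _ _) _; rewrite ler_wpM2r ?nrm_ge0 //.
  exact: quarter_le.
apply: (le_trans (nrmD _ _)).
have := nrmB (W j.+1 (f ((star (W j) * W j - K) w))) (W j (f (star (W j.+1) (W j w)))).
have := nrmB (W j.+1 (f (star (W j) (W j.+1 w)))) (W j (f ((star (W j.+1) * W j.+1 - K) w))).
have -> : 4 * F * nrm w * quarter j = 4 * (F * (quarter j * nrm w)) by ring.
lra.
Qed.

(** [(1 - c) (u - 1) = 2 c], and [1 - c] does not decrease norms as c is skew. *)
Lemma cayley_near1 (c u : op H) x : star c = - c -> (1 - c) * u = 1 + c ->
  star u * u = 1 -> u * star u = 1 -> nrm (star u x - x) <= 2 * nrm (c x).
Proof.
move=> sc hu u1 u2.
have -> : nrm (star u x - x) = nrm (u x - x).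
  have -> : star u x - x = star u (x - u x) by rewrite opB -[star u (u x)]mulE u1.
  have /isometryP -> : star (star u) * star u = 1 by rewrite starK.
  by rewrite nrmBC.
apply: le_trans (proj1 (skew_nrm _ sc)) _; rewrite opB -mulE hu.
have -> : (1 + c) x - (1 - c) x = (2%:R)%:C *: c x.
  by apply: ip_inj => z; rewrite !opE !ipE; ring.
by rewrite nrmZ ger0_norm.
Qed.

Hypothesis dd : forall x e, 0 < e -> exists i, nrm (x - d i) < e.
Hypothesis finM : finite_algebra M.

(* The image of W J (f y) under the inverse of the infinite product of rotations
   stays near W n (f y), which has squared norm about ip (f y) y and is weakly null. *)
Lemma rotation_bound y J : ip (f y) y <= (8 * F * nrm (f y) * quarter J) ^+ 2.
Proof.
have [_ WK Wd Ws0 _] := hW.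
have /choice[u hu] j := cayley hM (rotator_mem j) (rotator_skew j).
have Mu j : M (u j) by case: (hu j).
have u1 j : star (u j) * u j = 1 by case: (hu j).
have u2 j : u j * star (u j) = 1 by case: (hu j).
have uc j : (1 - rotator j) * u j = 1 + rotator j by case: (hu j).
(* New factors enter on the right, so in [V n.+1 - V n = V n (u^* - 1)] the isometry [V n] drops out
   of the norm. *)
pose V n := iteri n (fun k B => B * star (u (J + k)%N)) (1 : op H).
have VS n : V n.+1 = V n * star (u (J + n)%N) by [].
have MV n : M (V n).
  by elim: n => [|n IHn]; [exact: alg1|rewrite VS; apply: (algM hM) => //; exact: sM].
have V1 n : star (V n) * V n = 1.
  elim: n => [|n IHn]; first by rewrite star1 mulr1.
  by rewrite VS starM starK -mulrA (mulrA (star (V n))) IHn mul1r u2.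
have V2 n : V n * star (V n) = 1 by exact: finM.
have nV n x : nrm (V n x) = nrm x by exact: (iffLR (isometryP _)).
have nu j x : nrm (u j x) = nrm x by exact: (iffLR (isometryP _)).
have nVs n x : nrm (star (V n) x) = nrm x.
  by apply: (iffLR (isometryP _)); rewrite starK.
have [v hv] : exists v, scvg V v.
  apply: (cvg_on_dense dd) => [n x|i]; first by rewrite nV.
  (* [d i] is controlled by [W j] only from [j = i] on. The constant collects 2 from [cayley_near1]
     and F times two terms [C quarter n]. *)
  apply: (@quarter_cauchy _ _ _ (4 * F * C) i) => [|n ni]; first by rewrite !mulr_ge0.
  rewrite VS mulE -opB nV.
  apply: le_trans (cayley_near1 _ (rotator_skew _) (uc _) (u1 _) (u2 _)) _.
  have iJ : (i <= J + n)%N by rewrite (leq_trans ni) ?leq_addl.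
  have q1 := quarter_le (R := R) (leq_addl J n).
  have q2 := quarter_le (R := R) (leqnSn (J + n)).
  have h1 := Wd _ _ iJ; have h2 := Wd _ _ (leqW iJ).
  have h3 := rotator_nrm (J + n) (d i).
  have h4 : C * quarter (J + n) <= C * quarter n by rewrite ler_wpM2l.
  have h5 : C * quarter (J + n).+1 <= C * quarter n.
    by rewrite ler_wpM2l // (le_trans q2).
  have : F * (nrm (star (W (J + n)) (d i)) + nrm (star (W (J + n).+1) (d i))) <=
    F * (2 * (C * quarter n)) by rewrite ler_wpM2l //; lra.
  have -> : 4 * F * C * quarter n = 2 * (F * (2 * (C * quarter n))) by ring.
  lra.
have Mv : M v by exact: alg_lim hv.
have v1 : star v * v = 1.
  apply/isometryP => x; have := cvg_nrm (hv x).
  rewrite (_ : (fun n => _) = fun=> nrm x); last by apply/funext => n; rewrite nV.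
  by move=> h; apply: (cvg_unique _ h (cvg_cst _)).
(* The only use of finiteness on a genuine limit: the isometry v is unitary. *)
have hvs := scvg_star_unitary V1 hv (finM Mv v1).
set w := f y; pose g j := W j w; pose E := 4 * F * nrm w.
have E0 : 0 <= E by rewrite !mulr_ge0 ?nrm_ge0.
have near n : nrm (star (V n) (g J) - g (J + n)%N) <= 2 * E * (quarter J - quarter (J + n)).
  elim: n => [|n IHn]; first by rewrite addn0 star1 oneE !subrr nrm0 mulr0.
  rewrite VS starM starK mulE addnS.
  have := nrm_tri (u (J + n)%N (g (J + n)%N)) (u (J + n)%N (star (V n) (g J))) (g (J + n).+1).
  rewrite -opB nu.
  have := rotator_step y (uc (J + n)%N); rewrite -/w -/E.
  have := mulr_ge0 E0 (ltW (quarter_gt0 (R := R) (J + n))).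
  by rewrite quarterS; move: IHn; rewrite /g; nra.
have E2 : 0 <= 2 * E by rewrite mulr_ge0.
have near2 n : nrm (star (V n) (g J) - g (J + n)%N) ^+ 2 <= (2 * E * quarter J) ^+ 2.
  have q0 := ltW (quarter_gt0 (R := R) J).
  apply: lerXn2r; rewrite ?nnegrE ?nrm_ge0 ?(mulr_ge0 E2 q0) //.
  apply: le_trans (near n) _; apply: ler_wpM2l; first exact: E2.
  by rewrite gerBl; exact/ltW/quarter_gt0.
have -> : 8 * F * nrm w * quarter J = 2 * E * quarter J by rewrite /E; ring.
have l1 : (fun n => nrm (g (J + n)%N) ^+ 2) @ \oo --> ip (f y) y.
  have WKc : scvg (fun j => star (W j) * W j) K.
    move=> x; apply/cvg_vec => e e0; have n1 : 0 < nrm x + 1 by rewrite ltr_wpDl ?nrm_ge0.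
    have [n0 hn] := quarter_small (divr_gt0 e0 n1); exists n0 => n /hn.
    rewrite ltr_pdivlMr // -subE => h; apply: le_lt_trans (WK _ _) _.
    have := quarter_gt0 (R := R) n; lra.
  have -> : ip (f y) y = ip (K w) w.
    by rewrite /w -(saP _ _ sf) -[f (K _)]/((f * K * f) y) fKf.
  rewrite (_ : (fun n => _) = (fun n => ip ((star (W (n + J)%N) * W (n + J)%N) w) w)); last first.
    by apply/funext => n; rewrite ip_star_mul addnC.
  rewrite (cvg_shiftn J (fun n => ip ((star (W n) * W n) w) w)).
  exact: (scvg_form (x := w) WKc).
have l2 : (fun n => ip (star (V n) (g J)) (g (J + n)%N)) @ \oo --> (0 : R).
  rewrite (_ : (fun n => _) =
      (fun n => ip (star (W (n + J)%N) (star (V n) (g J))) w)); last first.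
    by apply/funext => n; rewrite [RHS]starP2 (addnC n).
  rewrite -(ip0l w); apply: cvg_ip; last exact: cvg_cst.
  have Ws : scvg (fun n => star (W (n + J)%N)) 0.
    by move=> x; rewrite (cvg_shiftn J (fun n => star (W n) x)); exact: Ws0.
  rewrite -(zeroE (star v (g J))); apply: (@scvg_app _ _ 1 _ _ _ _ _ Ws (hvs _)).
  by move=> n x; rewrite mul1r; exact: W1s.
(* The squared distance tends to [|g J|^2 + <f y, y>] as the cross term dies, yet stays below the
   bound [near2]. *)
have l3 : (fun n => nrm (star (V n) (g J) - g (J + n)%N) ^+ 2) @ \oo -->
    nrm (g J) ^+ 2 + ip (f y) y - 2 * 0.
  rewrite (_ : (fun n => _) = (fun n => nrm (g J) ^+ 2 + nrm (g (J + n)%N) ^+ 2 -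
      2 * ip (star (V n) (g J)) (g (J + n)%N))); last first.
    apply/funext => n; rewrite -[in LHS]ipxx ipBl !ipBr !ipxx nVs (ipC (g _)).
    by rewrite mulr2n; ring.
  apply: cvgB; last exact: cvgMr.
  by apply: cvgD => //; exact: cvg_cst.
have := cvg_to_le l3 near2; have := sqr_ge0 (nrm (g J)); lra.
Qed.

End Rotation.

Theorem finite_vanishing M (S : nat -> op H) A : separable_space H ->
  strong_algebra M -> star_closed M -> finite_algebra M ->
  (forall n, M (S n)) -> (forall n x, nrm (S n x) <= nrm x) ->
  (forall x, (fun n => star (S n) x) @ \oo --> (0 : H)) ->
  scvg (fun n => star (S n) * S n) A -> A = 0.
Proof.
move=> /dense_sequence[d dd] hM sM finM MS S1 S0 SA; apply/eqP/negPn/negP => A0.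
have [W [K [C [MW MK [pK K0] C0 hW]]]] := damped_sequence d hM sM MS S1 S0 SA A0.
have [f [gf pf fKf [y fy]]] := generalized_inverse pK K0.
have Mf : M f by exact: strong_gen_min gf.
have [F F0 hF] := opbd f.
pose E := 8 * F * nrm (f y); have E0 : 0 <= E by rewrite !mulr_ge0 ?nrm_ge0 ?ltW.
have E1 : 0 < E ^+ 2 + 1 by rewrite ltr_wpDl ?sqr_ge0.
(* [<f y, y>] is a fixed positive number, while the bound of [rotation_bound] tends to 0 with J. *)
have [J hJ] := quarter_small (divr_gt0 fy E1).
have := rotation_bound hM sM MW Mf (proj1 pf) fKf hW C0 (ltW F0) hF dd finM y J.
rewrite -/E exprMn; have := hJ _ (leqnn J); rewrite ltr_pdivlMr //.
have q0 := quarter_gt0 (R := R) J; have q1 : quarter J <= 1 :> R.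
  by have := quarter_le (R := R) (leq0n J); rewrite {2}/quarter expr0.
have : E ^+ 2 * quarter J ^+ 2 <= E ^+ 2 * quarter J.
  by rewrite ler_wpM2l ?sqr_ge0 // expr2 ler_piMr // ltW.
lra.
Qed.

End FiniteVanishing.

(** * The convergence theorem *)

Section VonNeumannAlgebras.
Context {R : realType} {H : hilbertType R}.
Implicit Types (A B P : op H) (M : set (H -> H)).

Lemma closure_scvg M (G : nat -> op H) A : (forall n, M (G n)) -> scvg G A ->
  closure (M : set {ptws H -> H}) ((A : H -> H) : {ptws H -> H}).
Proof.
move=> MG GA B; have hG : ((fun n => G n : H -> H) : nat -> {ptws H -> H}) @ \oo -->
    ((A : H -> H) : {ptws H -> H}).
  apply/cvg_sup => x U [V [[W oW <-] /= WA WU]].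
  apply: (filterS WU); rewrite nbhs_simpl /=.
  by have := GA x W (open_nbhs_nbhs (conj oW WA)).
move=> /hG[n0 _ hn]; exists (G n0 : H -> H); split; first exact: MG.
by apply: hn => /=.
Qed.

Definition op_trace M : set (op H) := [set A | M (A : H -> H)].

Lemma von_neumann_strong M : von_neumann_algebra M ->
  strong_algebra (op_trace M) /\ star_closed (op_trace M).
Proof.
move=> [[bM M1 ML MM Madj] Mcl]; split; last first.
  move=> A MA; change (M (star A : H -> H)); rewrite -adjointE; exact: Madj.
split=> //.
- move=> A B MA MB; change (M (opf (A - B))).
  rewrite (_ : opf (A - B) = fun x => - 1 *: B x + A x); first exact: ML.
  by apply/funext => x; rewrite subE scaleN1r addrC.
- by move=> A B; exact: MM.
- move=> a A MA; change (M (opf (a *: A))).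
  (* The linearity axiom has the form [l A + B], so a multiple needs the zero operator, itself
     obtained as [- A + A]. *)
  rewrite (_ : opf (a *: A) = fun x => a%:C *: A x + (0 : op H) x).
    apply: (ML _ _ _ MA); rewrite (_ : opf 0 = fun x => - 1 *: A x + A x); first exact: ML.
    by apply/funext => x; rewrite zeroE scaleN1r addNr.
  by apply/funext => x; rewrite zeroE addr0.
- move=> G A MG GA; apply: Mcl; first exact: bounded_op.
  exact: (closure_scvg MG GA).
Qed.

Lemma finite_von_neumann_finite M : finite_von_neumann_algebra M ->
  finite_algebra (op_trace M).
Proof.
move=> [_ fM] v Mv v1; apply: op_ext => x; rewrite mulE -[star v x]/((star v : H -> H) x).
rewrite -adjointE -[RHS]/(idfun x) -(fM v Mv) //.
by rewrite adjointE; apply/funext => y; rewrite /= -[RHS]/((1 : op H) y) -v1.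
Qed.

End VonNeumannAlgebras.

Section Convergence.
Context {R : realType} {H : hilbertType R}.
Implicit Types (A B P : op H).

Definition limit_data (G : nat -> op H) (T P : op H) :=
  [/\ dec_pcontr G, scvg G T, pcontr T /\ (forall n, psd (G n - T)),
      scvg (fun n => T ^+ n) P & [/\ strong_gen T P, sa P, P * P = P & T * P = P]].

Lemma limit_data_of (T : nat -> H -> H) : decreasing_contractions T ->
  exists G L P, [/\ limit_data G L P, T = (fun n => G n : H -> H),
    ordered_product T = (fun n => prod_op G n : H -> H) &
    spectral_projection (strong_lim T) [set 1] = P].
Proof.
move=> /dec_pcontr_of[G hG ->]; have [L GL [pL GLp]] := dec_pcontr_lim hG.
have [P [hP gP sP PP LP]] := fix_projection pL; exists G, L, P; split=> //.
- by apply/funext => n; rewrite ordered_productE.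
- have -> : strong_lim (fun n => G n : H -> H) = L.
    by apply/funext => x; apply: cvg_lim (GL x); exact: norm_hausdorff.
  by apply: spectral_projection_one => // x; exact: fix_projectionP.
Qed.

Lemma scvg_star_strong (S : nat -> op H) P : scvg S P -> sa P ->
  scvg (fun n => star (S n)) P ->
  star_strong_cvg_to (fun n => S n : H -> H) P.
Proof.
move=> hS sP hs; split=> x; first exact: hS.
rewrite adjointE sP (_ : (fun n => _) = (fun n => star (S n) x)); first exact: hs.
by apply/funext => n; rewrite adjointE.
Qed.

Lemma prod_cvg_star G T P (S : H -> H) : limit_data G T P ->
  strong_cvg_to (fun n => prod_op G n : H -> H) S ->
  star_strong_cvg_to (fun n => prod_op G n : H -> H) P.
Proof.
move=> [hG GT [pT GTp] hP [_ sP PP TP]] hS.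
apply: scvg_star_strong => //; last exact: star_prod_cvg GT GTp hP sP TP.
by move=> x; rewrite -(prod_cvg_limit hG GT GTp hP sP TP (hS x)); exact: hS.
Qed.

(** [P] belongs to M as a limit of polynomials in [T], itself the limit of the factors. Since
    [S n.+1 = G n.+1 * S n], the operators [star (S n) * S n] decrease, and their limit being 0
    means [|S n x| -> 0]. *)
Lemma prod_cvg_finite G T P (M : set (op H)) : limit_data G T P ->
  separable_space H -> strong_algebra M -> star_closed M -> finite_algebra M ->
  (forall n, M (G n)) -> scvg (prod_op G) P.
Proof.
move=> [hG GT [pT GTp] hP [gP sP PP TP]] sepH hM sM finM MG.
have MT : M T by exact: alg_lim GT.
have MP : M P by exact: strong_gen_min gP.
pose S n := prod_op G n - P; pose A n := star (S n) * S n.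
have MS n : M (S n).
  by apply: (algB hM) => //; elim: n => [|n IHn] //=; exact: (algM hM).
have PS n : prod_op G n * P = P by exact: prod_mul_fix GTp TP n.
have SP n : S n = prod_op G n * (1 - P) by rewrite mulrBr mulr1 PS.
have pP : projector P by split.
have S1 n x : nrm (S n x) <= nrm x.
  rewrite SP mulE (le_trans (prod_nrm hG n _)) // pcontr_nrm //.
  exact/proj_pcontr/proj1B.
have pA n : pcontr (A n).
  split; first exact: psd_sqr.
  by move=> x; rewrite ip_star_mul ler_sqr ?nnegrE ?nrm_ge0.
have SS n : S n.+1 = G n.+1 * S n.
  by rewrite /S mulrBr (mul_fix hG GTp TP).
have dA n : psd (A n - A n.+1).
  split; first by apply: saB; [case: (psd_sqr (S n))|case: (psd_sqr (S n.+1))].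
  move=> x; rewrite subE ipBl !ip_star_mul SS mulE subr_ge0 ler_sqr ?nnegrE ?nrm_ge0 //.
  by apply: pcontr_nrm; case: hG.
have [A0 hA _] := scvg_dec pA dA.
have S0 x : (fun n => star (S n) x) @ \oo --> (0 : H).
  have hs := star_prod_cvg hG GT GTp hP sP TP.
  rewrite -(subrr (P x)); have := scvgB hs (scvg_cst (A := P)) (x := x).
  rewrite subE; apply: cvg_trans; apply: near_eq_cvg; apply: nearW => n.
  by rewrite /S starB sP.
have A00 := finite_vanishing sepH hM sM finM MS S1 S0 hA.
move=> x; apply/cvg_vec => e e0; have := scvg_form (x := x) hA.
rewrite A00 zeroE ip0l => /cvg_eventually/(_ (e ^+ 2)); rewrite exprn_gt0 // => /(_ isT)[n0 hn].
exists n0 => n /hn; rewrite subr0 ip_star_mul ger0_norm ?sqr_ge0 // -subE -/(S n).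
by rewrite ltr_sqr ?nnegrE ?nrm_ge0 ?ltW.
Qed.

End Convergence.

Theorem theorem1p3 (R : realType) :
  ((forall H : hilbertType R,
      separable_space H -> ~ finite_dimensional [set: H] ->
      forall T : nat -> H -> H, decreasing_contractions T ->
        strong_cvg (ordered_product T))
   <->
   (forall H : hilbertType R,
      separable_space H -> ~ finite_dimensional [set: H] ->
      forall T : nat -> H -> H, decreasing_contractions T ->
        star_strong_cvg_to (ordered_product T)
          (spectral_projection (strong_lim T) [set 1])))
  /\
  (forall H : hilbertType R,
     separable_space H -> ~ finite_dimensional [set: H] ->
     forall T : nat -> H -> H, decreasing_contractions T ->
       (exists n, ~ essential_spectrum (T n) 1) \/
       finite_von_neumann_algebra (generated_von_neumann_algebra (range T)) ->
       strong_cvg (ordered_product T)).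
Proof.
split; [split=> h H sepH infH T dT|move=> H sepH infH T dT].
- have [S _ hS] := h H sepH infH T dT.
  have [G [L [P [hL _ prodE ->]]]] := limit_data_of dT.
  by move: hS; rewrite prodE; exact: prod_cvg_star hL.
- have [G [L [P [_ _ prodE PE]]]] := limit_data_of dT.
  have [hS _] := h H sepH infH T dT; exists P; first exact: bounded_op.
  by rewrite -PE.
- have [G [L [P [hL TE prodE _]]]] := limit_data_of dT.
  move=> hyp; exists P; first exact: bounded_op.
  rewrite prodE; case: hyp => [[n ess]|fM] x.
    move: ess; rewrite TE; have [hG GT [pT GTp] hP [_ sP PP TP]] := hL.
    move=> ess; apply: (prod_cvg_essential hG _ _ ess) => [m|y]; first exact: mul_fix GTp TP m.
    exact: prod_weak_cvg GT GTp hP sP TP x y.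
  have [hM sM] := von_neumann_strong (proj1 fM).
  apply: (prod_cvg_finite hL sepH hM sM (finite_von_neumann_finite fM)) => m.
  by apply: sub_gen_smallest; exists m => //; rewrite TE.
Qed.
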